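(* Let $c>0$, $C>0$ and $\alpha,\alpha'\in(0,1)$ satisfy $2\alpha+\alpha'<1$. Then there is a constant $D>0$ such that for each $\delta\in(0,\delta_0]$ with $\delta\le D^{\frac{1}{1-(2\alpha+\alpha')}}$ there exist $l_\delta>0$ and $r_\delta>0$, independent of $R$, with the following property. Assume that a minimizer $u^R:B_R\to\mathbb{R}^2$, a ball $B_l(x_0)\subset B_R$ and a set $\Sigma\subset(0,R)$ satisfy $$|u^R(x)-a|\le c\,\delta^{\alpha},\qquad x\in B_l(x_0)\setminus\tilde\Sigma,\qquad \tilde\Sigma=\{x\in B_R:\ |x|\in\Sigma\},$$ and $$|\Sigma|\le\frac{C}{\delta^{1+\alpha'}}.$$ Then $l\ge l_\delta$ and $|x_0|\ge r_\delta$ imply $$|u^R(x_0)-a|\le 2\delta.$$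
   Context: $N\ge 3$ is an integer and $\omega$ is the rotation of $\mathbb{R}^2$ by $\frac{2\pi}{N}$, the generator of the rotation group $C_N$. $W:\mathbb{R}^2\to\mathbb{R}$ is a smooth function such that: (i) $W(\omega u)=W(u)$ for all $u$; (ii) $W\ge 0$ and the set of zeros of $W$ is exactly $A=\{a,\omega a,\dots,\omega^{N-1}a\}$ for some $a\in\mathbb{R}^2\setminus\{0\}$, and the Hessian $W_{uu}(a)$ is positive definite; (iii) $W_u(u)\cdot u\ge0$ for $|u|$ sufficiently large. $B_R$ is the ball of radius $R$ centered at the origin of $\mathbb{R}^2$, $B_l(x_0)$ is the ball of radius $l$ centered at $x_0$, and $|\Sigma|$ is the Lebesgue measure of $\Sigma$. A minimizer $u^R:B_R\to\mathbb{R}^2$ means a minimizer of $J_{B_R}(v)=\int_{B_R}\big(\frac{|\nabla v|^2}{2}+W(v)\big)dx$ in the class of $C_N$-equivariant maps ($v(\omega x)=\omega v(x)$). It is a standing assumption that minimizers satisfy $\|u^R\|_{L^\infty}+\|\nabla u^R\|_{L^\infty}\le M$ for some $M>0$ independent of $R$. $\delta_W,c_W,C_W>0$ are fixed constants (with $\delta_W$ small) such that $|z-a|=\delta\le\delta_W$ implies $\frac12c_W^2\delta^2\le W(z)\le\frac12C_W^2\delta^2$, and such that $\delta\in(0,\delta_W]$, $|z|\le M$, $\min_{1\le j\le N}|z-\omega^{j-1}a|\ge\delta$ imply $W(z)\ge\frac12c_W^2\delta^2$. A number $\delta^*\in(0,\delta_W]$ is fixed, and $\delta_0\in(0,\delta_W]$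 is a fixed number (depending on $\delta^*$) such that for each unit vector $n\in\mathbb{R}^2$, each $\delta\in(0,\delta_0]$ and each $d>\delta$ with $a+dn\in B_M\setminus\bigcup_{j=2}^NB_{\delta^*}(\omega^{j-1}a)$ one has $W(a+\delta n)<W(a+dn)$. *)

(* Defs.v *)
From HB Require Import structures.
From mathcomp Require Import all_boot all_order all_algebra.
From mathcomp Require Import all_classical all_reals all_analysis.

Set Implicit Arguments.
Unset Strict Implicit.
Unset Printing Implicit Defensive.

Import Order.TTheory GRing.Theory Num.Theory.
Import numFieldNormedType.Exports.

Local Open Scope classical_set_scope.
Local Open Scope ring_scope.

(** The Euclidean plane is [R * R]; its library norm is the sup norm, so the
    Euclidean inner product, norm and (open) discs are introduced here. *)

Definition dot2 (R : realType) (x y : R * R) : R := x.1 * y.1 + x.2 * y.2.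

Definition norm2 (R : realType) (x : R * R) : R := Num.sqrt (dot2 x x).

Definition disc (R : realType) (c : R * R) (r : R) : set (R * R) :=
  [set x | norm2 (x - c) < r].

Definition rot (R : realType) (N : nat) (x : R * R) : R * R :=
  let t := 2 * pi / N%:R in
  (cos t * x.1 - sin t * x.2, sin t * x.1 + cos t * x.2).

(** Classical partial derivatives; [false] is the first variable and [true]
    the second one. *)

Definition axis (R : realType) (i : bool) : R * R :=
  if i then (0, 1) else (1, 0).

Definition partial (R : realType) (i : bool) (f : R * R -> R) : R * R -> R :=
  fun x => 'D_(axis R i) f x.

Definition grad (R : realType) (f : R * R -> R) (x : R * R) : R * R :=
  (partial false f x, partial true f x).

Fixpoint Ck (R : realType) (k : nat) (f : R * R -> R) : Prop :=
  continuous f /\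
  if k is k'.+1 then
    forall i, (forall x, derivable f x (axis R i)) /\ Ck k' (partial i f)
  else True.

Definition smooth (R : realType) (f : R * R -> R) : Prop :=
  forall k, Ck k f.

Definition hessian (R : realType) (f : R * R -> R) (x : R * R) : 'M[R]_2 :=
  \matrix_(i, j) partial (i == 1) (partial (j == 1) f) x.

Definition posdef (R : realType) (n : nat) (H : 'M[R]_n) : Prop :=
  forall h : 'rV[R]_n, h != 0 -> 0 < (h *m H *m h^T) 0 0.

Definition potential (R : realType) (N : nat) (W : R * R -> R) (a : R * R) :
    Prop :=
  [/\ smooth W,
      forall u, W (rot N u) = W u,
      (forall u, 0 <= W u) /\
        [set u | W u = 0] = [set iter j (rot N) a | j in [set j | (j < N)%N]],
      a != 0 /\ posdef (hessian W a) &
      exists r, forall u, r <= norm2 u -> 0 <= dot2 (grad W u) u].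

(** Planar Lebesgue measure. *)
Definition leb2 (R : realType) :
    {measure set (measurableTypeR R * measurableTypeR R) -> \bar R} :=
  (lebesgue_measure \x lebesgue_measure)%E.

(** Off Borel sets, [lebesgue_measure] is the Lebesgue outer measure, so this is
    Lebesgue measurability and [lebesgue_measure S] is then the measure of [S]. *)
Definition lebesgue_measurable (R : realType) (S : set R) : Prop :=
  (@lebesgue_measure R).-caratheodory S.

Definition test_function (R : realType) (Omega : set (R * R))
    (phi : R * R -> R) : Prop :=
  smooth phi /\
  exists K, [/\ compact K, K `<=` Omega & forall x, ~ K x -> phi x = 0].

Definition L2 (R : realType) (Omega : set (R * R)) (f : R * R -> R) : Prop :=
  measurable_fun (Omega : set (measurableTypeR R * measurableTypeR R)) f /\
  (\int[leb2 R]_(x in Omega) ((f x ^+ 2)%:E) < +oo)%E.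

Definition weak_grad (R : realType) (Omega : set (R * R))
    (f : R * R -> R) (g : R * R -> R * R) : Prop :=
  forall phi, test_function Omega phi ->
    (\int[leb2 R]_(x in Omega) (f x * partial false phi x)) =
      - (\int[leb2 R]_(x in Omega) ((g x).1 * phi x)) /\
    (\int[leb2 R]_(x in Omega) (f x * partial true phi x)) =
      - (\int[leb2 R]_(x in Omega) ((g x).2 * phi x)).

(** [f] belongs to $W^{1,2}(\Omega)$ and [g] represents its gradient. *)
Definition sobolev (R : realType) (Omega : set (R * R))
    (f : R * R -> R) (g : R * R -> R * R) : Prop :=
  [/\ L2 Omega f, L2 Omega (fun x => (g x).1), L2 Omega (fun x => (g x).2) &
      weak_grad Omega f g].

(** A map [v] into the plane goes together with its gradient [Dv], where
    [(Dv x).1] and [(Dv x).2] are the gradients of the components of [v]. *)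
Definition admissible (R : realType) (N : nat) (rho : R)
    (v : R * R -> R * R) (Dv : R * R -> (R * R) * (R * R)) : Prop :=
  [/\ forall x, disc 0 rho x -> v (rot N x) = rot N (v x),
      sobolev (disc 0 rho) (fun x => (v x).1) (fun x => (Dv x).1) &
      sobolev (disc 0 rho) (fun x => (v x).2) (fun x => (Dv x).2)].

Definition frob (R : realType) (A : (R * R) * (R * R)) : R :=
  Num.sqrt (dot2 A.1 A.1 + dot2 A.2 A.2).

Definition energy (R : realType) (W : R * R -> R) (rho : R)
    (v : R * R -> R * R) (Dv : R * R -> (R * R) * (R * R)) : \bar R :=
  (\int[leb2 R]_(x in disc 0%R rho)
     (frob (Dv x) ^+ 2 / 2 + W (v x))%:E)%E.

(** Minimizers are taken continuous because their pointwise values are used: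
    this selects the representative in the Sobolev class. *)
Definition minimizer (R : realType) (N : nat) (W : R * R -> R) (rho : R)
    (u : R * R -> R * R) (Du : R * R -> (R * R) * (R * R)) : Prop :=
  [/\ {in disc 0 rho, continuous u},
      admissible N rho u Du &
      forall v Dv, admissible N rho v Dv ->
        (energy W rho u Du <= energy W rho v Dv)%E].

Definition Linfty (R : realType) (Omega : set (R * R)) (f : R * R -> R) :
    \bar R :=
  Lnorm (leb2 R) +oo%E (EFin \o (f \_ Omega)).

Definition minimizers_bounded (R : realType) (N : nat) (W : R * R -> R)
    (M : R) : Prop :=
  forall (rho : R) u Du, 0 < rho -> minimizer N W rho u Du ->
    (Linfty (disc 0%R rho) (fun x => norm2 (u x)) +
     Linfty (disc 0%R rho) (fun x => frob (Du x)) <= M%:E)%E.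

Definition quadratic_bounds (R : realType) (N : nat) (W : R * R -> R)
    (a : R * R) (M deltaW cW CW : R) : Prop :=
  (forall z delta, norm2 (z - a) = delta -> delta <= deltaW ->
     cW ^+ 2 * delta ^+ 2 / 2 <= W z <= CW ^+ 2 * delta ^+ 2 / 2) /\
  (forall z delta, 0 < delta <= deltaW -> norm2 z <= M ->
     (forall j, (j < N)%N -> delta <= norm2 (z - iter j (rot N) a)) ->
     cW ^+ 2 * delta ^+ 2 / 2 <= W z).

Definition radial_monotone (R : realType) (N : nat) (W : R * R -> R)
    (a : R * R) (M deltastar delta0 : R) : Prop :=
  forall n delta d, norm2 n = 1 -> 0 < delta <= delta0 -> delta < d ->
    disc 0 M (a + d *: n) ->
    (forall j, (0 < j < N)%N ->
       ~ disc (iter j (rot N) a) deltastar (a + d *: n)) ->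
    W (a + delta *: n) < W (a + d *: n).

(* Main.v *)
Require Import Defs.
From HB Require Import structures.
From mathcomp Require Import all_boot all_order all_algebra.
From mathcomp Require Import all_classical all_reals all_analysis.
From mathcomp Require Import measurable_realfun.
From mathcomp Require Import ring lra.
(* Below, [rot] is the rotation of the plane and not that of sequences. *)
Import Defs.
Import Order.TTheory GRing.Theory Num.Theory.
Import numFieldNormedType.Exports.
Set Implicit Arguments.
Unset Strict Implicit.
Unset Printing Implicit Defensive.
Local Open Scope classical_set_scope.
Local Open Scope ring_scope.

(** Write x_j and a_j for the images of x_0 and a under the j-th power of the
    rotation, E(s) for the energy of u in the union A(s) of the discs of
    radius s around the points x_j, and e_k = E(k).

    Energy comparison. When x_0 is far from the origin the discs around the
    x_j are disjoint, so that u can be modified in all of them at once without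
    losing equivariance: with z_j a smooth cutoff that is 1 on the disc of
    radius k around x_j and 0 off the disc of radius k + 1, the competitor
      v = u + sum_j z_j (a_j - u)
    is the well a_j on each inner disc and u outside. Minimality leaves only
    the rings A(k+1) \ A(k) to be estimated. Where u is so close to a_j that
    the quadratic bounds of W apply, the density of v is at most a constant
    times that of u; elsewhere (the bad set, where |x| lies in Sigma) it is at
    most a constant, since u and its gradient are bounded. Thus
      e_{k+1} <= C1 (e_{k+1} - e_k) + C2 (b_{k+1} - b_k),
    where b_k is the area of the bad part of A(k) ([compare_energy],
    [compare_orbit_energy]).

    Bounded energy. The bad set consists of circular shells of total width
    little more than |Sigma|. Far from the origin a shell crosses a disc of radius k like a
    strip, so b_k <= C4 k ([shell_area], [bad_set_orbit_area]). Since e_k grows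
    at most quadratically, telescoping the inequality makes it linear and
    telescoping once more makes it bounded ([energy_bounded]), with a bound
    that does not depend on R. Hence some ring of width 3 with a large inner
    radius r carries as little energy as desired ([exists_quiet_ring]).

    From small energy to pointwise information. A bounded weak gradient makes
    the continuous map u Lipschitz ([weak_grad_lipschitz]), so a point where
    |u - a_j| >= 2 delta for all j costs a fixed amount of energy nearby:
    little energy forces u to be 2 delta-close to some well
    ([near_some_well]). By continuity that well cannot change along a path
    ([path_same_well]). On every circle that does not surround the origin and
    has diameter larger than |Sigma|, and on every radial segment longer than
    |Sigma|, there is a point where |x| avoids Sigma, hence where u is already
    known to be near a ([good_angle], [exists_outside]).

    Conclusion ([close_of_quiet_ring]). On the middle part of the quiet ring u
    is therefore 2 delta-close to a, without exception. The energy comparison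
    can be repeated there with an empty bad set, and shows that the whole disc
    of radius r + 2 around x_0 has little energy. So u is 2 delta-close to some
    well on the disc of radius r + 1, and a segment from x_0 pointing away from
    the origin reaches a point where that well is a.

    The constant D only has to make c delta^alpha and delta small compared with
    delta_W and with the distance between the wells. *)

(** * Closure properties of smooth functions of two variables *)

Lemma fst_continuous (R : realType) : continuous (fst : R * R -> R).
Proof. by move=> x; exact: cvg_fst. Qed.

Lemma snd_continuous (R : realType) : continuous (snd : R * R -> R).
Proof. by move=> x; exact: cvg_snd. Qed.

(** A directional derivative is the derivative at 0 along the line; this and its
    converse transport the one-variable rules to the plane. *)
Lemma is_derive_line (R : realType) (f : R * R -> R) (x v : R * R) (d : R) :
  is_derive (0 : R) (1 : R) (fun t => f (x + t *: v)) d -> is_derive x v f d.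
Proof.
have E : (fun h : R => h^-1 *: ((f \o shift x) (h *: v) - f x)) =
  (fun h : R => h^-1 *: (((fun t : R => f (x + t *: v)) \o shift 0) (h *: 1)
     - f (x + 0 *: v))).
  by apply/funext => h /=; rewrite scale0r !addr0 [h%:A]mulr1 [x + _]addrC.
case=> df vf; split; first by rewrite /derivable E.
by rewrite -vf /derive E.
Qed.

Lemma is_derive_to_line (R : realType) (f : R * R -> R) (x v : R * R) (t d : R) :
  is_derive (x + t *: v) v f d ->
  is_derive t (1 : R) (fun t => f (x + t *: v)) d.
Proof.
have E : (fun h : R => h^-1 *: ((f \o shift (x + t *: v)) (h *: v) - f (x + t *: v))) =
  (fun h : R => h^-1 *: (((fun t : R => f (x + t *: v)) \o shift t) (h *: 1)
     - f (x + t *: v))).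
  apply/funext => h /=; rewrite [h *: 1]mulr1 scalerDl.
  by rewrite addrCA addrA [x + _]addrC -!addrA.
case=> df vf; split; first by rewrite /derivable -E.
by rewrite -vf /derive -E.
Qed.

Lemma is_derive_comp2 (R : realType) (h : R -> R) (q : R * R -> R)
    (x v : R * R) (a b : R) :
  is_derive (q x) 1 h a -> is_derive x v q b ->
  is_derive x v (h \o q) (a * b).
Proof.
move=> dh dq; apply: is_derive_line.
have := @is_derive1_comp R h (fun t : R => q (x + t *: v)) 0 a b.
apply; first by rewrite scale0r addr0.
by apply: is_derive_to_line; rewrite scale0r addr0.
Qed.

Lemma Ck_cont (R : realType) k (f : R * R -> R) : Ck k f -> continuous f.
Proof. by case: k => [|k] []. Qed.

Lemma smooth_cont (R : realType) (f : R * R -> R) : smooth f -> continuous f.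
Proof. by move/(_ 0%N)/Ck_cont. Qed.

Lemma CkW (R : realType) k (f : R * R -> R) : Ck k.+1 f -> Ck k f.
Proof.
elim: k f => [|k IH] f [cf] df; first by split.
by split=> // i; split; [exact: (df i).1 | apply: IH; exact: (df i).2].
Qed.

(** Exhibiting the partial derivatives g replaces the computation of [partial],
    which is defined by a limit. *)
Lemma CkS_intro (R : realType) k (f : R * R -> R) (g : bool -> R * R -> R) :
  continuous f ->
  (forall i x, is_derive x (axis R i) f (g i x)) ->
  (forall i, Ck k (g i)) -> Ck k.+1 f.
Proof.
move=> cf dg cg; split=> // i; split=> [x|]; first exact: (@ex_derive _ _ _ _ _ _ _ (dg i x)).
have -> : partial i f = g i by apply/funext => x; exact: derive_val.
exact: cg.
Qed.

Lemma smooth_is_derive (R : realType) (f : R * R -> R) i x :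
  smooth f -> is_derive x (axis R i) f (partial i f x).
Proof. by move=> /(_ 1%N)[_ /(_ i)[df _]]; exact: derivableP. Qed.

Lemma smooth_partial (R : realType) (f : R * R -> R) i :
  smooth f -> smooth (partial i f).
Proof. by move=> sf k; have [_ /(_ i)[]] := sf k.+1. Qed.

Lemma smooth_intro (R : realType) (f : R * R -> R) (g : bool -> R * R -> R) :
  continuous f -> (forall i x, is_derive x (axis R i) f (g i x)) ->
  (forall i, smooth (g i)) -> smooth f.
Proof.
move=> cf dg sg [|k]; first by split.
by apply: CkS_intro dg _ => // i; exact: sg.
Qed.

Lemma Ck_cst (R : realType) k (c : R) : Ck k (cst c : R * R -> R).
Proof.
elim: k c => [|k IH] c; first by split=> //; exact: cst_continuous.
by apply: (CkS_intro (g := fun=> cst 0)) => //; exact: cst_continuous.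
Qed.

Lemma smooth_cst (R : realType) (c : R) : smooth (fun _ : R * R => c).
Proof. by move=> k; exact: Ck_cst. Qed.

Lemma CkD (R : realType) k (f g : R * R -> R) :
  Ck k f -> Ck k g -> Ck k (fun x => f x + g x).
Proof.
elim: k f g => [|k IH] f g Hf Hg.
  by split=> // x; apply: continuousD; [exact: (Ck_cont Hf)|exact: (Ck_cont Hg)].
apply: (CkS_intro (g := fun i x => partial i f x + partial i g x)).
- by move=> x; apply: continuousD; [exact: (Ck_cont Hf)|exact: (Ck_cont Hg)].
- move=> i x; have [_ /(_ i)[/(_ x)/derivableP df _]] := Hf.
  have [_ /(_ i)[/(_ x)/derivableP dg _]] := Hg.
  exact: is_deriveD.
- by move=> i; apply: IH; [exact: (Hf.2 i).2 | exact: (Hg.2 i).2].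
Qed.

Lemma smoothD (R : realType) (f g : R * R -> R) :
  smooth f -> smooth g -> smooth (fun x => f x + g x).
Proof. by move=> sf sg k; apply: CkD. Qed.

Lemma CkM (R : realType) k (f g : R * R -> R) :
  Ck k f -> Ck k g -> Ck k (fun x => f x * g x).
Proof.
elim: k f g => [|k IH] f g Hf Hg.
  by split=> // x; apply: continuousM; [exact: (Ck_cont Hf)|exact: (Ck_cont Hg)].
apply: (CkS_intro (g := fun i x => f x * partial i g x + g x * partial i f x)).
- by move=> x; apply: continuousM; [exact: (Ck_cont Hf)|exact: (Ck_cont Hg)].
- move=> i x; have [_ /(_ i)[/(_ x)/derivableP df _]] := Hf.
  have [_ /(_ i)[/(_ x)/derivableP dg _]] := Hg.
  exact: is_deriveM.
- move=> i; apply: CkD.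
    by apply: IH; [exact: CkW | exact: (Hg.2 i).2].
  by apply: IH; [exact: CkW | exact: (Hf.2 i).2].
Qed.

Lemma smoothM (R : realType) (f g : R * R -> R) :
  smooth f -> smooth g -> smooth (fun x => f x * g x).
Proof. by move=> sf sg k; apply: CkM. Qed.

Lemma smoothZ (R : realType) c (f : R * R -> R) :
  smooth f -> smooth (fun x => c * f x).
Proof. by move=> sf; apply: smoothM => //; exact: smooth_cst. Qed.

Lemma smoothB (R : realType) (f g : R * R -> R) :
  smooth f -> smooth g -> smooth (fun x => f x - g x).
Proof.
move=> sf sg; have -> : (fun x => f x - g x) = (fun x => f x + (-1) * g x).
  by apply/funext => x; rewrite mulN1r.
by apply: smoothD => //; exact: smoothZ.
Qed.

Lemma smooth_sum (R : realType) (I : Type) (s : seq I) (f : I -> R * R -> R) :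
  (forall i, smooth (f i)) -> smooth (fun x => \sum_(i <- s) f i x).
Proof.
move=> sf; elim: s => [|i s IH].
  have -> : (fun x => \sum_(i <- [::]) f i x) = (fun=> 0).
    by apply/funext => x; rewrite big_nil.
  exact: smooth_cst.
have -> : (fun x => \sum_(j <- i :: s) f j x) =
   (fun x => f i x + \sum_(j <- s) f j x).
  by apply/funext => x; rewrite big_cons.
exact: smoothD.
Qed.

Lemma CkV (R : realType) k (f : R * R -> R) :
  (forall x, f x != 0) -> Ck k f -> Ck k (fun x => (f x)^-1).
Proof.
move=> f0; have cV : continuous f -> continuous (fun x => (f x)^-1).
  by move=> cf x; apply: continuousV => //; exact: cf.
elim: k => [|k IH] Hf; first by split=> //; apply: cV; exact: (Ck_cont Hf).
apply: (CkS_intro (g := fun i x => (-1) * ((f x)^-1 * (f x)^-1) * partial i f x)).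
- by apply: cV; exact: (Ck_cont Hf).
- move=> i x; have [_ /(_ i)[/(_ x) df _]] := Hf.
  have -> : (-1) * ((f x)^-1 * (f x)^-1) * partial i f x =
    - f x ^- 2 *: 'D_(axis R i) f x.
    by rewrite /partial /GRing.scale /= mulN1r expr2 invfM.
  split; last exact: deriveV.
  exact: derivableV.
- move=> i; apply: CkM; last exact: (Hf.2 i).2.
  apply: CkM; first exact: Ck_cst.
  by apply: CkM; apply: IH; exact: CkW.
Qed.

Lemma smoothV (R : realType) (f : R * R -> R) :
  (forall x, f x != 0) -> smooth f -> smooth (fun x => (f x)^-1).
Proof. by move=> f0 sf k; apply: CkV. Qed.

Lemma partial_fst (R : realType) i (x : R * R) :
  is_derive x (axis R i) (fst : R * R -> R) (axis R i).1.
Proof.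
apply: is_derive_line.
have -> : (fun t : R => (x + t *: axis R i).1) = (cst x.1 + (axis R i).1 *: id).
  by apply/funext => t /=; rewrite [RHS]/GRing.add/= /GRing.scale /= mulrC.
apply: (is_derive_eq (is_deriveD (is_derive_cst _ _ _)
  (is_deriveZ _ (is_derive_id _ _)))).
by rewrite add0r /GRing.scale /= mulr1.
Qed.

Lemma partial_snd (R : realType) i (x : R * R) :
  is_derive x (axis R i) (snd : R * R -> R) (axis R i).2.
Proof.
apply: is_derive_line.
have -> : (fun t : R => (x + t *: axis R i).2) = (cst x.2 + (axis R i).2 *: id).
  by apply/funext => t /=; rewrite [RHS]/GRing.add/= /GRing.scale /= mulrC.
apply: (is_derive_eq (is_deriveD (is_derive_cst _ _ _)
  (is_deriveZ _ (is_derive_id _ _)))).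
by rewrite add0r /GRing.scale /= mulr1.
Qed.

Lemma smooth_fst (R : realType) : smooth (fst : R * R -> R).
Proof.
apply: (smooth_intro (g := fun i => cst (axis R i).1)).
- exact: fst_continuous.
- by move=> i x; exact: partial_fst.
- by move=> i; exact: smooth_cst.
Qed.

Lemma smooth_snd (R : realType) : smooth (snd : R * R -> R).
Proof.
apply: (smooth_intro (g := fun i => cst (axis R i).2)).
- exact: snd_continuous.
- by move=> i x; exact: partial_snd.
- by move=> i; exact: smooth_cst.
Qed.

(** * A smooth step built from exp(-1/t) *)

Lemma expr_le_expR (R : realType) (n : nat) (y : R) : 0 <= y ->
  y ^+ n <= n`!%:R * expR y.
Proof.
move=> y0; case: n => [|n]; first by rewrite expr0 fact0 mul1r -expR0 ler_expR.
have := expR_ge1Dxn n y0 => H.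
have f0 : 0 < (n.+1)`!%:R :> R by rewrite ltr0n fact_gt0.
rewrite mulrC -ler_pdivrMr //; lra.
Qed.

Lemma poly_le_expR (R : realType) (p : {poly R}) :
  exists2 B : R, 0 <= B & forall y, 0 <= y -> `|p.[y]| <= B * expR y.
Proof.
exists (\sum_(i < size p) `|p`_i| * i`!%:R).
  by apply: sumr_ge0 => i _; rewrite mulr_ge0.
move=> y y0; rewrite horner_coef mulr_suml.
apply: (le_trans (ler_norm_sum _ _ _)); apply: ler_sum => i _.
by rewrite normrM -mulrA ler_wpM2l // ger0_norm ?exprn_ge0 // expr_le_expR.
Qed.

(** The functions p(1/t) exp(-1/t), extended by 0: unlike exp(-1/t) alone, this
    family is closed under differentiation ([is_derive_flat]), which makes
    smoothness an induction. *)
Definition flat (R : realType) (p : {poly R}) (t : R) : R :=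
  if 0 < t then p.[t^-1] * expR (- t^-1) else 0.

(** The quadratic bound gives a vanishing derivative at 0. *)
Lemma flat_small (R : realType) (p : {poly R}) :
  exists2 B : R, 0 <= B & forall t, `|flat p t| <= B * t ^+ 2.
Proof.
have [B B0 HB] := poly_le_expR (p * 'X^2).
exists B => // t; rewrite /flat; case: ifPn => [t0|_]; last first.
  by rewrite normr0 mulr_ge0 // sqr_ge0.
have := HB t^-1; rewrite invr_ge0 (ltW t0) => /(_ isT).
rewrite hornerM hornerXn normrM (ger0_norm (sqr_ge0 _)).
rewrite exprVn ler_pdivrMr ?exprn_gt0// => H.
rewrite normrM (ger0_norm (expR_ge0 _)) expRN ler_pdivrMr ?expR_gt0//.
by rewrite mulrAC.
Qed.

(** With s = 1/t one has d/dt = - s^2 d/ds, and d/ds (p e^-s) = (p' - p) e^-s; at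
    the junction 0 the claim follows from [flat_small]. *)
Lemma is_derive_flat (R : realType) (p : {poly R}) (t : R) :
  is_derive t 1 (flat p) (flat ('X^2 * (p - p^`())) t).
Proof.
have [t0|t0|t0] := ltgtP 0 t.
- have d1 : is_derive t 1 (fun s : R => s^-1) (- t ^- 2).
    apply: (is_derive_eq (is_deriveV _ (is_derive_id _ _))); first by rewrite gt_eqF.
    by rewrite /GRing.scale /= mulr1.
  have d2 : is_derive t 1 (fun s : R => p.[s^-1]) (p^`().[t^-1] * (- t ^- 2)).
    exact: (is_derive1_comp (f := horner p)).
  have d3 : is_derive t 1 (fun s : R => expR (- s^-1)) (expR (- t^-1) * (- - t ^- 2)).
    by apply: (is_derive1_comp (f := expR)) (is_deriveN _); exact: is_derive_expR.
  have d4 := is_deriveM d2 d3.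
  apply: (near_eq_is_derive (f := (fun s : R => p.[s^-1]) * (fun s : R => expR (- s^-1)))).
    near=> s; rewrite /flat ifT //.
    by near: s; exact: lt_nbhsr.
  apply: (is_derive_eq d4).
  rewrite /flat t0 hornerM hornerXn hornerD hornerN /GRing.scale /= exprVn.
  by ring.
- apply: (near_eq_is_derive (f := cst 0)).
    near=> s; rewrite /flat ifF //; apply/negbTE; rewrite -leNgt.
    by apply: ltW; near: s; exact: lt_nbhsl.
  by rewrite /flat ltNge (ltW t0) /=; exact: is_derive_cst.
- rewrite -t0 /flat ltxx.
  have [B B0 HB] := flat_small p.
  have H : h^-1 *: ((flat p \o shift 0) (h *: 1) - flat p 0) @[h --> 0^'] --> (0 : R).
    apply/cvgr0Pnorm_lt => e e0; near=> h.
    have h0 : h != 0 by near: h; exact: nbhs_dnbhs_neq.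
    rewrite /= addr0 [h%:A]mulr1 /flat ltxx subr0 -/(flat p h).
    rewrite normrZ normfV mulrC ltr_pdivrMr ?normr_gt0//.
    apply: (le_lt_trans (HB h)).
    have -> : h ^+ 2 = `|h| * `|h| by rewrite -normrM -expr2 ger0_norm ?sqr_ge0.
    rewrite mulrA ltr_pM2r ?normr_gt0//.
    have : `|h| < e / (B + 1).
      near: h; apply: dnbhs0_lt; rewrite divr_gt0//; lra.
    rewrite ltr_pdivlMr; last by lra.
    have := normr_ge0 h; nra.
  split; first by apply/cvg_ex; exists 0.
  exact: (cvg_lim _ H).
Unshelve. all: by end_near. Qed.

Lemma is_derive_continuous (R : realType) (f df : R -> R) :
  (forall t : R, is_derive t (1 : R) f (df t)) -> continuous f.
Proof.
move=> d t; apply: differentiable_continuous.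
by apply/derivable1_diffP; exact: (@ex_derive _ _ _ _ _ _ _ (d t)).
Qed.

Lemma flat_continuous (R : realType) (p : {poly R}) : continuous (flat p).
Proof. exact: is_derive_continuous (is_derive_flat p). Qed.

Lemma smooth_flat_comp (R : realType) (p : {poly R}) (q : R * R -> R) :
  smooth q -> smooth (fun x => flat p (q x)).
Proof.
move=> sq k; elim: k p => [|k IH] p.
  split=> // x; apply: continuous_comp; first exact: (smooth_cont sq).
  exact: flat_continuous.
apply: (CkS_intro (g := fun i x => flat ('X^2 * (p - p^`())) (q x) * partial i q x)).
- move=> x; apply: continuous_comp; first exact: (smooth_cont sq).
  exact: flat_continuous.
- move=> i x; apply: (is_derive_comp2 (h := flat p)); first exact: is_derive_flat.
  exact: smooth_is_derive.
- move=> i; apply: CkM; first exact: IH.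
  exact: smooth_partial.
Qed.

Lemma flat_le0 (R : realType) (p : {poly R}) (t : R) : t <= 0 -> flat p t = 0.
Proof. by rewrite /flat ltNge => ->. Qed.

Lemma flat_Xn_ge0 (R : realType) n (t : R) : 0 <= flat 'X^n t.
Proof.
rewrite /flat; case: ifPn => // t0.
by rewrite hornerXn mulr_ge0 ?expR_ge0 // exprn_ge0 // invr_ge0 ltW.
Qed.

Lemma flat_Xn_gt0 (R : realType) n (t : R) : 0 < t -> 0 < flat 'X^n t.
Proof.
by move=> t0; rewrite /flat t0 hornerXn mulr_gt0 ?expR_gt0 // exprn_gt0 // invr_gt0.
Qed.

Definition step_den (R : realType) (t : R) : R := flat 'X^0 t + flat 'X^0 (1 - t).

(** One of t and 1 - t is positive, so the step is a quotient without poles. *)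
Lemma step_den_gt0 (R : realType) (t : R) : 0 < step_den t.
Proof.
rewrite /step_den; have [t0|t0] := ltP 0 t.
  by rewrite ltr_pwDl ?flat_Xn_ge0 ?flat_Xn_gt0.
rewrite ltr_wpDl ?flat_Xn_ge0 ?flat_Xn_gt0 //; lra.
Qed.

Definition smoothstep (R : realType) (t : R) : R := flat 'X^0 t / step_den t.

(** The quotient rule for [smoothstep], after cancellation; in this form it is
    visibly nonnegative and smooth. *)
Definition dsmoothstep (R : realType) (t : R) : R :=
  (flat 'X^2 t * flat 'X^0 (1 - t) + flat 'X^0 t * flat 'X^2 (1 - t)) *
  ((step_den t)^-1 * (step_den t)^-1).

Lemma smoothstep_ge0 (R : realType) (t : R) : 0 <= smoothstep t.
Proof. by rewrite divr_ge0 ?flat_Xn_ge0 // ltW // step_den_gt0. Qed.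

Lemma smoothstep_le1 (R : realType) (t : R) : smoothstep t <= 1.
Proof. by rewrite ler_pdivrMr ?step_den_gt0 // mul1r lerDl flat_Xn_ge0. Qed.

Lemma smoothstep0 (R : realType) (t : R) : t <= 0 -> smoothstep t = 0.
Proof. by move=> t0; rewrite /smoothstep flat_le0 // mul0r. Qed.

Lemma smoothstep1 (R : realType) (t : R) : 1 <= t -> smoothstep t = 1.
Proof.
move=> t1; rewrite /smoothstep /step_den (@flat_le0 _ _ (1 - t)) ?addr0; last by lra.
by rewrite divff // gt_eqF // flat_Xn_gt0 //; lra.
Qed.

Lemma is_derive_flatX0 (R : realType) (t : R) :
  is_derive t 1 (flat 'X^0) (flat 'X^2 t).
Proof.
apply: (is_derive_eq (is_derive_flat _ _)).
by rewrite expr0 derivC subr0 mulr1.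
Qed.

Lemma is_derive_flatX0_refl (R : realType) (t : R) :
  is_derive t 1 (fun s => flat 'X^0 (1 - s)) (- flat 'X^2 (1 - t)).
Proof.
have d : is_derive t 1 (fun s : R => 1 - s) (- 1).
  by apply: (is_derive_eq (is_deriveB (is_derive_cst _ _ _) (is_derive_id _ _))); rewrite sub0r.
apply: (is_derive_eq (is_derive1_comp (is_derive_flatX0 _) d)).
by rewrite mulrN1.
Qed.

Lemma is_derive_smoothstep (R : realType) (t : R) :
  is_derive t 1 (@smoothstep R) (dsmoothstep t).
Proof.
have d1 := is_derive_flatX0 t.
have d2 := is_deriveD d1 (is_derive_flatX0_refl t).
have d0 := step_den_gt0 t.
have d3 := is_deriveV (lt0r_neq0 d0) d2.
apply: (is_derive_eq (is_deriveM d1 d3)).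
rewrite /dsmoothstep /GRing.scale /=.
move: (lt0r_neq0 d0); rewrite expr2 invfM /step_den => n0.
by field.
Qed.

Lemma dsmoothstep_ge0 (R : realType) (t : R) : 0 <= dsmoothstep t.
Proof.
have d0 := ltW (step_den_gt0 t).
by rewrite /dsmoothstep mulr_ge0 ?mulr_ge0 ?invr_ge0 // addr_ge0 // mulr_ge0 // flat_Xn_ge0.
Qed.

Lemma dsmoothstep_out (R : realType) (t : R) : ~~ (0 < t < 1) -> dsmoothstep t = 0.
Proof.
rewrite negb_and -!leNgt /dsmoothstep => /orP[t0|t1].
  by rewrite !(flat_le0 _ t0) !mul0r addr0 mul0r.
have t1' : 1 - t <= 0 by lra.
by rewrite !(flat_le0 _ t1') !mulr0 addr0 mul0r.
Qed.

Lemma dsmoothstep_continuous (R : realType) : continuous (@dsmoothstep R).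
Proof.
have cr p : continuous (fun t : R => flat p (1 - t)).
  move=> t; apply: (@continuous_comp _ _ _ (fun t : R => 1 - t) (flat p)).
    by apply: continuousB; [exact: cst_continuous|exact: cvg_id].
  exact: flat_continuous.
have cd (t : R) : {for t, continuous (fun t => (@step_den R t)^-1)}.
  apply: continuousV; first by rewrite gt_eqF // step_den_gt0.
  by apply: continuousD; [exact: flat_continuous|exact: cr].
have cf p (t : R) : {for t, continuous (flat p)} by exact: flat_continuous.
rewrite /dsmoothstep => t; apply: (@continuousM _ _ (fun s : R => _ + _)
  (fun s : R => (step_den s)^-1 * (step_den s)^-1)); last by apply: continuousM; exact: cd.
apply: (@continuousD _ _ _ (fun s : R => flat 'X^2 s * flat 'X^0 (1 - s))
   (fun s : R => flat 'X^0 s * flat 'X^2 (1 - s))).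
  by apply: (@continuousM _ _ (flat 'X^2) (fun s : R => flat 'X^0 (1 - s))); [exact: cf|exact: cr].
by apply: (@continuousM _ _ (flat 'X^0) (fun s : R => flat 'X^2 (1 - s))); [exact: cf|exact: cr].
Qed.

Lemma dsmoothstep_bounded (R : realType) :
  exists2 B : R, 0 <= B & forall t, dsmoothstep t <= B.
Proof.
have c : {within `[0, 1], continuous (@dsmoothstep R)}.
  by apply: continuous_subspaceT; exact: dsmoothstep_continuous.
have [m _ Hm] := EVT_max ler01 c.
exists (dsmoothstep m); first exact: dsmoothstep_ge0.
move=> t; have [t01|t01] := boolP (0 < t < 1).
  by apply: Hm; rewrite in_itv /=; case/andP: t01 => /ltW -> /ltW ->.
by rewrite dsmoothstep_out // dsmoothstep_ge0.
Qed.

Lemma smooth_1B (R : realType) (q : R * R -> R) : smooth q -> smooth (fun x => 1 - q x).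
Proof. by move=> sq; apply: smoothB => //; exact: smooth_cst. Qed.

Lemma smooth_step_denV_comp (R : realType) (q : R * R -> R) :
  smooth q -> smooth (fun x => (step_den (q x))^-1).
Proof.
move=> sq; apply: smoothV; first by move=> x; rewrite gt_eqF // step_den_gt0.
by apply: smoothD; apply: smooth_flat_comp => //; exact: smooth_1B.
Qed.

Lemma smooth_smoothstep_comp (R : realType) (q : R * R -> R) :
  smooth q -> smooth (fun x => smoothstep (q x)).
Proof.
move=> sq; apply: smoothM; first exact: smooth_flat_comp.
exact: smooth_step_denV_comp.
Qed.

Lemma smooth_dsmoothstep_comp (R : realType) (q : R * R -> R) :
  smooth q -> smooth (fun x => dsmoothstep (q x)).
Proof.
move=> sq; apply: smoothM.
  by apply: smoothD; apply: smoothM; apply: smooth_flat_comp => //; exact: smooth_1B.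
by apply: smoothM; exact: smooth_step_denV_comp.
Qed.

Lemma partial_smoothstep_comp (R : realType) (q : R * R -> R) i x : smooth q ->
  partial i (fun x => smoothstep (q x)) x = dsmoothstep (q x) * partial i q x.
Proof.
move=> sq; apply: derive_val.
apply: (is_derive_comp2 (h := @smoothstep R)); first exact: is_derive_smoothstep.
exact: smooth_is_derive.
Qed.

(** * Measurability and negligible sets in the plane *)

(** The plane with the measurable structure on which [leb2] is defined; it is
    convertible to R * R, which carries the topology. *)
Notation plane R := (measurableTypeR R * measurableTypeR R)%type.

(** The product sigma-algebra is generated by rectangles, and an open set is the
    countable union of the rational boxes that it contains. *)
Lemma open_measurable2 (R : realType) (U : set (R * R)) :
  open U -> measurable (U : set (plane R)).
Proof.
move=> oU.
have H (r t : R) : 0 < r -> exists q : rat, `|ratr q - t| < r.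
  move=> r0; have : t - r < t + r by lra.
  move=> /rat_in_itvoo[q]; rewrite in_itv /= => /andP[q1 q2]; exists q.
  by rewrite ltr_norml; apply/andP; split; lra.
pose box (i : rat * rat * nat) : set (plane R) :=
  (ball (ratr i.1.1 : R) (i.2.+1%:R^-1)) `*` (ball (ratr i.1.2 : R) (i.2.+1%:R^-1)).
have -> : (U : set (plane R)) = \bigcup_i [set x | box i x /\ box i `<=` U].
  apply/seteqP; split=> [x Ux|x [i _ /= [iU /(_ _ iU)]]//].
  have /nbhs_ballP[e /= e0 eU] : nbhs x U by exact: open_nbhs_nbhs.
  have [n _ nP] := near_infty_natSinv_lt (PosNum (divr_gt0 e0 (ltr0n R 2))).
  have {nP} := nP n (leqnn n).
  have n0 : 0 < n.+1%:R^-1 :> R by [].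
  have [q1 Hq1] := H _ x.1 n0; have [q2 Hq2] := H _ x.2 n0.
  move=> /= ne; exists (q1, q2, n) => //=; split; first by split.
  move=> y [/= y1 y2]; apply: eU; split => /=; rewrite /ball /=.
    rewrite -(subrKA (ratr q1)); apply: (le_lt_trans (ler_normD _ _)).
    move: n0 ne Hq1 y1; rewrite /ball /= distrC; move: (n.+1%:R^-1) => r ? ? ? ?.
    lra.
  rewrite -(subrKA (ratr q2)); apply: (le_lt_trans (ler_normD _ _)).
  move: n0 ne Hq2 y2; rewrite /ball /= distrC; move: (n.+1%:R^-1) => r ? ? ? ?.
  lra.
apply: countable_bigcupT_measurable => [|i]; first exact: countableP.
have [iU|iU] := pselect (box i `<=` U).
  rewrite (_ : [set x | _] = box i); last by apply/seteqP; split=> [x []|x].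
  by apply: measurableX; exact: measurable_ball.
by rewrite (_ : [set x | _] = set0) //; apply/seteqP; split=> [x []|x].
Qed.

Lemma continuous_measurable2 (R : realType) (f : R * R -> R) :
  continuous f -> measurable_fun setT (f : plane R -> R).
Proof.
move=> cf; apply: (measurability _ (RGenOpens.measurableE R)) => _ [_ [a [b ->] <-]].
rewrite setTI; apply: open_measurable2.
by apply: open_comp => //; exact: interval_open.
Qed.

Lemma leb2_aeS (R : realType) (P Q : R * R -> Prop) : (forall x, P x -> Q x) ->
  (\forall x \ae leb2 R, P x) -> \forall x \ae leb2 R, Q x.
Proof.
move=> PQ [A [mA A0 sA]]; exists A; split=> // x nQ; apply: sA => /= Px.
by apply: nQ; exact: PQ.
Qed.

Lemma leb2_aeI (R : realType) (P Q : R * R -> Prop) :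
  (\forall x \ae leb2 R, P x) -> (\forall x \ae leb2 R, Q x) ->
  \forall x \ae leb2 R, P x /\ Q x.
Proof.
move=> [A [mA A0 sA]] [B [mB B0 sB]]; exists (A `|` B); split.
- exact: measurableU.
- by apply: null_set_setU.
- move=> x /= nPQ; have [Px|nPx] := pselect (P x); last by left; exact: sA.
  by right; apply: sB => /= Qx; apply: nPQ.
Qed.

(** * The Euclidean norm and discs *)

Lemma norm2E (R : realType) (x : R * R) : norm2 x = Num.sqrt (x.1 ^+ 2 + x.2 ^+ 2).
Proof. by rewrite /norm2 /dot2 !expr2. Qed.

Lemma norm2_ge0 (R : realType) (x : R * R) : 0 <= norm2 x.
Proof. exact: sqrtr_ge0. Qed.

Lemma norm2_sqr (R : realType) (x : R * R) : norm2 x ^+ 2 = x.1 ^+ 2 + x.2 ^+ 2.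
Proof. by rewrite norm2E sqr_sqrtr // addr_ge0 // sqr_ge0. Qed.

Lemma norm2_le (R : realType) (x : R * R) (r : R) : 0 <= r ->
  (norm2 x <= r) = (x.1 ^+ 2 + x.2 ^+ 2 <= r ^+ 2).
Proof. by move=> r0; rewrite -norm2_sqr ler_sqr ?nnegrE ?norm2_ge0. Qed.

Lemma norm2_lt (R : realType) (x : R * R) (r : R) : 0 <= r ->
  (norm2 x < r) = (x.1 ^+ 2 + x.2 ^+ 2 < r ^+ 2).
Proof. by move=> r0; rewrite -norm2_sqr ltr_sqr ?nnegrE ?norm2_ge0. Qed.

Lemma norm2_0 (R : realType) : norm2 (0 : R * R) = 0.
Proof. by rewrite norm2E /= !expr0n /= addr0 sqrtr0. Qed.

Lemma norm2_eq0 (R : realType) (x : R * R) : (norm2 x == 0) = (x == 0).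
Proof.
rewrite -sqrf_eq0 norm2_sqr paddr_eq0 ?sqr_ge0 // !sqrf_eq0.
by case: x => x1 x2.
Qed.

Lemma norm2Z (R : realType) (c : R) (x : R * R) : norm2 (c *: x) = `|c| * norm2 x.
Proof.
rewrite norm2E /= /GRing.scale /= !exprMn -mulrDr sqrtrM ?sqr_ge0 // sqrtr_sqr.
by rewrite -norm2E.
Qed.

Lemma norm2N (R : realType) (x : R * R) : norm2 (- x) = norm2 x.
Proof. by rewrite -scaleN1r norm2Z normrN1 mul1r. Qed.

Lemma norm2C (R : realType) (x y : R * R) : norm2 (x - y) = norm2 (y - x).
Proof. by rewrite -norm2N opprB. Qed.

Lemma norm2_triangle (R : realType) (x y : R * R) : norm2 (x + y) <= norm2 x + norm2 y.
Proof.
rewrite norm2_le ?addr_ge0 ?norm2_ge0 // [leRHS]sqrrD !norm2_sqr /=.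
set p := norm2 x; set q := norm2 y.
have p2 : p ^+ 2 = x.1 ^+ 2 + x.2 ^+ 2 by exact: norm2_sqr.
have q2 : q ^+ 2 = y.1 ^+ 2 + y.2 ^+ 2 by exact: norm2_sqr.
have p0 : 0 <= p by exact: norm2_ge0.
have q0 : 0 <= q by exact: norm2_ge0.
have H : x.1 * y.1 + x.2 * y.2 <= p * q.
  apply: (le_trans (ler_norm _)).
  rewrite -ler_sqr ?nnegrE ?mulr_ge0 // real_normK ?num_real // exprMn p2 q2.
  have := sqr_ge0 (x.1 * y.2 - x.2 * y.1); rewrite !expr2; lra.
rewrite !expr2 in H *; lra.
Qed.

Lemma norm2_tri3 (R : realType) (x y z : R * R) :
  norm2 (x - z) <= norm2 (x - y) + norm2 (y - z).
Proof. by rewrite -(subrKA y); exact: norm2_triangle. Qed.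

Lemma normr1_le_norm2 (R : realType) (x : R * R) : `|x.1| <= norm2 x.
Proof.
rewrite -ler_sqr ?nnegrE ?norm2_ge0 // norm2_sqr real_normK ?num_real //.
by rewrite lerDl sqr_ge0.
Qed.

Lemma normr2_le_norm2 (R : realType) (x : R * R) : `|x.2| <= norm2 x.
Proof.
rewrite -ler_sqr ?nnegrE ?norm2_ge0 // norm2_sqr real_normK ?num_real //.
by rewrite lerDr sqr_ge0.
Qed.

Lemma norm2_le_sum (R : realType) (x : R * R) : norm2 x <= `|x.1| + `|x.2|.
Proof.
rewrite norm2_le ?addr_ge0 // sqrrD !real_normK ?num_real //.
have := mulr_ge0 (normr_ge0 x.1) (normr_ge0 x.2); lra.
Qed.

Lemma norm2_continuous (R : realType) : continuous (@norm2 R).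
Proof.
have -> : @norm2 R = Num.sqrt \o (fun x => x.1 * x.1 + x.2 * x.2) by [].
move=> x; apply: continuous_comp; last exact: sqrt_continuous.
have c1 := @fst_continuous R x; have c2 := @snd_continuous R x.
by apply: (@continuousD _ _ _ (fun x : R * R => x.1 * x.1) (fun x => x.2 * x.2));
   apply: continuousM.
Qed.

Lemma disc_open (R : realType) (c : R * R) (r : R) : open (disc c r).
Proof.
have -> : disc c r = (fun x => norm2 (x - c)) @^-1` `]-oo, r[.
  by apply/seteqP; split=> x; rewrite /disc /= in_itv.
apply: open_comp; last exact: interval_open.
move=> x _; apply: (@continuous_comp _ _ _ (fun x : R * R => x - c) (@norm2 R)).
  by apply: (@continuousB _ _ _ (@id (R * R)) (cst c)); [exact: cvg_id|exact: cst_continuous].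
exact: norm2_continuous.
Qed.

Lemma disc_measurable (R : realType) (c : R * R) (r : R) :
  measurable (disc c r : set (plane R)).
Proof. by apply: open_measurable2; exact: disc_open. Qed.

Definition square (R : realType) (c : R * R) (r : R) : set (R * R) :=
  `[c.1 - r, c.1 + r] `*` `[c.2 - r, c.2 + r].

Lemma disc_sub_square (R : realType) (c : R * R) (r : R) : disc c r `<=` square c r.
Proof.
move=> x; rewrite /disc /square /= !in_itv /= => xr.
have := le_lt_trans (normr1_le_norm2 _) xr.
have := le_lt_trans (normr2_le_norm2 _) xr.
rewrite !ltr_norml /= => /andP[? ?] /andP[? ?].
by split; apply/andP; split; lra.
Qed.

(** Inner and outer squares replace the exact area of a disc, which is only
    needed up to a factor. *)
Lemma square_sub_disc (R : realType) (c : R * R) (r : R) : 0 < r ->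
  square c (r / 2) `<=` disc c r.
Proof.
move=> r0 x; rewrite /disc /square /= !in_itv /= => -[/andP[? ?] /andP[? ?]].
rewrite norm2_lt ?ltW //=.
have H (s : R) : - (r / 2) <= s -> s <= r / 2 -> s ^+ 2 <= r ^+ 2 / 4.
  by move=> s1 s2; nra.
have := H (x.1 - c.1); have := H (x.2 - c.2).
have : 0 < r ^+ 2 by rewrite exprn_gt0.
move=> ? /(_ ltac:(lra) ltac:(lra)) ? /(_ ltac:(lra) ltac:(lra)) ?; lra.
Qed.

Lemma square_measurable (R : realType) (c : R * R) (r : R) :
  measurable (square c r : set (plane R)).
Proof. by apply: measurableX; exact: measurable_itv. Qed.

Lemma lebesgue_measure_centered (R : realType) (t r : R) : 0 <= r ->
  @lebesgue_measure R `[t - r, t + r] = (2 * r)%:E.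
Proof.
move=> r0; rewrite lebesgue_measure_itv /= lte_fin; case: ltP => H.
  by rewrite -EFinB; congr (_%:E); ring.
by congr (_%:E); lra.
Qed.

Lemma leb2_square (R : realType) (c : R * R) (r : R) : 0 <= r ->
  leb2 R (square c r) = ((2 * r) ^+ 2)%:E.
Proof.
move=> r0; apply: (etrans (product_measure1E _ _ _ _)); try exact: measurable_itv.
rewrite [X in (X * _)%E]lebesgue_measure_centered // [X in (_ * X)%E]lebesgue_measure_centered //.
Qed.

Lemma leb2_disc_le (R : realType) (c : R * R) (r : R) : 0 <= r ->
  (leb2 R (disc c r) <= ((2 * r) ^+ 2)%:E)%E.
Proof.
move=> r0; rewrite -(leb2_square c r0); apply: le_measure; rewrite ?inE.
- exact: disc_measurable.
- exact: square_measurable.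
- exact: disc_sub_square.
Qed.

Lemma leb2_disc_ge (R : realType) (c : R * R) (r : R) : 0 < r ->
  ((r ^+ 2)%:E <= leb2 R (disc c r))%E.
Proof.
move=> r0; have -> : r ^+ 2 = (2 * (r / 2)) ^+ 2 by congr (_ ^+ 2); field.
rewrite -(leb2_square c); last by lra.
apply: le_measure; rewrite ?inE.
- exact: square_measurable.
- exact: disc_measurable.
- exact: square_sub_disc.
Qed.

Lemma leb2_disc_fin (R : realType) (c : R * R) (r : R) : (leb2 R (disc c r) < +oo)%E.
Proof.
have [r0|r0] := leP 0 r.
  by apply: (le_lt_trans (leb2_disc_le c r0)); rewrite ltry.
have -> : disc c r = set0.
  apply/seteqP; split=> // x; rewrite /disc /= => H.
  by have := lt_trans (le_lt_trans (norm2_ge0 _) H) r0; rewrite ltxx.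
by rewrite measure0 ltry.
Qed.

Lemma square_compact (R : realType) (c : R * R) (r : R) : compact (square c r).
Proof. by apply: compact_setX; exact: segment_compact. Qed.

Lemma continuous_bounded_square (R : realType) (f : R * R -> R) c r :
  continuous f -> exists2 B : R, 0 <= B & forall x, square c r x -> `|f x| <= B.
Proof.
move=> cf; have K : compact (f @` square c r).
  by apply: continuous_compact; [exact: continuous_subspaceT|exact: square_compact].
have [B [_ HB]] := compact_bounded K.
exists (`|B| + 1); first by rewrite addr_ge0.
move=> x sx; apply: (HB (`|B| + 1)); last by exists x.
by apply: (le_lt_trans (ler_norm B)); rewrite ltrDl.
Qed.

Lemma continuous_bounded_disc (R : realType) (f : R * R -> R) c r :
  continuous f -> exists2 B : R, 0 <= B & forall x, disc c r x -> `|f x| <= B.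
Proof.
move=> cf; have [B B0 HB] := continuous_bounded_square c r cf.
by exists B => // x /disc_sub_square; exact: HB.
Qed.

Lemma integrable_leb2_disc (R : realType) (f : R * R -> R) c r :
  continuous f -> (leb2 R).-integrable (disc c r) (EFin \o f).
Proof.
move=> cf; have [B B0 HB] := continuous_bounded_disc c r cf.
apply: measurable_bounded_integrable.
- exact: disc_measurable.
- exact: leb2_disc_fin.
- by apply: measurable_funTS; exact: continuous_measurable2.
- exists B; split; first exact: num_real.
  by move=> y yB x /HB/le_trans; apply; exact: ltW.
Qed.

(** * Weak gradients and products with smooth functions *)

Lemma integral_derive_support (R : realType) (f F : R -> R) (a b : R) : a < b ->
  (forall t : R, is_derive t (1 : R) F (f t)) -> continuous f ->
  (forall t, ~~ (a <= t <= b) -> f t = 0) ->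
  (\int[@lebesgue_measure R]_x (f x)%:E = (F b - F a)%:E)%E.
Proof.
move=> ab dF cf f0.
have -> : (\int[@lebesgue_measure R]_x (f x)%:E =
           \int[@lebesgue_measure R]_(x in `[a, b]) (f x)%:E)%E.
  rewrite [RHS]integral_mkcond; apply: eq_integral => x _.
  rewrite patchE; case: ifPn => // /negP xab; rewrite f0 //.
  by apply/negP => /andP[? ?]; apply: xab; rewrite inE /= in_itv /=; apply/andP.
have cF := is_derive_continuous dF.
rewrite (continuous_FTC2 ab (f := f) (F := F)) ?EFinB //.
- exact: continuous_subspaceT.
- split.
  + by move=> x _; exact: (@ex_derive _ _ _ _ _ _ _ (dF x)).
  + by apply: cvg_at_right_filter; exact: cF.
  + by apply: cvg_at_left_filter; exact: cF.
- move=> x _; rewrite derive1E; exact: (@derive_val _ _ _ _ _ _ _ (dF x)).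
Qed.

Lemma partial_off_support (R : realType) (K : set (R * R)) (phi : R * R -> R) i x :
  compact K -> (forall y, ~ K y -> phi y = 0) -> ~ K x -> partial i phi x = 0.
Proof.
move=> cK phi0 nKx; apply: derive_val.
apply: (near_eq_is_derive (f := cst 0)).
  have oK : open (~` K) by apply: closed_openC; apply: compact_closed.
  have : nbhs x (~` K) by exact: open_nbhs_nbhs.
  by apply: filterS => y /phi0 ->.
Qed.

Lemma compact_sub_square (R : realType) (K : set (R * R)) : compact K ->
  exists2 B : R, 0 < B & forall x, K x -> `|x.1| <= B /\ `|x.2| <= B.
Proof.
move=> /compact_bounded[B [_ HB]].
exists (`|B| + 1); first by rewrite ltr_wpDl.
move=> x Kx; have H : `|x| <= `|B| + 1.
  by apply: HB => //; apply: (le_lt_trans (ler_norm B)); rewrite ltrDl.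
by split; apply: le_trans H; rewrite /Num.Def.normr /= le_max lexx ?orbT.
Qed.

Lemma pair_continuous (R : realType) (f g : R -> R) :
  continuous f -> continuous g -> continuous (fun t => (f t, g t)).
Proof. by move=> cf cg t; apply: (@cvg_pair _ _ _ (nbhs t) (nbhs (f t)) (nbhs (g t))); [exact: cf|exact: cg]. Qed.

Lemma is_derive_slice1 (R : realType) (phi : R * R -> R) (t y : R) : smooth phi ->
  is_derive t (1 : R) (fun s => phi (s, y)) (partial false phi (t, y)).
Proof.
move=> sp; have H s : (0, y) + s *: axis R false = (s, y) :> R * R.
  transitivity (0 + s * 1, y + s * 0) => //.
  by rewrite mulr1 mulr0 add0r addr0.
have := @is_derive_to_line R phi (0, y) (axis R false) t (partial false phi (t, y)).
rewrite H => /(_ (smooth_is_derive _ _ sp)).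
by under eq_fun do rewrite H.
Qed.

Lemma is_derive_slice2 (R : realType) (phi : R * R -> R) (t y : R) : smooth phi ->
  is_derive t (1 : R) (fun s => phi (y, s)) (partial true phi (y, t)).
Proof.
move=> sp; have H s : (y, 0) + s *: axis R true = (y, s) :> R * R.
  transitivity (y + s * 0, 0 + s * 1) => //.
  by rewrite mulr1 mulr0 add0r addr0.
have := @is_derive_to_line R phi (y, 0) (axis R true) t (partial true phi (y, t)).
rewrite H => /(_ (smooth_is_derive _ _ sp)).
by under eq_fun do rewrite H.
Qed.

(** Fubini reduces the claim to lines, where the integral of the derivative of a
    compactly supported function vanishes. *)
Lemma integral_partial0 (R : realType) c r (phi : R * R -> R) i :
  test_function (disc c r) phi ->
  \int[leb2 R]_(x in disc c r) partial i phi x = 0.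
Proof.
case=> sphi [K [cK KO phi0]].
have [B B0 HB] := compact_sub_square cK.
have sp := smooth_partial i sphi.
have cp := smooth_cont sp.
have p0 x : ~ K x -> partial i phi x = 0 by exact: partial_off_support.
have Ep : (partial i phi \_ (disc c r)) = partial i phi.
  apply/funext => x; rewrite patchE; case: ifPn => // /negP xO.
  by rewrite p0 // => /KO ?; apply: xO; rewrite inE.
have ip : (leb2 R).-integrable setT (EFin \o partial i phi).
  have := integrable_leb2_disc c r cp.
  rewrite (integrable_mkcond _ (disc_measurable c r)).
  by rewrite restrict_EFin Ep.
rewrite /Rintegral integral_mkcond restrict_EFin Ep.
suff -> : (\int[leb2 R]_x (EFin \o partial i phi) x = 0)%E by [].
have outK (x : R * R) : (B < `|x.1|) || (B < `|x.2|) -> ~ K x.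
  by move=> H /HB[]; rewrite !leNgt => /negP ? /negP ?; case/orP: H.
have B1 : - (B + 1) < B + 1 by lra.
have big : B < `|B + 1| by rewrite ger0_norm; lra.
have bigN : B < `|- (B + 1)| by rewrite normrN.
have tb t : ~~ (- (B + 1) <= t <= B + 1) -> B < `|t|.
  by rewrite ltNge ler_norml; apply: contra => /andP[? ?]; apply/andP; split; lra.
case: i sp cp p0 Ep ip => sp cp p0 Ep ip.
- rewrite -(@fubini1 _ _ _ _ _ lebesgue_measure lebesgue_measure _ ip).
  apply: integral0_eq => x _; rewrite /fubini_F /=.
  have d t := @is_derive_slice2 R phi t x sphi.
  rewrite (integral_derive_support B1 d).
  + by rewrite !phi0 ?subrr //; apply: outK; rewrite /= ?big ?bigN orbT.
  + move=> t; apply: (@continuous_comp _ _ _ (fun y : R => (x, y)) (partial true phi)); last exact: cp.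
    by apply: pair_continuous => ?; [exact: cvg_cst|exact: cvg_id].
  + by move=> t tB; apply: p0; apply: outK => /=; rewrite (tb t tB) orbT.
- rewrite -(@fubini2 _ _ _ _ _ lebesgue_measure lebesgue_measure _ ip).
  apply: integral0_eq => x _; rewrite /fubini_G /=.
  have d t := @is_derive_slice1 R phi t x sphi.
  rewrite (integral_derive_support B1 d).
  + by rewrite !phi0 ?subrr //; apply: outK; rewrite /= ?big ?bigN.
  + move=> t; apply: (@continuous_comp _ _ _ (fun y : R => (y, x)) (partial false phi)); last exact: cp.
    by apply: pair_continuous => ?; [exact: cvg_id|exact: cvg_cst].
  + by move=> t tB; apply: p0; apply: outK => /=; rewrite (tb t tB).
Qed.

Lemma test_functionM (R : realType) (Om : set (R * R)) (th phi : R * R -> R) :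
  smooth th -> test_function Om phi -> test_function Om (fun x => th x * phi x).
Proof.
move=> sth [sphi [K [cK KO phi0]]]; split; first exact: smoothM.
by exists K; split=> // x /phi0 ->; rewrite mulr0.
Qed.

Lemma partialM (R : realType) (f g : R * R -> R) i x : smooth f -> smooth g ->
  partial i (fun x => f x * g x) x = f x * partial i g x + g x * partial i f x.
Proof.
move=> sf sg; apply: derive_val.
exact: is_deriveM (smooth_is_derive _ _ sf) (smooth_is_derive _ _ sg).
Qed.

(** The disc has finite measure, so |f| <= 1 + f^2 suffices. *)
Lemma L2_integrable (R : realType) c r (f : R * R -> R) :
  L2 (disc c r) f -> (leb2 R).-integrable (disc c r) (EFin \o f).
Proof.
case=> mf f2; have mD := disc_measurable c r.
have i1 : (leb2 R).-integrable (disc c r) (EFin \o (fun x => 1 + f x ^+ 2)).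
  have -> : EFin \o (fun x => 1 + f x ^+ 2) = (EFin \o (cst 1 : R * R -> R)) \+ (EFin \o (fun x => f x ^+ 2)) by apply/funext.
  apply: integrableD => //.
    by apply: integrable_leb2_disc; exact: cst_continuous.
  apply/integrableP; split.
    by apply/measurable_EFinP; apply: measurable_funX.
  under eq_integral => x _ do rewrite /= ger0_norm ?sqr_ge0//.
  exact: f2.
apply: (le_integrable mD _ _ i1); first exact/measurable_EFinP.
move=> x _ /=; rewrite lee_fin [leRHS]ger0_norm; last by rewrite addr_ge0 // sqr_ge0.
have H := sqr_ge0 (`|f x| - 1); rewrite -(real_normK (num_real (f x))).
move: H; rewrite !expr2; have := normr_ge0 (f x); nra.
Qed.

Lemma integrable_contM (R : realType) c r (f h : R * R -> R) :
  (leb2 R).-integrable (disc c r) (EFin \o f) -> continuous h ->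
  (leb2 R).-integrable (disc c r) (EFin \o (fun x => f x * h x)).
Proof.
move=> fi ch; have [B B0 HB] := continuous_bounded_disc c r ch.
have -> : EFin \o (fun x => f x * h x) = ((EFin \o h) \* (EFin \o f))%E.
  by apply/funext => x /=; rewrite mulrC EFinM.
apply: integrableMr => //; first exact: disc_measurable.
- by apply: measurable_funTS; exact: continuous_measurable2.
- exists B; split; first exact: num_real.
  by move=> y yB x /HB/le_trans; apply; exact: ltW.
Qed.

(** Testing the weak gradient of f with th * phi gives the product rule; the
    remaining terms are the integral of the partial derivative of b * phi,
    which vanishes. *)
Lemma weak_grad_affine (R : realType) c r (f th b : R * R -> R) (g : R * R -> R * R) :
  smooth th -> smooth b ->
  L2 (disc c r) f -> L2 (disc c r) (fun x => (g x).1) ->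
  L2 (disc c r) (fun x => (g x).2) -> weak_grad (disc c r) f g ->
  weak_grad (disc c r) (fun x => th x * f x + b x)
   (fun x => (th x * (g x).1 + f x * partial false th x + partial false b x,
              th x * (g x).2 + f x * partial true th x + partial true b x)).
Proof.
move=> sth sb /L2_integrable fi /L2_integrable g1i /L2_integrable g2i wg phi tphi.
have sphi := tphi.1.
have mD := disc_measurable c r.
suff H i (gi : R * R -> R) : (leb2 R).-integrable (disc c r) (EFin \o gi) ->
   \int[leb2 R]_(x in disc c r) (f x * partial i (fun x => th x * phi x) x) =
     - (\int[leb2 R]_(x in disc c r) (gi x * (th x * phi x))) ->
   \int[leb2 R]_(x in disc c r) ((th x * f x + b x) * partial i phi x) =
   - \int[leb2 R]_(x in disc c r) ((th x * gi x + f x * partial i th x + partial i b x) * phi x).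
  have [w1 w2] := wg _ (test_functionM sth tphi).
  by split; [exact: (H false (fun x => (g x).1))|exact: (H true (fun x => (g x).2))].
move=> gii W.
have cphi := smooth_cont sphi; have cth := smooth_cont sth; have cb := smooth_cont sb.
have cpphi := smooth_cont (smooth_partial i sphi).
have cpth := smooth_cont (smooth_partial i sth).
have cpb := smooth_cont (smooth_partial i sb).
have cM (h k : R * R -> R) : continuous h -> continuous k -> continuous (fun x => h x * k x).
  by move=> ch ck x; apply: continuousM; [exact: ch|exact: ck].
have i1 := integrable_contM fi (smooth_cont (smooth_partial i (smoothM sth sphi))).
have i2 := integrable_contM fi (cM _ _ cphi cpth).
have i3 := integrable_leb2_disc c r (smooth_cont (smooth_partial i (smoothM sb sphi))).
have i4 := integrable_leb2_disc c r (cM _ _ cphi cpb).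
have i5 := integrable_contM gii (cM _ _ cth cphi).
have E0 := integral_partial0 i (test_functionM sb tphi).
have E1 : \int[leb2 R]_(x in disc c r) ((th x * f x + b x) * partial i phi x) =
  \int[leb2 R]_(x in disc c r) ((f x * partial i (fun x => th x * phi x) x
     - f x * (phi x * partial i th x)) +
    (partial i (fun x => b x * phi x) x - phi x * partial i b x)).
  apply: eq_Rintegral => x _; rewrite !partialM //; ring.
rewrite E1 RintegralD //; first last.
- by have := integrableB mD i3 i4; rewrite /comp; under eq_fun do rewrite -EFinB.
- by have := integrableB mD i1 i2; rewrite /comp; under eq_fun do rewrite -EFinB.
rewrite RintegralB // RintegralB // W E0.
have E2 : \int[leb2 R]_(x in disc c r) ((th x * gi x + f x * partial i th x + partial i b x) * phi x) =
  \int[leb2 R]_(x in disc c r) (gi x * (th x * phi x) + f x * (phi x * partial i th x)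
     + phi x * partial i b x).
  apply: eq_Rintegral => x _; ring.
rewrite E2 RintegralD //; last first.
  by have := integrableD mD i5 i2; rewrite /comp; under eq_fun do rewrite -EFinD.
rewrite RintegralD //; ring.
Qed.

Lemma L2_cont (R : realType) c r (b : R * R -> R) : continuous b -> L2 (disc c r) b.
Proof.
move=> cb; split; first by apply: measurable_funTS; exact: continuous_measurable2.
have cb2 : continuous (fun x => b x * b x).
  by move=> x; apply: continuousM; exact: cb.
have /integrableP[_] := integrable_leb2_disc c r cb2.
apply: le_lt_trans; apply: ge0_le_integral => //.
- exact: disc_measurable.
- by move=> x _; rewrite lee_fin sqr_ge0.
- apply/measurable_EFinP; apply: measurable_funX.
  by apply: measurable_funTS; exact: continuous_measurable2.
- apply: measurableT_comp => //; apply/measurable_EFinP.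
  by apply: measurable_funTS; exact: continuous_measurable2.
- by move=> x _; rewrite /= lee_fin expr2 ler_norm.
Qed.

Lemma L2_le (R : realType) c r (f g h : R * R -> R) :
  measurable_fun (disc c r : set (plane R)) h -> L2 (disc c r) f -> L2 (disc c r) g ->
  (exists B : R, 0 <= B /\ forall x, disc c r x -> h x ^+ 2 <= B * (f x ^+ 2 + g x ^+ 2)) ->
  L2 (disc c r) h.
Proof.
move=> mh [mf f2] [mg g2] [B [B0 HB]]; split=> //.
have mD := disc_measurable c r.
have ms (k : R * R -> R) : measurable_fun (disc c r : set (plane R)) k ->
   measurable_fun (disc c r : set (plane R)) (fun x => (k x ^+ 2)%:E).
  by move=> mk; apply/measurable_EFinP; exact: measurable_funX.
have : (\int[leb2 R]_(x in disc c r) (B%:E * ((f x ^+ 2)%:E + (g x ^+ 2)%:E)) < +oo)%E.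
  rewrite ge0_integralZl //; first last.
  - by move=> x _; rewrite adde_ge0 // lee_fin sqr_ge0.
  - by apply: emeasurable_funD; exact: ms.
  rewrite ge0_integralD //; first last.
  - exact: ms.
  - by move=> x _; rewrite lee_fin sqr_ge0.
  - exact: ms.
  - by move=> x _; rewrite lee_fin sqr_ge0.
  by apply: lte_mul_pinfty => //; exact: lte_add_pinfty.
apply: le_lt_trans; apply: ge0_le_integral => //.
- by move=> x _; rewrite lee_fin sqr_ge0.
- exact: ms.
- by apply: measurable_funeM; apply: emeasurable_funD; exact: ms.
Qed.

Lemma L2D (R : realType) c r (f g : R * R -> R) :
  L2 (disc c r) f -> L2 (disc c r) g -> L2 (disc c r) (fun x => f x + g x).
Proof.
move=> Lf Lg; apply: (L2_le _ Lf Lg).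
  by apply: measurable_funD; [exact: Lf.1|exact: Lg.1].
exists 2; split=> // x _; have := sqr_ge0 (f x - g x); rewrite !expr2; nra.
Qed.

Lemma L2M (R : realType) c r (f h : R * R -> R) :
  L2 (disc c r) f -> continuous h -> L2 (disc c r) (fun x => f x * h x).
Proof.
move=> Lf ch; have [B B0 HB] := continuous_bounded_disc c r ch.
apply: (L2_le _ Lf Lf).
  apply: measurable_funM; first exact: Lf.1.
  by apply: measurable_funTS; exact: continuous_measurable2.
exists (B ^+ 2); split=> [|x /HB hB]; first exact: sqr_ge0.
have h2 : h x ^+ 2 <= B ^+ 2.
  by rewrite -(real_normK (num_real (h x))) ler_sqr ?nnegrE.
rewrite exprMn; have := sqr_ge0 (f x); have := sqr_ge0 B; nra.
Qed.

(** Every competitor used below has components of the form th * f + b with th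
    and b smooth. *)
Lemma sobolev_affine (R : realType) c r (f th b : R * R -> R) (g : R * R -> R * R) :
  smooth th -> smooth b -> sobolev (disc c r) f g ->
  sobolev (disc c r) (fun x => th x * f x + b x)
   (fun x => (th x * (g x).1 + f x * partial false th x + partial false b x,
              th x * (g x).2 + f x * partial true th x + partial true b x)).
Proof.
move=> sth sb [Lf L1 L2' wg].
have cp h i : smooth h -> continuous (partial i h).
  by move=> sh; exact: (smooth_cont (smooth_partial i sh)).
have thM k : L2 (disc c r) k -> L2 (disc c r) (fun x => th x * k x).
  move=> Lk; have -> : (fun x => th x * k x) = (fun x => k x * th x).
    by apply/funext => x; rewrite mulrC.
  by apply: L2M => //; exact: smooth_cont.
split; last exact: weak_grad_affine.
- by apply: L2D; [exact: thM | exact: L2_cont (smooth_cont sb)].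
- apply: L2D; last by apply: L2_cont; exact: cp.
  by apply: L2D; [exact: thM | apply: L2M => //; exact: cp].
- apply: L2D; last by apply: L2_cont; exact: cp.
  by apply: L2D; [exact: thM | apply: L2M => //; exact: cp].
Qed.

(** * A bounded weak gradient makes a continuous function Lipschitz *)

(** A smooth step from 0 to 1 on [-e, e]; its derivative [rstep] is a mollifier,
    so that the difference of two steps has a difference of two mollifiers as
    derivative. *)
Definition hstep (R : realType) (e t : R) : R := smoothstep (t / (2 * e) + 2^-1).
Definition rstep (R : realType) (e t : R) : R := dsmoothstep (t / (2 * e) + 2^-1) / (2 * e).

Lemma is_derive_hstep (R : realType) (e t : R) :
  is_derive t (1 : R) (hstep e) (rstep e t).
Proof.
have d : is_derive t (1 : R) (fun t : R => t * (2 * e)^-1 + 2^-1) (2 * e)^-1.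
  have := is_deriveD (is_deriveM (is_derive_id t (1 : R)) (is_derive_cst ((2 * e)^-1) t 1)) (is_derive_cst (2^-1 : R) t (1 : R)).
  move=> H; apply: (is_derive_eq H).
  by rewrite scaler0 add0r addr0 /GRing.scale /= mulr1.
exact: (is_derive1_comp (is_derive_smoothstep _) d).
Qed.

Lemma rstep_continuous (R : realType) (e : R) : continuous (rstep e).
Proof.
move=> t; apply: (@continuousM _ _ (fun t : R => dsmoothstep (t / (2 * e) + 2^-1)) (cst (2 * e)^-1)); last exact: cst_continuous.
apply: (@continuous_comp _ _ _ (fun t : R => t / (2 * e) + 2^-1) (@dsmoothstep R)); last exact: dsmoothstep_continuous.
apply: (@continuousD _ _ _ (fun t : R => t / (2 * e)) (cst 2^-1)); last exact: cst_continuous.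
by apply: (@continuousM _ _ id (cst (2 * e)^-1)); [exact: cvg_id|exact: cst_continuous].
Qed.

Lemma rstep_ge0 (R : realType) (e t : R) : 0 < e -> 0 <= rstep e t.
Proof. by move=> e0; rewrite mulr_ge0 ?dsmoothstep_ge0 // invr_ge0; lra. Qed.

Lemma rstep_out (R : realType) (e t : R) : 0 < e -> ~~ (- e <= t <= e) -> rstep e t = 0.
Proof.
move=> e0 H; rewrite /rstep dsmoothstep_out ?mul0r //; apply: contra H => /andP[h1 h2].
have e2 : 0 < 2 * e by lra.
have {h1}: - 2^-1 < t / (2 * e) by lra.
have {h2}: t / (2 * e) < 2^-1 by lra.
rewrite ltr_pdivrMr // ltr_pdivlMr // => ? ?; apply/andP; split; lra.
Qed.

Lemma hstep_le0 (R : realType) (e t : R) : 0 < e -> t <= - e -> hstep e t = 0.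
Proof.
move=> e0 te; apply: smoothstep0.
have e2 : 0 < 2 * e by lra.
have : t / (2 * e) <= - 2^-1 by rewrite ler_pdivrMr //; lra.
by lra.
Qed.

Lemma hstep_ge1 (R : realType) (e t : R) : 0 < e -> e <= t -> hstep e t = 1.
Proof.
move=> e0 te; apply: smoothstep1.
have e2 : 0 < 2 * e by lra.
have : 2^-1 <= t / (2 * e) by rewrite ler_pdivlMr //; lra.
by lra.
Qed.

Lemma hstep_mono (R : realType) (e s t : R) : 0 < e -> s <= t -> hstep e s <= hstep e t.
Proof.
move=> e0 st; have d x := is_derive_hstep e x.
apply: (@ger0_derive1_le_cc R (hstep e) s t) => //.
- by move=> x _; rewrite derive1E (@derive_val _ _ _ _ _ _ _ (d x)) rstep_ge0.
- by apply: continuous_subspaceT; exact: (is_derive_continuous d).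
- by rewrite in_itv /= lexx st.
- by rewrite in_itv /= lexx st.
Qed.

Lemma integral_rstep (R : realType) (e p : R) : 0 < e ->
  (\int[@lebesgue_measure R]_x (rstep e (x - p))%:E = 1)%E.
Proof.
move=> e0.
have d (t : R) : is_derive t (1 : R) (fun x => hstep e (x - p)) (rstep e (t - p)).
  have d1 : is_derive t (1 : R) (fun x : R => x - p) 1.
    by apply: (is_derive_eq (is_deriveB (is_derive_id _ _) (is_derive_cst _ _ _))); rewrite subr0.
  apply: (is_derive_eq (is_derive1_comp (is_derive_hstep e _) d1)).
  by rewrite mulr1.
have ab : p - e < p + e by lra.
rewrite (integral_derive_support ab d).
- by rewrite hstep_ge1 ?hstep_le0 ?subr0 //; lra.
- move=> t; apply: (@continuous_comp _ _ _ (fun x : R => x - p) (rstep e)); last exact: rstep_continuous.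
  by apply: continuousB; [exact: cvg_id|exact: cst_continuous].
- by move=> t H; apply: rstep_out => //; apply: contra H => /andP[? ?]; apply/andP; split; lra.
Qed.

(** Coordinates are indexed by the same booleans as [axis], so that the two
    directions are handled by one argument. *)
Definition coord (R : realType) (i : bool) (x : R * R) : R := if i then x.2 else x.1.

Lemma coord_smooth (R : realType) i : smooth (@coord R i).
Proof. by case: i; [exact: smooth_snd|exact: smooth_fst]. Qed.

Lemma is_derive_coord (R : realType) i j (x : R * R) :
  is_derive x (axis R i) (@coord R j) ((i == j)%:R).
Proof.
have <- : coord j (axis R i) = (i == j)%:R by case: i; case: j.
by case: j; [exact: partial_snd|exact: partial_fst].
Qed.

Lemma coord_norm (R : realType) i (x : R * R) : `|coord i x| <= norm2 x.
Proof. by case: i; [exact: normr2_le_norm2|exact: normr1_le_norm2]. Qed.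

Lemma coordB (R : realType) i (x y : R * R) : coord i (x - y) = coord i x - coord i y.
Proof. by case: i. Qed.

Lemma norm2_coord (R : realType) i (x : R * R) :
  norm2 x ^+ 2 = coord i x ^+ 2 + coord (~~ i) x ^+ 2.
Proof. by rewrite norm2_sqr; case: i => //=; rewrite addrC. Qed.

(** Stated for nonnegative factors, so that no integrability has to be checked. *)
Lemma integral_coord_prod (R : realType) i (A B : R -> R) :
  continuous A -> continuous B -> (forall t, 0 <= A t) -> (forall t, 0 <= B t) ->
  (\int[leb2 R]_x (A (coord i x) * B (coord (~~ i) x))%:E =
   (\int[@lebesgue_measure R]_t (A t)%:E) * (\int[@lebesgue_measure R]_t (B t)%:E))%E.
Proof.
wlog -> : i A B / i = false.
  move=> H; case: i; last exact: H.
  move=> cA cB A0 B0; rewrite muleC -(H false B A) //.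
  by apply: eq_integral => x _; rewrite mulrC.
move=> cA cB A0 B0 /=.
have cc (f : R -> R) (g : R * R -> R) : continuous f -> continuous g -> continuous (f \o g).
  by move=> cf cg x; apply: continuous_comp; [exact: cg|exact: cf].
have mA : measurable_fun setT A by exact: continuous_measurable_fun.
have mB : measurable_fun setT B by exact: continuous_measurable_fun.
have mf : measurable_fun setT (fun x : plane R => (A x.1 * B x.2)%:E).
  apply/measurable_EFinP; apply: (@continuous_measurable2 R (fun x => A x.1 * B x.2)) => x.
  apply: (@continuousM _ _ (A \o fst) (B \o snd)).
    exact: (cc _ _ cA (@fst_continuous R)).
  exact: (cc _ _ cB (@snd_continuous R)).
transitivity (\int[@lebesgue_measure R]_x (fubini_F (@lebesgue_measure R) (fun x : plane R => (A x.1 * B x.2)%:E) x))%E.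
  by apply: fubini_tonelli1 => // x; rewrite lee_fin mulr_ge0.
rewrite /fubini_F /=.
under eq_integral => x _.
  rewrite (_ : (\int[lebesgue_measure]_y _ = (A x)%:E * \int[@lebesgue_measure R]_t (B t)%:E)%E); last first.
    under eq_integral do rewrite EFinM.
    rewrite ge0_integralZl //; first exact/measurable_EFinP.
      by move=> y _; rewrite lee_fin.
    by rewrite lee_fin.
  over.
rewrite ge0_integralZr //.
- exact/measurable_EFinP.
- by move=> y _; rewrite lee_fin.
- by apply: integral_ge0 => y _; rewrite lee_fin.
Qed.

Lemma Rintegral_coord_prod (R : realType) i c r (A B : R -> R) :
  continuous A -> continuous B -> (forall t, 0 <= A t) -> (forall t, 0 <= B t) ->
  (forall x, ~ disc c r x -> A (coord i x) * B (coord (~~ i) x) = 0) ->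
  \int[leb2 R]_(x in disc c r) (A (coord i x) * B (coord (~~ i) x)) =
  fine ((\int[@lebesgue_measure R]_t (A t)%:E) * (\int[@lebesgue_measure R]_t (B t)%:E))%E.
Proof.
move=> cA cB A0 B0 H; rewrite -(integral_coord_prod i cA cB A0 B0) /Rintegral.
rewrite integral_mkcond; congr fine; apply: eq_integral => x _.
rewrite patchE; case: ifPn => // /negP xO; rewrite H // => xd; apply: xO.
by rewrite inE.
Qed.

Lemma coord_box_norm (R : realType) (x y : R * R) i (e : R) : 0 <= e ->
  `|coord i x| <= `|coord i y| + e -> `|coord (~~ i) x| <= `|coord (~~ i) y| + e ->
  norm2 x <= norm2 y + 2 * e.
Proof.
wlog -> : i / i = false.
  by move=> H; case: i => e0 h1 h2; [apply: (H false)|apply: (H false)].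
move=> e0 /= h1 h2.
have H0 : norm2 x <= norm2 ((`|y.1|, `|y.2|) + (e, e) : R * R).
  rewrite norm2_le ?norm2_ge0 // norm2_sqr /=.
  rewrite -(real_normK (num_real x.1)) -(real_normK (num_real x.2)).
  by apply: lerD; rewrite ler_sqr ?nnegrE ?addr_ge0.
apply: (le_trans H0); apply: (le_trans (norm2_triangle _ _)); apply: lerD.
  by rewrite norm2_le ?norm2_ge0 // norm2_sqr /= !real_normK ?num_real.
by apply: (le_trans (norm2_le_sum _)); rewrite /= ger0_norm // mulr2n mulrDl mul1r.
Qed.

(** A mollifier at P, of product form so that its integral is computed by
    [integral_coord_prod]. *)
Definition bump (R : realType) i (e : R) (P x : R * R) : R :=
  rstep e (coord i x - coord i P) * rstep e (coord (~~ i) x - coord (~~ i) P).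

Definition coord_box (R : realType) i (e : R) (P x : R * R) : Prop :=
  `|coord i x - coord i P| <= e /\ `|coord (~~ i) x - coord (~~ i) P| <= e.

Lemma smooth_rstep_comp (R : realType) (e c : R) j : smooth (fun x => rstep e (coord j x - c)).
Proof.
apply: smoothM; last exact: smooth_cst.
apply: smooth_dsmoothstep_comp; apply: smoothD; last exact: smooth_cst.
apply: smoothM; last exact: smooth_cst.
by apply: smoothB; [exact: coord_smooth|exact: smooth_cst].
Qed.

Lemma smooth_hstep_comp (R : realType) (e c : R) j : smooth (fun x => hstep e (coord j x - c)).
Proof.
apply: smooth_smoothstep_comp; apply: smoothD; last exact: smooth_cst.
apply: smoothM; last exact: smooth_cst.
by apply: smoothB; [exact: coord_smooth|exact: smooth_cst].
Qed.

Lemma bump_ge0 (R : realType) i (e : R) (P x : R * R) : 0 < e -> 0 <= bump i e P x.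
Proof. by move=> e0; rewrite mulr_ge0 // rstep_ge0. Qed.

Lemma bump_out (R : realType) i (e : R) (P x : R * R) : 0 < e -> ~ coord_box i e P x -> bump i e P x = 0.
Proof.
move=> e0 nb; rewrite /bump.
have [h1|h1] := boolP (`|coord i x - coord i P| <= e); last first.
  by rewrite rstep_out ?mul0r // -ler_norml.
have [h2|h2] := boolP (`|coord (~~ i) x - coord (~~ i) P| <= e); last first.
  by rewrite [X in _ * X]rstep_out ?mulr0 // -ler_norml.
by case: nb; split.
Qed.

Lemma smooth_bump (R : realType) i (e : R) (P : R * R) : smooth (bump i e P).
Proof. by apply: smoothM; exact: smooth_rstep_comp. Qed.

Lemma shift_continuous (R : realType) (f : R -> R) (p : R) : continuous f -> continuous (fun t => f (t - p)).
Proof.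
move=> cf t; apply: (@continuous_comp _ _ _ (fun x : R => x - p) f); last exact: cf.
by apply: continuousB; [exact: cvg_id|exact: cst_continuous].
Qed.

Lemma integral_bump (R : realType) c r i (e : R) (P : R * R) : 0 < e ->
  coord_box i e P `<=` disc c r -> \int[leb2 R]_(x in disc c r) bump i e P x = 1.
Proof.
move=> e0 bO; have H (p t : R) : 0 <= rstep e (t - p) by exact: rstep_ge0.
have ct (p : R) : continuous (fun t => rstep e (t - p)).
  by apply: shift_continuous; exact: rstep_continuous.
rewrite (@Rintegral_coord_prod R i c r (fun t => rstep e (t - coord i P))
  (fun t => rstep e (t - coord (~~ i) P))) //.
  by rewrite !integral_rstep // mule1.
by move=> x xO; apply: (@bump_out R i e P) => // /bO.
Qed.

Lemma mollify_close (R : realType) c r i (e d : R) (P : R * R) (f : R * R -> R) :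
  0 < e -> coord_box i e P `<=` disc c r ->
  (leb2 R).-integrable (disc c r) (EFin \o f) ->
  (forall x, coord_box i e P x -> `|f x - f P| <= d) ->
  `|\int[leb2 R]_(x in disc c r) (f x * bump i e P x) - f P| <= d.
Proof.
move=> e0 bO fi Hd; have cb := smooth_cont (smooth_bump i e P).
have mD := disc_measurable c r.
have ib := integrable_leb2_disc c r cb.
have i1 := integrable_contM fi cb.
have i2 : (leb2 R).-integrable (disc c r) (EFin \o (fun x => f P * bump i e P x)).
  by have := integrableZl mD (f P) ib.
have i3 : (leb2 R).-integrable (disc c r) (EFin \o (fun x => d * bump i e P x)).
  by have := integrableZl mD d ib.
have E : f P = \int[leb2 R]_(x in disc c r) (f P * bump i e P x).
  by rewrite RintegralZl // integral_bump // mulr1.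
rewrite [X in _ - X]E -RintegralB //.
have i4 : (leb2 R).-integrable (disc c r) (EFin \o (fun x => f x * bump i e P x - f P * bump i e P x)).
  by have := integrableB mD i1 i2; rewrite /comp; under eq_fun do rewrite -EFinB.
apply: (le_trans (le_normr_Rintegral mD i4)).
rewrite -[leRHS]mulr1 -(integral_bump (c := c) (r := r) e0 bO) -RintegralZl //.
apply: le_Rintegral => //.
  have := integrable_norm i4; rewrite /comp /=.
  by under eq_fun do rewrite /=.
move=> x xO; rewrite -mulrBl normrM (ger0_norm (bump_ge0 _ _ _ e0)).
have [b|nb] := pselect (coord_box i e P x); last by rewrite bump_out // !mulr0.
by rewrite ler_wpM2r ?bump_ge0 // Hd.
Qed.

(** A compact neighborhood of the segment from P to Q that contains the support
    of [hat]. *)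
Definition corridor (R : realType) i (e : R) (P Q : R * R) : set (R * R) :=
  [set x | coord i P - e <= coord i x <= coord i Q + e /\
           coord (~~ i) P - e <= coord (~~ i) x <= coord (~~ i) P + e].

Lemma compact_corridor (R : realType) i (e : R) (P Q : R * R) :
  compact (corridor i e P Q).
Proof.
rewrite /corridor; case: i => /=.
- rewrite (_ : mkset _ = `[P.1 - e, P.1 + e] `*` `[P.2 - e, Q.2 + e]).
    by apply: compact_setX; exact: segment_compact.
  by apply/seteqP; split=> x /=; rewrite !in_itv /= => -[].
- rewrite (_ : mkset _ = `[P.1 - e, Q.1 + e] `*` `[P.2 - e, P.2 + e]).
    by apply: compact_setX; exact: segment_compact.
  by apply/seteqP; split=> x /=; rewrite !in_itv /= => -[].
Qed.

Lemma partial_coord_shift (R : realType) (h dh : R -> R) (c : R) i j x :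
  (forall t : R, is_derive t (1 : R) h (dh t)) ->
  is_derive x (axis R i) (fun x => h (coord j x - c)) (dh (coord j x - c) * (i == j)%:R).
Proof.
move=> d; apply: (is_derive_comp2 (h := h) (q := fun x => coord j x - c)).
apply: (is_derive_eq (is_deriveB (is_derive_coord i j x) (is_derive_cst _ _ _))).
by rewrite subr0.
Qed.

(** A test function whose i-th derivative is the difference of the mollifiers at P
    and Q, two points that differ only in the i-th coordinate. Testing with it
    turns the weak gradient into a bound on f P - f Q. *)
Definition hat (R : realType) i (e : R) (P Q x : R * R) : R :=
  rstep e (coord (~~ i) x - coord (~~ i) P) *
  (hstep e (coord i x - coord i P) - hstep e (coord i x - coord i Q)).

Lemma partial_hat (R : realType) i (e : R) (P Q x : R * R) :
  coord (~~ i) P = coord (~~ i) Q ->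
  partial i (hat i e P Q) x = bump i e P x - bump i e Q x.
Proof.
move=> PQ.
have d1 : is_derive x (axis R i) (fun x => rstep e (coord (~~ i) x - coord (~~ i) P)) 0.
  apply: is_derive_line.
  rewrite (_ : (fun t : R => _) = cst (rstep e (coord (~~ i) x - coord (~~ i) P))).
    exact: is_derive_cst.
  apply/funext => t; congr (rstep e (_ - _)).
  by case: (i) => /=; rewrite /GRing.scale /= mulr0 addr0.
have d2 := is_deriveB (partial_coord_shift (coord i P) i i x (is_derive_hstep e))
     (partial_coord_shift (coord i Q) i i x (is_derive_hstep e)).
have d3 := is_deriveM d1 d2.
rewrite /partial (_ : hat i e P Q = (fun x => rstep e (coord (~~ i) x - coord (~~ i) P)) *
     ((fun x => hstep e (coord i x - coord i P)) - (fun x => hstep e (coord i x - coord i Q)))) //.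
rewrite (@derive_val _ _ _ _ _ _ _ d3) scaler0 addr0 eqxx !mulr1.
by rewrite /bump -PQ /GRing.scale /= mulrBr; congr (_ - _); rewrite mulrC.
Qed.

Lemma smooth_hat (R : realType) i (e : R) (P Q : R * R) : smooth (hat i e P Q).
Proof.
apply: smoothM; first exact: smooth_rstep_comp.
by apply: smoothB; exact: smooth_hstep_comp.
Qed.

Lemma hat_ge0 (R : realType) i (e : R) (P Q x : R * R) : 0 < e ->
  coord i P <= coord i Q -> 0 <= hat i e P Q x.
Proof.
move=> e0 pq; rewrite mulr_ge0 ?rstep_ge0 // subr_ge0.
by apply: hstep_mono => //; lra.
Qed.

(** To the left of the corridor both steps are 0, to its right both are 1. *)
Lemma hat_out (R : realType) i (e : R) (P Q x : R * R) : 0 < e ->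
  ~ corridor i e P Q x ->
  coord i P <= coord i Q -> hat i e P Q x = 0.
Proof.
move=> e0 nb pq; rewrite /hat.
have [h2|h2] := boolP (- e <= coord (~~ i) x - coord (~~ i) P <= e); last first.
  by rewrite rstep_out ?mul0r.
have [h1|h1] := ltP (coord i x) (coord i P - e).
  by rewrite !hstep_le0 ?subrr ?mulr0 //; lra.
have [h3|h3] := ltP (coord i Q + e) (coord i x).
  by rewrite !hstep_ge1 ?subrr ?mulr0 //; lra.
case: nb; split; first by rewrite h1 h3.
by case/andP: h2 => ? ?; apply/andP; split; lra.
Qed.

(** The factor across the segment has integral 1, the factor along it is at most 1
    on an interval of length coord i Q - coord i P + 2 e. *)
Lemma integral_hat (R : realType) c r i (e : R) (P Q : R * R) : 0 < e ->
  coord i P <= coord i Q ->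
  (forall x, ~ disc c r x -> hat i e P Q x = 0) ->
  \int[leb2 R]_(x in disc c r) hat i e P Q x <= coord i Q - coord i P + 2 * e.
Proof.
move=> e0 pq H0.
pose D (t : R) := hstep e (t - coord i P) - hstep e (t - coord i Q).
have cs (p : R) : continuous (fun t => hstep e (t - p)).
  by apply: shift_continuous; exact: (is_derive_continuous (is_derive_hstep e)).
have cD : continuous D.
  by move=> t; apply: (@continuousB _ _ _ (fun t => hstep e (t - coord i P))
    (fun t => hstep e (t - coord i Q))); exact: cs.
have D0 t : 0 <= D t by rewrite subr_ge0; apply: hstep_mono => //; lra.
have D1 t : D t <= 1.
  have h1 : hstep e (t - coord i P) <= 1 by exact: smoothstep_le1.
  have h2 : 0 <= hstep e (t - coord i Q) by exact: smoothstep_ge0.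
  rewrite /D; lra.
have r0 t : 0 <= rstep e (t - coord (~~ i) P) by exact: rstep_ge0.
have cr : continuous (fun t => rstep e (t - coord (~~ i) P)).
  by apply: shift_continuous; exact: rstep_continuous.
have E (x : R * R) : hat i e P Q x = D (coord i x) * rstep e (coord (~~ i) x - coord (~~ i) P).
  by rewrite /hat mulrC.
under eq_Rintegral do rewrite E.
rewrite (@Rintegral_coord_prod R i c r D (fun t => rstep e (t - coord (~~ i) P))) //; last first.
  by move=> x /H0; rewrite E.
rewrite integral_rstep // mule1.
have ab : coord i P - e <= coord i Q + e by lra.
have le : (\int[@lebesgue_measure R]_t (D t)%:E <= (coord i Q - coord i P + 2 * e)%:E)%E.
  have -> : (\int[@lebesgue_measure R]_t (D t)%:E =
     \int[@lebesgue_measure R]_(t in `[(coord i P - e)%R, (coord i Q + e)%R]) (D t)%:E)%E.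
    rewrite [RHS]integral_mkcond; apply: eq_integral => x _.
    rewrite patchE; case: ifPn => // /negP xab; rewrite /D.
    have [h1|h1] := ltP x (coord i P - e).
      by rewrite !hstep_le0 ?subrr //; lra.
    have [h3|h3] := ltP (coord i Q + e) x.
      by rewrite !hstep_ge1 ?subrr //; lra.
    by case: xab; rewrite inE /= in_itv /= h1 h3.
  apply: (@le_trans _ _ (\int[@lebesgue_measure R]_(t in `[(coord i P - e)%R, (coord i Q + e)%R]) (cst 1 t))%E).
    apply: ge0_le_integral => //.
    - by move=> x _; rewrite lee_fin.
    - by apply/measurable_EFinP; apply: measurable_funTS; exact: continuous_measurable_fun.
    - by move=> x _; rewrite lee_fin.
  have E0 : @lebesgue_measure R `[coord i P - e, coord i Q + e] = (coord i Q + e - (coord i P - e))%:E.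
    rewrite lebesgue_measure_itv /= lte_fin; case: ltP => H; first by rewrite EFinB.
    by congr (_%:E); lra.
  rewrite integral_cst // mul1e.
  rewrite [X in (X <= _)%E]E0.
  by rewrite lee_fin; lra.
rewrite -lee_fin fineK // ge0_fin_numE ?(le_lt_trans le) ?ltry //.
by apply: integral_ge0 => t _; rewrite lee_fin.
Qed.

Lemma dist_close (R : realType) (p q p' q' d k : R) :
  `|p' - q'| <= k -> `|p' - p| <= d -> `|q' - q| <= d -> `|p - q| <= 2 * d + k.
Proof.
move=> h1 h2 h3; have -> : p - q = (p' - q') - (p' - p) + (q' - q) by ring.
apply: (le_trans (ler_normD _ _)); have := ler_normB (p' - q') (p' - p); lra.
Qed.

(** By definition of the weak gradient, the integral of f against the difference
    of the mollifiers at P and Q is minus that of the i-th component of g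
    against [hat]. As the scale goes to 0 the first tends to f P - f Q by
    continuity, and the second is bounded by M times the distance. *)
Lemma weak_grad_lipschitz1 (R : realType) (rho M : R) (f : R * R -> R)
    (g : R * R -> R * R) i (P Q : R * R) : 0 <= M ->
  {in disc 0 rho, continuous f} -> sobolev (disc 0 rho) f g ->
  (\forall x \ae leb2 R, disc 0 rho x -> `|coord i (g x)| <= M) ->
  disc 0 rho P -> disc 0 rho Q -> coord (~~ i) P = coord (~~ i) Q ->
  coord i P <= coord i Q ->
  `|f P - f Q| <= M * (coord i Q - coord i P).
Proof.
move=> M0 cf [Lf Lg1 Lg2 wg] gM PO QO PQ pq.
have mD := @disc_measurable R 0 rho.
have Lgi : L2 (disc 0 rho) (fun x => coord i (g x)) by case: (i).
have gii := L2_integrable Lgi.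
have fi := L2_integrable Lf.
pose m := Num.max (norm2 P) (norm2 Q).
have mrho : m < rho.
  by move: PO QO; rewrite /disc /= !subr0 /m => ? ?; rewrite gt_max; apply/andP.
(* At scale e the weak gradient is tested with hat i e P Q; the support of
   that function is a corridor inside the disc since m + 2 e < rho. *)
have key (e d : R) : 0 < e -> m + 2 * e < rho ->
    (forall x, coord_box i e P x -> `|f x - f P| <= d) ->
    (forall x, coord_box i e Q x -> `|f x - f Q| <= d) ->
    `|f P - f Q| <= 2 * d + M * (coord i Q - coord i P + 2 * e).
  move=> e0 me dP dQ.
  have cO : corridor i e P Q `<=` disc 0 rho.
    move=> x [/andP[h1 h2] /andP[h3 h4]]; rewrite /disc /= subr0.
    have Hy : `|coord (~~ i) x| <= `|coord (~~ i) P| + e.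
      rewrite -(subrK (coord (~~ i) P) (coord (~~ i) x)) addrC.
      apply: (le_trans (ler_normD _ _)); rewrite lerD2l ler_norml.
      by apply/andP; split; lra.
    have [H|H] := lerP `|coord i P| `|coord i Q|.
      apply: (@le_lt_trans _ _ (norm2 Q + 2 * e)).
        apply: (coord_box_norm (i := i)); first exact: ltW.
          rewrite ler_norml; move: H; rewrite ler_norml => /andP[? ?].
          have := ler_norm (coord i Q); rewrite lerNl => ?.
          by apply/andP; split; lra.
        by rewrite -PQ.
      by apply: le_lt_trans me; rewrite lerD2r /m le_max lexx orbT.
    apply: (@le_lt_trans _ _ (norm2 P + 2 * e)).
      apply: (coord_box_norm (i := i)) => //; first exact: ltW.
      rewrite ler_norml; move/ltW: H; rewrite ler_norml => /andP[? ?].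
      have := ler_norm (- coord i P); rewrite normrN => ?.
      by apply/andP; split; lra.
    by apply: le_lt_trans me; rewrite lerD2r /m le_max lexx.
  have bP : coord_box i e P `<=` disc 0 rho.
    move=> x [h1 h2]; apply: cO; move: h1 h2; rewrite !ler_norml => /andP[? ?] /andP[? ?].
    by split; apply/andP; split; lra.
  have bQ : coord_box i e Q `<=` disc 0 rho.
    move=> x [h1 h2]; apply: cO; move: h1 h2; rewrite -PQ !ler_norml => /andP[? ?] /andP[? ?].
    by split; apply/andP; split; lra.
  have H0 x : ~ disc 0 rho x -> hat i e P Q x = 0.
    by move=> nx; apply: hat_out => // /cO.
  have th : test_function (disc 0 rho) (hat i e P Q).
    split; first exact: smooth_hat.
    exists (corridor i e P Q); split => //; first exact: compact_corridor.
    by move=> x nx; exact: hat_out.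
  have W : \int[leb2 R]_(x in disc 0 rho) (f x * partial i (hat i e P Q) x) =
     - \int[leb2 R]_(x in disc 0 rho) (coord i (g x) * hat i e P Q x).
    have [w1 w2] := wg _ th.
    by case: (i) w1 w2.
  have iP := integrable_contM fi (smooth_cont (smooth_bump i e P)).
  have iQ := integrable_contM fi (smooth_cont (smooth_bump i e Q)).
  have ch := smooth_cont (smooth_hat i e P Q).
  have ih := integrable_leb2_disc 0 rho ch.
  have igh := integrable_contM gii ch.
  have E1 : \int[leb2 R]_(x in disc 0 rho) (f x * partial i (hat i e P Q) x) =
    \int[leb2 R]_(x in disc 0 rho) (f x * bump i e P x) -
    \int[leb2 R]_(x in disc 0 rho) (f x * bump i e Q x).
    rewrite -RintegralB //; apply: eq_Rintegral => x _.
    by rewrite partial_hat // mulrBr.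
  have B1 : `|\int[leb2 R]_(x in disc 0 rho) (coord i (g x) * hat i e P Q x)| <=
      M * (coord i Q - coord i P + 2 * e).
    apply: (le_trans (le_normr_Rintegral mD igh)).
    apply: (@le_trans _ _ (\int[leb2 R]_(x in disc 0 rho) (M * hat i e P Q x))).
      have mh : measurable_fun (disc 0 rho : set (plane R)) (hat i e P Q).
        by apply: measurable_funTS; exact: continuous_measurable2.
      have fin1 : (\int[leb2 R]_(x in disc 0%R rho) (M * hat i e P Q x)%:E < +oo)%E.
        have /integrableP[_] := integrableZl mD M ih.
        apply: le_lt_trans; apply: ge0_le_integral => //.
        - by move=> x _; rewrite lee_fin mulr_ge0 // hat_ge0.
        - by apply/measurable_EFinP; apply: measurable_funM.
        - apply: measurableT_comp => //; apply: measurable_funeM; exact/measurable_EFinP.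
        - move=> x _; change ((M * hat i e P Q x)%:E <= `|M * hat i e P Q x|%:E)%E.
          by rewrite lee_fin ler_norm.
      have le : (\int[leb2 R]_(x in disc 0%R rho) `|coord i (g x) * hat i e P Q x|%:E <=
            \int[leb2 R]_(x in disc 0%R rho) (M * hat i e P Q x)%:E)%E.
        apply: ae_ge0_le_integral => //.
        - apply/measurable_EFinP; apply: measurableT_comp => //.
          by apply: measurable_funM => //; exact: Lgi.1.
        - by move=> x _; rewrite lee_fin mulr_ge0 // hat_ge0.
        - by apply/measurable_EFinP; apply: measurable_funM.
        - apply: leb2_aeS gM => x gx xO; rewrite lee_fin normrM.
          by rewrite (ger0_norm (hat_ge0 _ e0 pq)) ler_wpM2r ?hat_ge0 // gx.
      rewrite /Rintegral fine_le // ge0_fin_numE ?(le_lt_trans le) //.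
      - by apply: integral_ge0 => x _; rewrite lee_fin.
      - by apply: integral_ge0 => x _; rewrite lee_fin mulr_ge0 // hat_ge0.
    by rewrite RintegralZl // ler_wpM2l // integral_hat.
  have mP := mollify_close e0 bP fi dP.
  have mQ := mollify_close e0 bQ fi dQ.
  move: B1 W; rewrite E1 => B1 W.
  set IP := \int[leb2 R]_(x in disc 0 rho) (f x * bump i e P x) in mP W.
  set IQ := \int[leb2 R]_(x in disc 0 rho) (f x * bump i e Q x) in mQ W.
  have B2 : `|IP - IQ| <= M * (coord i Q - coord i P + 2 * e) by rewrite W normrN.
  exact: dist_close B2 mP mQ.
apply/ler_addgt0Pr => d d0.
have d0' : 0 < d / (2 + 2 * M) by rewrite divr_gt0 //; lra.
set d1 := d / (2 + 2 * M) in d0'.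
have nb (S : R * R) : disc 0 rho S -> exists2 e, 0 < e & forall x, coord_box i e S x -> `|f x - f S| <= d1.
  move=> SO; have := cf S; rewrite inE => /(_ SO).
  move=> /cvgrPdist_le/(_ _ d0')/nbhs_ballP[e /= e0 He].
  exists (e / 2); first by rewrite divr_gt0.
  have e2 : e / 2 < e by rewrite ltr_pdivrMr // ltr_pMr // ltr1n.
  move=> x [h1 h2]; rewrite distrC; apply: He.
  by split; rewrite /ball /= distrC; apply: le_lt_trans e2; case: (i) h1 h2.
have [e1 e10 H1] := nb P PO; have [e2 e20 H2] := nb Q QO.
pose e := Num.min (Num.min e1 e2) (Num.min d1 ((rho - m) / 4)).
have e0 : 0 < e.
  by rewrite /e !lt_min e10 e20 d0' /= divr_gt0 // subr_gt0.
have ee1 : e <= e1 by rewrite /e !ge_min lexx.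
have ee2 : e <= e2 by rewrite /e !ge_min lexx orbT.
have ed1 : e <= d1 by rewrite /e !ge_min lexx !orbT.
have em : e <= (rho - m) / 4 by rewrite /e !ge_min lexx !orbT.
have := @key e d1 e0.
have -> : m + 2 * e < rho by lra.
have E : (2 + 2 * M) * d1 = d by rewrite /d1 mulrC divfK // gt_eqF //; lra.
move=> /(_ isT) H; apply: (le_trans (H _ _)).
- by move=> x [h1 h2]; apply: H1; split; lra.
- by move=> x [h1 h2]; apply: H2; split; lra.
have : M * e <= M * d1 by rewrite ler_wpM2l.
lra.
Qed.

(** Two points are joined by two segments parallel to the axes, through a corner
    of the rectangle that they span. *)
Lemma weak_grad_lipschitz (R : realType) (rho M : R) (f : R * R -> R)
    (g : R * R -> R * R) (P Q : R * R) : 0 <= M ->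
  {in disc 0 rho, continuous f} -> sobolev (disc 0 rho) f g ->
  (\forall x \ae leb2 R, disc 0 rho x -> norm2 (g x) <= M) ->
  disc 0 rho P -> disc 0 rho Q ->
  `|f P - f Q| <= 2 * M * norm2 (P - Q).
Proof.
move=> M0 cf sf gM PO QO.
have gi i : \forall x \ae leb2 R, disc 0 rho x -> `|coord i (g x)| <= M.
  by apply: leb2_aeS gM => x H /H; apply: le_trans; exact: coord_norm.
have sym i S T : disc 0 rho S -> disc 0 rho T -> coord (~~ i) S = coord (~~ i) T ->
    `|f S - f T| <= M * `|coord i S - coord i T|.
  move=> SO TO ST; have [le|/ltW le] := leP (coord i S) (coord i T).
    have -> : `|coord i S - coord i T| = coord i T - coord i S.
      by rewrite distrC ger0_norm ?subr_ge0.
    exact: (weak_grad_lipschitz1 M0 cf sf (gi i)).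
  have -> : `|coord i S - coord i T| = coord i S - coord i T.
    by rewrite ger0_norm ?subr_ge0.
  by rewrite distrC; apply: (weak_grad_lipschitz1 M0 cf sf (gi i)).
have step S T U : disc 0 rho S -> disc 0 rho T -> disc 0 rho U ->
    S.2 = T.2 -> T.1 = U.1 -> `|f S - f U| <= M * (`|S.1 - U.1| + `|S.2 - U.2|).
  move=> SO TO UO e1 e2; rewrite -(subrKA (f T)); apply: (le_trans (ler_normD _ _)).
  by rewrite mulrDr lerD //; [rewrite -e2; exact: (sym false)|rewrite e1; exact: (sym true)].
have sum_le : M * (`|P.1 - Q.1| + `|P.2 - Q.2|) <= 2 * M * norm2 (P - Q).
  have := normr1_le_norm2 (P - Q); have := normr2_le_norm2 (P - Q) => /= h1 h2.
  rewrite -mulrA mulrCA ler_wpM2l //; lra.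
apply: le_trans sum_le.
(* Of the two corners of the rectangle with opposite vertices P and Q, the one
   that takes the smaller |first coordinate| lies in the disc. *)
have dE (S : R * R) : disc 0 rho S = (norm2 S < rho) :> Prop by rewrite /disc /= subr0.
have rho0 : 0 <= rho.
  by apply: ltW; move: PO; rewrite dE; exact: le_lt_trans (norm2_ge0 _).
have [H|H] := leP (Q.1 ^+ 2) (P.1 ^+ 2).
  apply: (step P (Q.1, P.2) Q) => //; rewrite dE norm2_lt //=.
  by move: PO; rewrite dE norm2_lt // => ?; lra.
rewrite distrC [`|P.1 - _|]distrC [`|P.2 - _|]distrC.
apply: (step Q (P.1, Q.2) P) => //; rewrite dE norm2_lt //=.
by move: QO; rewrite dE norm2_lt // => ?; lra.
Qed.

(** * The rotation and its orbits *)

Lemma rot_norm (R : realType) N (x : R * R) : norm2 (rot N x) = norm2 x.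
Proof.
rewrite !norm2E; congr Num.sqrt; rewrite /rot /=; set t := 2 * pi / N%:R.
have := cos2Dsin2 t; move: (cos t) (sin t) => c s H.
transitivity ((c ^+ 2 + s ^+ 2) * (x.1 ^+ 2 + x.2 ^+ 2)); first by ring.
by rewrite H mul1r.
Qed.

Lemma rotB (R : realType) N (x y : R * R) : rot N (x - y) = rot N x - rot N y.
Proof. by congr pair => /=; ring. Qed.

(** The angle is kept as a multiple of 2 pi / N, so that the addition formulas
    apply in an induction on j. *)
Lemma rot_iterE (R : realType) N j (x : R * R) : let t := (2 * pi / N%:R) *+ j in
  iter j (rot N) x = (cos t * x.1 - sin t * x.2, sin t * x.1 + cos t * x.2).
Proof.
elim: j => [|j IH] /=; first by rewrite mulr0n cos0 sin0 !mul1r !mul0r subr0 add0r; case: x.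
rewrite IH /rot /=; set t := 2 * pi / N%:R; rewrite [t *+ j.+1]mulrS cosD sinD.
by congr pair; ring.
Qed.

Lemma rot_iterN (R : realType) N (x : R * R) : (0 < N)%N -> iter N (rot N) x = x.
Proof.
move=> N0; rewrite rot_iterE.
have -> : (2 * pi / N%:R) *+ N = pi *+ 2 :> R.
  by rewrite -mulr_natr divfK ?pnatr_eq0 -?lt0n // mulr_natl.
by rewrite cos2pi sin2pi !mul1r !mul0r subr0 add0r; case: x.
Qed.

Lemma rot_iter_norm (R : realType) N j (x : R * R) : norm2 (iter j (rot N) x) = norm2 x.
Proof. by elim: j => //= j IH; rewrite rot_norm. Qed.

Lemma rot_iterB (R : realType) N j (x y : R * R) :
  iter j (rot N) (x - y) = iter j (rot N) x - iter j (rot N) y.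
Proof. by elim: j => //= j ->; rewrite rotB. Qed.

Lemma rot_iter_dist (R : realType) N j (x y : R * R) :
  norm2 (iter j (rot N) x - iter j (rot N) y) = norm2 (x - y).
Proof. by rewrite -rot_iterB rot_iter_norm. Qed.

(** The chord formula |e^(it) - 1|^2 = 2 - 2 cos t. *)
Lemma norm2_rot_sub (R : realType) N j (x : R * R) :
  norm2 (iter j (rot N) x - x) ^+ 2 =
  (2 - 2 * cos ((2 * pi / N%:R) *+ j)) * norm2 x ^+ 2.
Proof.
rewrite rot_iterE !norm2_sqr /=; set t := _ *+ j.
have := cos2Dsin2 t; move: (cos t) (sin t) => c s H.
transitivity ((c ^+ 2 + s ^+ 2 + 1 - 2 * c) * (x.1 ^+ 2 + x.2 ^+ 2)); first by ring.
by rewrite H; ring.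
Qed.

Lemma cos_lt1 (R : realType) (t : R) : 0 < t < 2 * pi -> cos t < 1.
Proof.
move=> /andP[t0 t2]; have -> : t = t / 2 + t / 2 by lra.
rewrite cosD -!expr2 cos2sin2.
have : 0 < sin (t / 2) by apply: sin_gt0_pi; apply/andP; split; lra.
move=> s0; have := exprn_gt0 2 s0; lra.
Qed.

Lemma rot_cos_lt1 (R : realType) N j : (0 < j < N)%N ->
  cos ((2 * pi / N%:R) *+ j) < 1 :> R.
Proof.
move=> /andP[j0 jN]; apply: cos_lt1; have N0 : 0 < N%:R :> R by rewrite ltr0n (leq_trans _ jN).
have p0 : 0 < pi :> R := pi_gt0 R.
have j0' : 0 < j%:R :> R by rewrite ltr0n.
rewrite -mulr_natr mulr_gt0 ?divr_gt0 ?mulr_gt0 //=.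
rewrite mulrAC -mulrA -[ltRHS]mulr1 ltr_pM2l; last by lra.
by rewrite ltr_pdivrMr // mul1r ltr_nat.
Qed.

(** Only finitely many chords occur; their minimum kap is positive since no angle
    2 pi j / N with 0 < j < N is a multiple of 2 pi. By homogeneity the
    points of the orbit of x are kap |x| apart. *)
Lemma rot_separation (R : realType) N : exists2 kap : R, 0 < kap &
  forall (x : R * R) j k, (j < N)%N -> (k < N)%N -> j <> k ->
    kap * norm2 x <= norm2 (iter j (rot N) x - iter k (rot N) x).
Proof.
have [kap k0 Hk] : exists2 kap : R, 0 < kap & forall j, (0 < j < N)%N ->
    kap ^+ 2 <= 2 - 2 * cos ((2 * pi / N%:R) *+ j).
  have [k k0 Hk] : exists2 k : R, 0 < k & forall j, (0 < j < N)%N ->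
    k <= 2 - 2 * cos ((2 * pi / N%:R) *+ j).
    suff : forall n, (n <= N)%N -> exists2 k : R, 0 < k & forall j, (0 < j < n)%N ->
      k <= 2 - 2 * cos ((2 * pi / N%:R) *+ j) by exact.
    elim=> [|n IH] nN; first by exists 1 => // j; rewrite ltn0 andbF.
    have [k k0 Hk] := IH (ltnW nN).
    have [n0|n0] := posnP n.
      by exists 1 => // j; rewrite n0 ltnS => /andP[]; case: j.
    exists (Num.min k (2 - 2 * cos ((2 * pi / N%:R) *+ n))).
      have := @rot_cos_lt1 R N n; rewrite n0 nN => /(_ isT) ?.
      by rewrite lt_min k0 /=; lra.
    move=> j /andP[j0]; rewrite ltnS leq_eqVlt => /orP[/eqP ->|jn].
      by rewrite ge_min lexx orbT.
    by rewrite ge_min Hk // j0.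
  by exists (Num.sqrt k); rewrite ?sqrtr_gt0 // => j /Hk; rewrite sqr_sqrtr // ltW.
exists kap => // x j k.
wlog kj : j k / (k < j)%N.
  move=> H jN kN /eqP; rewrite neq_ltn => /orP[jk|kj].
    by rewrite norm2C; apply: H => //; apply/eqP; rewrite neq_ltn jk orbT.
  by apply: H => //; apply/eqP; rewrite neq_ltn kj orbT.
move=> jN _ _.
rewrite -(subnKC (ltnW kj)) iterD rot_iter_dist.
rewrite -ler_sqr ?nnegrE ?norm2_ge0 ?mulr_ge0 ?norm2_ge0 ?(ltW k0) //.
rewrite norm2_rot_sub exprMn ler_wpM2r ?sqr_ge0 // Hk // subn_gt0 kj /=.
by rewrite (leq_ltn_trans _ jN) // leq_subr.
Qed.

(** * Cutoff functions of discs *)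

(** The square of the distance is used since it is smooth at the center; the
    argument is 1 at distance r and 0 at distance r + 1. *)
Definition cutoff (R : realType) (r : R) (y x : R * R) : R :=
  smoothstep (((r + 1) ^+ 2 - norm2 (x - y) ^+ 2) / (2 * r + 1)).

Lemma cutoff_argE (R : realType) (r : R) (y : R * R) :
  (fun x => ((r + 1) ^+ 2 - norm2 (x - y) ^+ 2) / (2 * r + 1)) =
  (fun x => ((r + 1) ^+ 2 - ((coord false x - coord false y) * (coord false x - coord false y)
     + (coord true x - coord true y) * (coord true x - coord true y))) * (2 * r + 1)^-1).
Proof. by apply/funext => x; rewrite (norm2_coord false) !coordB !expr2. Qed.

Lemma smooth_coord_shift (R : realType) j (c : R) : smooth (fun x => coord j x - c).
Proof. by apply: smoothB; [exact: coord_smooth|exact: smooth_cst]. Qed.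

Lemma smooth_cutoff_arg (R : realType) (r : R) (y : R * R) :
  smooth (fun x => ((r + 1) ^+ 2 - norm2 (x - y) ^+ 2) / (2 * r + 1)).
Proof.
rewrite cutoff_argE; apply: smoothM; last exact: smooth_cst.
apply: smoothB; first exact: smooth_cst.
by apply: smoothD; apply: smoothM; exact: smooth_coord_shift.
Qed.

Lemma smooth_cutoff (R : realType) (r : R) (y : R * R) : smooth (cutoff r y).
Proof. exact: smooth_smoothstep_comp (smooth_cutoff_arg r y). Qed.

Lemma is_derive_coord_shift (R : realType) i j (c : R) x :
  is_derive x (axis R i) (fun x => coord j x - c) (i == j)%:R.
Proof.
apply: (is_derive_eq (is_deriveB (is_derive_coord i j x) (is_derive_cst _ _ _))).
by rewrite subr0.
Qed.

Lemma partial_cutoff (R : realType) (r : R) (y x : R * R) i :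
  partial i (cutoff r y) x =
  - 2 * dsmoothstep (((r + 1) ^+ 2 - norm2 (x - y) ^+ 2) / (2 * r + 1)) /
   (2 * r + 1) * (coord i x - coord i y).
Proof.
rewrite partial_smoothstep_comp; last exact: smooth_cutoff_arg.
rewrite cutoff_argE /=.
set d := dsmoothstep _.
have ds j := is_derive_coord_shift i j (coord j y) x.
have dq j := is_deriveM (ds j) (ds j).
have D := is_deriveM (is_deriveB (is_derive_cst ((r + 1) ^+ 2) x (axis R i)) (is_deriveD (dq false) (dq true)))
  (is_derive_cst ((2 * r + 1)^-1) x (axis R i)).
rewrite /partial (@derive_val _ _ _ _ _ _ _ D) /GRing.scale /=.
by case: i {ds dq D} => /=; ring.
Qed.

Lemma cutoff_ge0 (R : realType) (r : R) (y x : R * R) : 0 <= cutoff r y x.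
Proof. exact: smoothstep_ge0. Qed.

Lemma cutoff_le1 (R : realType) (r : R) (y x : R * R) : cutoff r y x <= 1.
Proof. exact: smoothstep_le1. Qed.

Lemma cutoff_arg_ge1 (R : realType) (r : R) (y x : R * R) : 0 <= r -> norm2 (x - y) <= r ->
  1 <= ((r + 1) ^+ 2 - norm2 (x - y) ^+ 2) / (2 * r + 1).
Proof.
move=> r0 xr; rewrite ler_pdivlMr; last by lra.
have := norm2_ge0 (x - y); rewrite !expr2; nra.
Qed.

Lemma cutoff_arg_le0 (R : realType) (r : R) (y x : R * R) : 0 <= r -> r + 1 <= norm2 (x - y) ->
  ((r + 1) ^+ 2 - norm2 (x - y) ^+ 2) / (2 * r + 1) <= 0.
Proof.
move=> r0 xr; rewrite ler_pdivrMr ?mul0r; last by lra.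
rewrite !expr2; nra.
Qed.

Lemma cutoff_in (R : realType) (r : R) (y x : R * R) : 0 <= r -> norm2 (x - y) <= r ->
  cutoff r y x = 1.
Proof. by move=> r0 xr; apply: smoothstep1; exact: cutoff_arg_ge1. Qed.

Lemma cutoff_out (R : realType) (r : R) (y x : R * R) : 0 <= r -> r + 1 <= norm2 (x - y) ->
  cutoff r y x = 0.
Proof. by move=> r0 xr; apply: smoothstep0; exact: cutoff_arg_le0. Qed.

Lemma partial_cutoff0 (R : realType) (r : R) (y x : R * R) i : 0 <= r ->
  (norm2 (x - y) <= r) || (r + 1 <= norm2 (x - y)) -> partial i (cutoff r y) x = 0.
Proof.
move=> r0 H; rewrite partial_cutoff dsmoothstep_out ?(mulr0, mul0r) // negb_and -!leNgt.
by case/orP: H => H; [rewrite cutoff_arg_ge1 // orbT|rewrite cutoff_arg_le0].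
Qed.

(** The gradient is at most 2 B |x - y| / (2 r + 1), with B a bound of the
    derivative of the step, and |x - y| <= r + 1 <= 2 r + 1 where it does not
    vanish. The bound is uniform in r because all rings have width 1. *)
Lemma grad_cutoff_bounded (R : realType) : exists2 G : R, 0 <= G &
  forall (r : R) (y x : R * R), 0 <= r -> norm2 (grad (cutoff r y) x) <= G.
Proof.
have [B B0 HB] := dsmoothstep_bounded R.
exists (4 * B); first by lra.
move=> r y x r0.
have [H|H] := boolP ((norm2 (x - y) <= r) || (r + 1 <= norm2 (x - y))).
  rewrite /grad !partial_cutoff0 // (_ : (0, 0) = 0 :> R * R) // norm2_0; lra.
move: H; rewrite negb_or -!ltNge => /andP[_ H].
set d := dsmoothstep (((r + 1) ^+ 2 - norm2 (x - y) ^+ 2) / (2 * r + 1)).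
have -> : grad (cutoff r y) x = (- 2 * d / (2 * r + 1)) *: (x - y).
  by rewrite /grad !partial_cutoff.
have p : 0 < 2 * r + 1 by lra.
have d0 : 0 <= d by exact: dsmoothstep_ge0.
rewrite norm2Z normrM normfV (gtr0_norm p) normrM (ger0_norm d0) normrN ger0_norm //.
rewrite mulrAC ler_pdivrMr //.
have dB : d <= B by exact: HB.
have := norm2_ge0 (x - y); nra.
Qed.

(** * The equivariant competitor *)

Lemma partial_sum (R : realType) n (c : 'I_n -> R) (f : 'I_n -> R * R -> R) i x :
  (forall j, smooth (f j)) ->
  partial i (fun x => \sum_(j < n) c j * f j x) x = \sum_(j < n) c j * partial i (f j) x.
Proof.
move=> sf; apply: derive_val.
have -> : (fun x => \sum_(j < n) c j * f j x) = \sum_(j < n) (fun x => c j * f j x).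
  by apply/funext => y; rewrite fct_sumE.
apply: is_derive_sum => j.
exact: (is_deriveZ (c j) (smooth_is_derive i x (sf j))).
Qed.

(** The competitor u + sum_j z_j (a_j - u) is [map_part] * u + [well_part]. The
    factor 1 gives both coefficients the form sum_j c_j z_j, which
    [partial_sum] differentiates. *)
Definition map_part (R : realType) N (r : R) (x0 x : R * R) : R :=
  1 - \sum_(j < N) 1 * cutoff r (iter j (rot N) x0) x.

Definition well_part (R : realType) N (r : R) (x0 a : R * R) k (x : R * R) : R :=
  \sum_(j < N) coord k (iter j (rot N) a) * cutoff r (iter j (rot N) x0) x.

Definition competitor (R : realType) N (r : R) (x0 a : R * R) (u : R * R -> R * R)
    (x : R * R) : R * R :=
  (map_part N r x0 x * (u x).1 + well_part N r x0 a false x,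
   map_part N r x0 x * (u x).2 + well_part N r x0 a true x).

Definition competitor_row (R : realType) N (r : R) (x0 a : R * R) k
    (f : R * R -> R) (g : R * R -> R * R) (x : R * R) : R * R :=
  (map_part N r x0 x * (g x).1 + f x * partial false (map_part N r x0) x
     + partial false (well_part N r x0 a k) x,
   map_part N r x0 x * (g x).2 + f x * partial true (map_part N r x0) x
     + partial true (well_part N r x0 a k) x).

(** The rows are literally the gradients produced by [sobolev_affine]. *)
Definition competitor_grad (R : realType) N (r : R) (x0 a : R * R)
    (u : R * R -> R * R) (Du : R * R -> (R * R) * (R * R)) (x : R * R) :=
  (competitor_row N r x0 a false (fun x => (u x).1) (fun x => (Du x).1) x,
   competitor_row N r x0 a true (fun x => (u x).2) (fun x => (Du x).2) x).

Lemma smooth_well_part (R : realType) N (r : R) (x0 a : R * R) k : smooth (well_part N r x0 a k).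
Proof. by apply: smooth_sum => j; apply: smoothZ; exact: smooth_cutoff. Qed.

Lemma smooth_map_part (R : realType) N (r : R) (x0 : R * R) : smooth (map_part N r x0).
Proof. by apply: smooth_1B; apply: smooth_sum => j; apply: smoothZ; exact: smooth_cutoff. Qed.

Lemma partial_map_part (R : realType) N (r : R) (x0 : R * R) i x :
  partial i (map_part N r x0) x = - \sum_(j < N) 1 * partial i (cutoff r (iter j (rot N) x0)) x.
Proof.
have sS : smooth (fun x => \sum_(j < N) 1 * cutoff r (iter j (rot N) x0) x).
  by apply: smooth_sum => j; apply: smoothZ; exact: smooth_cutoff.
rewrite -(partial_sum (fun=> 1)); last by move=> j; exact: smooth_cutoff.
apply: derive_val.
apply: (is_derive_eq (is_deriveB (is_derive_cst (1 : R) x (axis R i)) (smooth_is_derive i x sS))).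
by rewrite sub0r.
Qed.

Lemma sum_cyclic (V : nmodType) N (F : nat -> V) : F N = F 0%N ->
  \sum_(j < N) F j = \sum_(j < N) F j.+1.
Proof.
case: N => [|n] FN; first by rewrite !big_ord0.
by rewrite big_ord_recl big_ord_recr /= FN addrC.
Qed.

Lemma cutoff_rot (R : realType) N (r : R) (y x : R * R) :
  cutoff r (rot N y) (rot N x) = cutoff r y x.
Proof. by rewrite /cutoff -rotB rot_norm. Qed.

Lemma map_part_rot (R : realType) N (r : R) (x0 x : R * R) : (0 < N)%N ->
  map_part N r x0 (rot N x) = map_part N r x0 x.
Proof.
move=> N0; rewrite /map_part; congr (1 - _).
rewrite (sum_cyclic (F := fun j => 1 * cutoff r (iter j (rot N) x0) (rot N x))).
  by apply: eq_bigr => j _; rewrite /= cutoff_rot.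
by rewrite rot_iterN.
Qed.

Lemma well_part_rot (R : realType) N (r : R) (x0 a x : R * R) k : (0 < N)%N ->
  well_part N r x0 a k (rot N x) =
  coord k (rot N (well_part N r x0 a false x, well_part N r x0 a true x)).
Proof.
move=> N0; rewrite /well_part.
rewrite (sum_cyclic (F := fun j => coord k (iter j (rot N) a) * cutoff r (iter j (rot N) x0) (rot N x))); last by rewrite !rot_iterN.
under eq_bigr do rewrite /= cutoff_rot.
case: k; rewrite /rot /= !mulr_sumr -?sumrB -?big_split /=;
  by apply: eq_bigr => j _; ring.
Qed.

(** The rotation permutes the cutoffs cyclically along with the wells. *)
Lemma competitor_rot (R : realType) N (r : R) (x0 a x : R * R) (u : R * R -> R * R) :
  (0 < N)%N -> u (rot N x) = rot N (u x) ->
  competitor N r x0 a u (rot N x) = rot N (competitor N r x0 a u x).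
Proof.
move=> N0 ux; rewrite /competitor ux map_part_rot // !well_part_rot //.
by rewrite /rot /=; congr pair; ring.
Qed.

Lemma admissible_competitor (R : realType) N (rho r : R) (x0 a : R * R)
    (u : R * R -> R * R) (Du : R * R -> (R * R) * (R * R)) : (0 < N)%N ->
  admissible N rho u Du ->
  admissible N rho (competitor N r x0 a u) (competitor_grad N r x0 a u Du).
Proof.
move=> N0 [eq s1 s2]; split.
- by move=> x xO; apply: competitor_rot => //; exact: eq.
- exact: (sobolev_affine (smooth_map_part N r x0) (smooth_well_part N r x0 a false) s1).
- exact: (sobolev_affine (smooth_map_part N r x0) (smooth_well_part N r x0 a true) s2).
Qed.

Lemma competitor_off (R : realType) N (r : R) (x0 a x : R * R)
    (u : R * R -> R * R) (Du : R * R -> (R * R) * (R * R)) : 0 <= r ->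
  (forall j, (j < N)%N -> r + 1 <= norm2 (x - iter j (rot N) x0)) ->
  competitor N r x0 a u x = u x /\ competitor_grad N r x0 a u Du x = Du x.
Proof.
move=> r0 H.
have k1 : map_part N r x0 x = 1.
  by rewrite /map_part big1 ?subr0 // => j _; rewrite cutoff_out ?mulr0 // H.
have s0 k : well_part N r x0 a k x = 0.
  by rewrite /well_part big1 // => j _; rewrite cutoff_out ?mulr0 // H.
have pk i : partial i (map_part N r x0) x = 0.
  rewrite partial_map_part big1 ?oppr0 // => j _.
  by rewrite partial_cutoff0 ?mulr0 // H ?orbT.
have ps i k : partial i (well_part N r x0 a k) x = 0.
  rewrite partial_sum; last by move=> j; exact: smooth_cutoff.
  by rewrite big1 // => j _; rewrite partial_cutoff0 ?mulr0 // H ?orbT.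
rewrite /competitor /competitor_grad /competitor_row k1 !s0 !pk !ps /=.
rewrite !mulr0 !addr0 !mul1r; split; first by case: (u x).
by case: (Du x) => -[? ?] [? ?].
Qed.

(** For disjoint discs only the cutoff z of the j-th one is active, and
    v = a_j + (1 - z) (u - a_j): u is pulled straight towards a_j. *)
Lemma competitor_near (R : realType) N (r : R) (x0 a x : R * R) j
    (u : R * R -> R * R) (Du : R * R -> (R * R) * (R * R)) : 0 <= r -> (j < N)%N ->
  (forall k, (k < N)%N -> k <> j -> r + 1 <= norm2 (x - iter k (rot N) x0)) ->
  let aj := iter j (rot N) a in
  let z := cutoff r (iter j (rot N) x0) in
  competitor N r x0 a u x = aj + (1 - z x) *: (u x - aj) /\
  competitor_grad N r x0 a u Du x =
   ((1 - z x) *: (Du x).1 - ((u x).1 - aj.1) *: grad z x,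
    (1 - z x) *: (Du x).2 - ((u x).2 - aj.2) *: grad z x).
Proof.
move=> r0 jN H aj z; pose jj := Ordinal jN.
have Hk (k : 'I_N) : k != jj -> r + 1 <= norm2 (x - iter k (rot N) x0).
  move=> kj; apply: H => // kj'; move/eqP: kj; apply.
  exact: val_inj.
have k1 : map_part N r x0 x = 1 - z x.
  rewrite /map_part (bigD1 jj) //= big1 ?addr0 ?mul1r // => k kj.
  by rewrite cutoff_out ?mulr0 // Hk.
have s0 k : well_part N r x0 a k x = coord k aj * z x.
  rewrite /well_part (bigD1 jj) //= big1 ?addr0 // => i ij.
  by rewrite cutoff_out ?mulr0 // Hk.
have pk i : partial i (map_part N r x0) x = - partial i z x.
  rewrite partial_map_part (bigD1 jj) //= big1 ?addr0 ?mul1r // => k kj.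
  by rewrite partial_cutoff0 ?mulr0 // Hk ?orbT.
have ps i k : partial i (well_part N r x0 a k) x = coord k aj * partial i z x.
  rewrite partial_sum; last by move=> ?; exact: smooth_cutoff.
  rewrite (bigD1 jj) //= big1 ?addr0 // => l lj.
  by rewrite partial_cutoff0 ?mulr0 // Hk ?orbT.
rewrite /competitor /competitor_grad /competitor_row k1 !s0 !pk !ps /=.
rewrite /grad; clear s0 ps k1 pk Hk H; clearbody aj z.
case: (u x) (Du x) aj (partial false z x) (partial true z x) (z x) =>
  [u1 u2] [[p q] [p' q']] [a1 a2] zf zt zx.
split.
  transitivity (a1 + (1 - zx) * (u1 - a1), a2 + (1 - zx) * (u2 - a2)) => //=.
  by congr pair; ring.
transitivity (((1 - zx) * p - (u1 - a1) * zf, (1 - zx) * q - (u1 - a1) * zt),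
  ((1 - zx) * p' - (u2 - a2) * zf, (1 - zx) * q' - (u2 - a2) * zt)) => //=.
by congr pair; congr pair; ring.
Qed.

(** * The energy of the competitor *)

Definition density (R : realType) (W : R * R -> R) (v : R * R -> R * R)
    (Dv : R * R -> (R * R) * (R * R)) (x : R * R) : R :=
  frob (Dv x) ^+ 2 / 2 + W (v x).

Lemma frob_sqr (R : realType) (A : (R * R) * (R * R)) :
  frob A ^+ 2 = norm2 A.1 ^+ 2 + norm2 A.2 ^+ 2.
Proof.
rewrite /frob sqr_sqrtr; last by rewrite /dot2 -!expr2 !addr_ge0 // sqr_ge0.
by rewrite !norm2_sqr /dot2 !expr2.
Qed.

Lemma frob_ge0 (R : realType) (A : (R * R) * (R * R)) : 0 <= frob A.
Proof. exact: sqrtr_ge0. Qed.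

Lemma norm2_frob1 (R : realType) (A : (R * R) * (R * R)) : norm2 A.1 <= frob A.
Proof. by rewrite -ler_sqr ?nnegrE ?norm2_ge0 ?frob_ge0 // frob_sqr lerDl sqr_ge0. Qed.

Lemma norm2_frob2 (R : realType) (A : (R * R) * (R * R)) : norm2 A.2 <= frob A.
Proof. by rewrite -ler_sqr ?nnegrE ?norm2_ge0 ?frob_ge0 // frob_sqr lerDr sqr_ge0. Qed.

Lemma density_ge0 (R : realType) (W : R * R -> R) v Dv x : (forall z, 0 <= W z) ->
  0 <= density W v Dv x.
Proof. by move=> W0; rewrite addr_ge0 // divr_ge0 // sqr_ge0. Qed.

(** The components are only measurable on D; they are extended by 0, after which
    the result is a composition of total functions. *)
Lemma measurable_comp2 (R : realType) (D : set (plane R)) (W : R * R -> R) (f g : R * R -> R) :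
  measurable D -> continuous W ->
  measurable_fun D (f : plane R -> R) -> measurable_fun D (g : plane R -> R) ->
  measurable_fun D (fun x : plane R => W (f x, g x)).
Proof.
move=> mD cW mf mg.
have mf' : measurable_fun setT (f \_ D : plane R -> R) by apply/(measurable_restrictT _ mD).
have mg' : measurable_fun setT (g \_ D : plane R -> R) by apply/(measurable_restrictT _ mD).
have H : measurable_fun setT (fun x : plane R => W ((f \_ D) x, (g \_ D) x)).
  apply: (measurableT_comp (f := W : plane R -> R)); first exact: continuous_measurable2.
  exact: measurable_fun_pair.
have : measurable_fun D (fun x : plane R => W ((f \_ D) x, (g \_ D) x)) by exact: measurable_funTS.
by apply: eq_measurable_fun => x xD; rewrite !patchE xD.
Qed.

Lemma measurable_density (R : realType) N rho (W : R * R -> R) v Dv :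
  continuous W -> admissible N rho v Dv ->
  measurable_fun (disc 0 rho : set (plane R)) (density W v Dv).
Proof.
move=> cW [_ [L1 L2 L3 _] [L4 L5 L6 _]]; have mD := @disc_measurable R 0 rho.
apply: measurable_funD; last first.
  have -> : (fun x => W (v x)) = (fun x => W ((v x).1, (v x).2)).
    by apply/funext => x; case: (v x).
  by apply: measurable_comp2 => //; [exact: L1.1|exact: L4.1].
have -> : (fun x => frob (Dv x) ^+ 2 / 2) = (fun x =>
  ((Dv x).1.1 ^+ 2 + (Dv x).1.2 ^+ 2 + ((Dv x).2.1 ^+ 2 + (Dv x).2.2 ^+ 2)) * 2^-1).
  by apply/funext => x; rewrite frob_sqr !norm2_sqr.
apply: measurable_funM; last exact: measurable_cst.
apply: measurable_funD; apply: measurable_funD; apply: measurable_funX.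
- exact: L2.1.
- exact: L3.1.
- exact: L5.1.
- exact: L6.1.
Qed.

Lemma rot_invariant_iter (R : realType) N (W : R * R -> R) j z : (forall u, W (rot N u) = W u) ->
  W (iter j (rot N) z) = W z.
Proof. by move=> H; elim: j => //= j IH; rewrite H. Qed.

(** A rotation carries a_j to a and leaves W unchanged. *)
Lemma quadratic_bounds_at (R : realType) N (W : R * R -> R) (a : R * R) (dW cW CW : R) j z :
  (forall u, W (rot N u) = W u) ->
  (forall z d, norm2 (z - a) = d -> d <= dW ->
     cW ^+ 2 * d ^+ 2 / 2 <= W z <= CW ^+ 2 * d ^+ 2 / 2) ->
  (j < N)%N -> norm2 (z - iter j (rot N) a) <= dW ->
  cW ^+ 2 * norm2 (z - iter j (rot N) a) ^+ 2 / 2 <= W z <=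
    CW ^+ 2 * norm2 (z - iter j (rot N) a) ^+ 2 / 2.
Proof.
move=> Wr Q jN zd.
have E : z = iter j (rot N) (iter (N - j) (rot N) z).
  by rewrite -iterD subnKC 1?ltnW // rot_iterN // (leq_ltn_trans _ jN).
have E2 : norm2 (z - iter j (rot N) a) = norm2 (iter (N - j) (rot N) z - a).
  by rewrite {1}E rot_iter_dist.
have := Q (iter (N - j) (rot N) z) _ erefl; rewrite rot_invariant_iter // -E2; exact.
Qed.

(** The gradient of a_j + t (u - a_j), with t = 1 - z and g the gradient of z, is
    t Du minus the tensor product of u - a_j and g. *)
Lemma frob_interp (R : realType) (A : (R * R) * (R * R)) (w g : R * R) (t G : R) :
  0 <= t <= 1 -> norm2 g <= G ->
  frob (t *: A.1 - w.1 *: g, t *: A.2 - w.2 *: g) ^+ 2 <=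
  2 * frob A ^+ 2 + 2 * G ^+ 2 * norm2 w ^+ 2.
Proof.
move=> /andP[t0 t1] gG; have G0 : 0 <= G by apply: le_trans gG; exact: norm2_ge0.
have g2 : norm2 g ^+ 2 <= G ^+ 2 by rewrite ler_sqr ?nnegrE ?norm2_ge0.
rewrite !frob_sqr.
have H (p : R * R) (s : R) : norm2 (t *: p - s *: g) ^+ 2 <= 2 * norm2 p ^+ 2 + 2 * G ^+ 2 * s ^+ 2.
  have h1 : norm2 (t *: p - s *: g) <= norm2 p + `|s| * G.
    apply: (le_trans (norm2_triangle _ _)); rewrite norm2N !norm2Z; apply: lerD.
      by rewrite (ger0_norm t0) ler_piMl ?norm2_ge0.
    by rewrite ler_wpM2l.
  apply: (@le_trans _ _ ((norm2 p + `|s| * G) ^+ 2)).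
    by rewrite ler_sqr ?nnegrE ?norm2_ge0 ?addr_ge0 ?mulr_ge0 ?norm2_ge0.
  have := sqr_ge0 (norm2 p - `|s| * G).
  rewrite -(real_normK (num_real s)) !expr2; nra.
have h1 := H A.1 w.1; have h2 := H A.2 w.2.
rewrite (norm2_sqr w) /=; lra.
Qed.

Lemma norm2_interp (R : realType) (p q : R * R) (t : R) : 0 <= t <= 1 ->
  norm2 (p + t *: (q - p) - p) <= norm2 (q - p).
Proof.
move=> /andP[t0 t1]; rewrite addrAC subrr add0r norm2Z ger0_norm //.
by rewrite ler_piMl ?norm2_ge0.
Qed.

Lemma onem_cutoff_itv01 (R : realType) (r : R) (y x : R * R) : 0 <= 1 - cutoff r y x <= 1.
Proof. by have := cutoff_ge0 r y x; have := cutoff_le1 r y x => ? ?; apply/andP; split; lra. Qed.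

(** The summand 2 is the price of splitting the square in [frob_interp]. The
    fraction pays for the terms in |u - a_j|^2, from the gradient of the cutoff
    and from W, since |u - a_j|^2 <= 2 W(u) / cW^2. *)
Definition C_good (R : realType) (G cW CW : R) : R := 2 + (2 * G ^+ 2 + CW ^+ 2) / cW ^+ 2.

Lemma C_good_ge2 (R : realType) (G cW CW : R) : 2 <= C_good G cW CW.
Proof. by rewrite /C_good lerDl divr_ge0 ?sqr_ge0 // addr_ge0 ?sqr_ge0 // mulr_ge0 ?sqr_ge0. Qed.

(** Close to the well every term of the competitor is controlled by |Du|^2 or by
    |u - a_j|^2, and the latter by W(u). *)
Lemma density_good (R : realType) N (W : R * R -> R) (a : R * R) (dW cW CW G : R) j
   (w aj : R * R) (A : (R * R) * (R * R)) (g : R * R) t :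
  aj = iter j (rot N) a ->
  (forall u, W (rot N u) = W u) ->
  (forall z d, norm2 (z - a) = d -> d <= dW ->
     cW ^+ 2 * d ^+ 2 / 2 <= W z <= CW ^+ 2 * d ^+ 2 / 2) ->
  0 < cW -> (j < N)%N -> norm2 (w - aj) <= dW ->
  0 <= t <= 1 -> norm2 g <= G ->
  frob (t *: A.1 - (w.1 - aj.1) *: g, t *: A.2 - (w.2 - aj.2) *: g) ^+ 2 / 2 +
    W (aj + t *: (w - aj)) <= C_good G cW CW * (frob A ^+ 2 / 2 + W w).
Proof.
move=> ajE Wr Q cW0 jN wd t01 gG.
have q z : norm2 (z - aj) <= dW -> cW ^+ 2 * norm2 (z - aj) ^+ 2 / 2 <= W z <=
    CW ^+ 2 * norm2 (z - aj) ^+ 2 / 2 by rewrite ajE; exact: quadratic_bounds_at.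
have /andP[h1 _] := q _ wd.
have wd' : norm2 (aj + t *: (w - aj) - aj) <= dW.
  by apply: le_trans wd; exact: norm2_interp.
have /andP[_ h2] := q _ wd'.
have h3 := frob_interp A (w - aj) t01 gG.
have h4 : norm2 (aj + t *: (w - aj) - aj) ^+ 2 <= norm2 (w - aj) ^+ 2.
  by rewrite ler_sqr ?nnegrE ?norm2_ge0 // norm2_interp.
have h5 : CW ^+ 2 * norm2 (aj + t *: (w - aj) - aj) ^+ 2 <= CW ^+ 2 * norm2 (w - aj) ^+ 2.
  by rewrite ler_wpM2l ?sqr_ge0.
move: h1 h2 h3 h5; rewrite /C_good /=.
set F := frob _ ^+ 2; set V := W (aj + _); set W' := W w; set d := norm2 (w - aj) ^+ 2.
set F' := frob A ^+ 2; set d' := norm2 _ ^+ 2 => h1 h2 h3 h5.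
have c2 : 0 < cW ^+ 2 by rewrite exprn_gt0.
set K := 2 * G ^+ 2 + CW ^+ 2.
have K0 : 0 <= K by rewrite addr_ge0 ?sqr_ge0 // mulr_ge0 ?sqr_ge0.
have h6 : K * d <= K / cW ^+ 2 * (2 * W').
  rewrite -mulrA ler_wpM2l // mulrC ler_pdivlMr // mulrC; lra.
have F0 : 0 <= F' by exact: sqr_ge0.
have d0 : 0 <= d by exact: sqr_ge0.
have W0 : 0 <= W'.
  by apply: le_trans h1; apply: divr_ge0 => //; apply: mulr_ge0 => //; exact: ltW.
have kf : 0 <= K / cW ^+ 2 * F' by rewrite mulr_ge0 ?divr_ge0 // ltW.
rewrite mulrDl mulrDr [X in _ <= _ + X]mulrDr.
set k := K / cW ^+ 2 in h6 kf *.
have : K * d = 2 * (G ^+ 2 * d) + CW ^+ 2 * d by rewrite /K; ring.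
lra.
Qed.

(** * The energy comparison *)

(** An equivariant competitor changes u around all the points of the orbit of x0
    at once, so energies are taken over the union of the discs. *)
Definition orbit_disc (R : realType) N (x0 : R * R) (s : R) : set (R * R) :=
  \bigcup_(j in [set j | (j < N)%N]) disc (iter j (rot N) x0) s.

Lemma orbit_disc_measurable (R : realType) N (x0 : R * R) (s : R) :
  measurable (orbit_disc N x0 s : set (plane R)).
Proof. by apply: bigcup_measurable => j _; exact: disc_measurable. Qed.

Lemma orbit_discS (R : realType) N (x0 : R * R) (s t : R) : s <= t ->
  orbit_disc N x0 s `<=` orbit_disc N x0 t.
Proof. by move=> st x [j jN xj]; exists j => //; exact: lt_le_trans st. Qed.

Lemma orbit_disc_sub (R : realType) N (x0 : R * R) (s rho : R) :
  disc x0 s `<=` disc 0 rho -> orbit_disc N x0 s `<=` disc 0 rho.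
Proof.
move=> H x [j /= jN xj]; rewrite /disc /= subr0.
have N0 : (0 < N)%N by exact: leq_ltn_trans jN.
have E : iter j (rot N) (iter (N - j) (rot N) x) = x.
  by rewrite -iterD subnKC ?rot_iterN // ltnW.
rewrite -E rot_iter_norm.
have := H (iter (N - j) (rot N) x); rewrite /disc /= subr0; apply.
by rewrite -(rot_iter_dist N j) E.
Qed.

Definition ae_bounded (R : realType) rho M (u : R * R -> R * R)
    (Du : R * R -> (R * R) * (R * R)) : Prop :=
  \forall x \ae leb2 R, disc 0 rho x -> norm2 (u x) <= M /\ frob (Du x) <= M.

Lemma density_integral_le (R : realType) N rho M (Wmax : R) (W : R * R -> R) u Du (S : set (plane R)) :
  continuous W -> (forall z, 0 <= W z) -> (forall z, norm2 z <= M -> W z <= Wmax) ->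
  0 <= Wmax ->
  admissible N rho u Du -> ae_bounded rho M u Du ->
  measurable S -> S `<=` disc 0 rho ->
  (\int[leb2 R]_(x in S) (density W u Du x)%:E <= (M ^+ 2 / 2 + Wmax)%:E * leb2 R S)%E.
Proof.
move=> cW W0 Wm Wm0 adm bd mS SO.
have md := measurable_density cW adm.
rewrite -integral_cst //.
apply: ae_ge0_le_integral => //.
- by move=> x _; rewrite lee_fin density_ge0.
- by apply/measurable_EFinP; exact: (measurable_funS (disc_measurable 0 rho) SO md).
- by move=> x _; rewrite lee_fin addr_ge0 // divr_ge0 // sqr_ge0.
- apply: leb2_aeS bd => x H /SO/H[uM DuM]; rewrite lee_fin.
  apply: lerD; last exact: Wm.
  have := frob_ge0 (Du x) => f0.
  by rewrite ler_pM2r // ler_sqr ?nnegrE // (le_trans f0).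
Qed.

(** A bound of the density of the competitor that uses only the bounds of u and
    of its gradient, for use where u may be far from the wells. *)
Definition C_bad (R : realType) (G M Wmax : R) (a : R * R) : R :=
  M ^+ 2 + G ^+ 2 * (M + norm2 a) ^+ 2 + Wmax.

(** Outside the outer discs the competitor equals u, so its energy there, which is
    finite, cancels. In the inner discs it is constant equal to a well and
    costs nothing. In the rings [density_good] applies off P and [C_bad] on P. *)
Lemma compare_energy (R : realType) N rho M Wmax dW cW CW G r (W : R * R -> R)
    (a x0 : R * R) u Du (P : set (plane R)) :
  (0 < N)%N -> continuous W -> (forall z, 0 <= W z) -> W a = 0 ->
  (forall z, W (rot N z) = W z) ->
  (forall z d, norm2 (z - a) = d -> d <= dW ->
     cW ^+ 2 * d ^+ 2 / 2 <= W z <= CW ^+ 2 * d ^+ 2 / 2) ->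
  0 < cW ->
  (forall z, norm2 z <= M + norm2 a -> W z <= Wmax) -> 0 <= M -> 0 <= Wmax ->
  (forall s y x, 0 <= s -> norm2 (grad (@cutoff R s y) x) <= G) ->
  minimizer N W rho u Du -> ae_bounded rho M u Du ->
  0 <= r -> disc x0 (r + 1) `<=` disc 0 rho ->
  (forall j k, (j < N)%N -> (k < N)%N -> j <> k ->
     2 * (r + 1) <= norm2 (iter j (rot N) x0 - iter k (rot N) x0)) ->
  measurable P ->
  (forall j x, (j < N)%N -> norm2 (x - iter j (rot N) x0) < r + 1 ->
     r <= norm2 (x - iter j (rot N) x0) -> ~ P x ->
     norm2 (u x - iter j (rot N) a) <= dW) ->
  (\int[leb2 R]_(x in orbit_disc N x0 (r + 1)%R) (density W u Du x)%:E <=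
   (C_good G cW CW)%:E * \int[leb2 R]_(x in orbit_disc N x0 (r + 1)%R `\` orbit_disc N x0 r)
       (density W u Du x)%:E +
   (C_bad G M Wmax a)%:E * leb2 R (P `&` (orbit_disc N x0 (r + 1)%R `\` orbit_disc N x0 r)))%E.
Proof.
move=> N0 cW0 W0 Wa Wr Q cW_gt0 Wmaxb M0 Wmax0 HG [cu adm minu] bd r0 dO sep mP good.
have admv := admissible_competitor r x0 a N0 adm.
set v := competitor N r x0 a u in admv.
set Dv := competitor_grad N r x0 a u Du in admv.
have := minu _ _ admv; rewrite /energy => le_uv.
set O := disc 0 rho in le_uv.
set A1 := orbit_disc N x0 (r + 1); set A0 := orbit_disc N x0 r.
have A1O : A1 `<=` O by exact: orbit_disc_sub.
have A01 : A0 `<=` A1 by apply: orbit_discS; lra.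
have mO : measurable (O : set (plane R)) by exact: disc_measurable.
have mA1 : measurable (A1 : set (plane R)) by exact: orbit_disc_measurable.
have mA0 : measurable (A0 : set (plane R)) by exact: orbit_disc_measurable.
pose e x := (density W u Du x)%:E; pose f x := (density W v Dv x)%:E.
have e0 x : (0 <= e x)%E by rewrite lee_fin density_ge0.
have f0 x : (0 <= f x)%E by rewrite lee_fin density_ge0.
have me : measurable_fun (O : set (plane R)) e.
  by apply/measurable_EFinP; exact: measurable_density adm.
have mf : measurable_fun (O : set (plane R)) f.
  by apply/measurable_EFinP; exact: measurable_density admv.
have Wm z : norm2 z <= M -> W z <= Wmax.
  by move=> zM; apply: Wmaxb; apply: (le_trans zM); rewrite lerDl norm2_ge0.
have split1 (h : R * R -> \bar R) : measurable_fun (O : set (plane R)) h ->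
   (forall x, (0 <= h x)%E) ->
   (\int[leb2 R]_(x in O) h x = \int[leb2 R]_(x in A1) h x + \int[leb2 R]_(x in O `\` A1) h x)%E.
  move=> mh h0; rewrite -[in LHS](setDUK A1O) ge0_integral_setU //.
  - exact: measurableD.
  - by rewrite setDUK.
  - by apply/disj_setPS => x [xA [_ nxA]]; case: nxA.
have off x : ~ A1 x -> v x = u x /\ Dv x = Du x.
  move=> nA; apply: competitor_off => // j jN; rewrite leNgt; apply/negP => H.
  by apply: nA; exists j.
have eqoff : (\int[leb2 R]_(x in O `\` A1) f x = \int[leb2 R]_(x in O `\` A1) e x)%E.
  apply: eq_integral => x; rewrite inE => -[_ nA].
  by rewrite /f /e /density; have [-> ->] := off x nA.
have fin_off : (\int[leb2 R]_(x in O `\` A1) e x)%E \is a fin_num.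
  rewrite ge0_fin_numE; last by apply: integral_ge0.
  apply: (le_lt_trans (@density_integral_le R N rho M Wmax W u Du (O `\` A1) _ _ _ _ _ _ _ _)) => //.
    exact: measurableD.
  apply: lte_mul_pinfty => //; first by rewrite lee_fin addr_ge0 // divr_ge0 // sqr_ge0.
  apply: (le_lt_trans _ (leb2_disc_fin 0 rho)); apply: le_measure; rewrite ?inE //.
  exact: measurableD.
have le1 : (\int[leb2 R]_(x in A1) e x <= \int[leb2 R]_(x in A1) f x)%E.
  have : (\int[leb2 R]_(x in O) e x <= \int[leb2 R]_(x in O) f x)%E by exact: le_uv.
  by rewrite (split1 e) // (split1 f) // eqoff leeD2rE.
apply: (le_trans le1).
have near j x : (j < N)%N -> norm2 (x - iter j (rot N) x0) < r + 1 ->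
   forall k, (k < N)%N -> k <> j -> r + 1 <= norm2 (x - iter k (rot N) x0).
  move=> jN xj k kN kj; have h := sep k j kN jN kj.
  have := norm2_tri3 (iter k (rot N) x0) x (iter j (rot N) x0).
  rewrite (norm2C (iter k (rot N) x0) x) => h2; lra.
(* On the inner discs the competitor is constant, equal to a zero of W. *)
have f00 x : A0 x -> f x = 0%E.
  move=> [j /= jN xj]; rewrite /disc /= in xj.
  have xj1 : norm2 (x - iter j (rot N) x0) < r + 1 by lra.
  have [vE DvE] := competitor_near a u Du r0 jN (near j x jN xj1).
  rewrite /f /density /v /Dv vE DvE cutoff_in // ?ltW // subrr !scale0r addr0 !sub0r.
  have -> : grad (cutoff r (iter j (rot N) x0)) x = 0.
    by rewrite /grad !partial_cutoff0 // (ltW xj).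
  rewrite !scaler0 oppr0 rot_invariant_iter // Wa addr0.
  by rewrite frob_sqr /= norm2_0 expr0n /= addr0 mul0r.
have -> : (\int[leb2 R]_(x in A1) f x = \int[leb2 R]_(x in A1 `\` A0) f x)%E.
  rewrite -[in LHS](setDUK A01) ge0_integral_setU //.
  - by rewrite integral0_eq ?add0e // => x xA; exact: f00.
  - exact: measurableD.
  - by rewrite setDUK //; exact: measurable_funS mf.
  - by apply/disj_setPS => x [xA [_ nxA]]; case: nxA.
set T := A1 `\` A0.
have mT : measurable (T : set (plane R)) by exact: measurableD.
have TO : T `<=` O by move=> x [/A1O].
have meT : measurable_fun (T : set (plane R)) e by exact: measurable_funS me.
have mfT : measurable_fun (T : set (plane R)) f by exact: measurable_funS mf.
have C10 : 0 <= C_good G cW CW by apply: le_trans (C_good_ge2 G cW CW).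
have C20 : 0 <= C_bad G M Wmax a.
  by rewrite !addr_ge0 ?sqr_ge0 // mulr_ge0 ?sqr_ge0.
have m1 : measurable_fun (T : set (plane R)) (fun x => (C_good G cW CW)%:E * e x)%E.
  exact: measurable_funeM.
have m2 : measurable_fun (T : set (plane R)) (fun x => (\1_P x)%:E : \bar R).
  by apply/measurable_EFinP; apply: measurable_funTS; exact: measurable_indic.
have m3 : measurable_fun (T : set (plane R)) (fun x => (C_bad G M Wmax a)%:E * (\1_P x)%:E)%E.
  exact: measurable_funeM.
apply: (@le_trans _ _ (\int[leb2 R]_(x in T) ((C_good G cW CW)%:E * e x + (C_bad G M Wmax a)%:E * (\1_P x)%:E))%E).
  apply: ae_ge0_le_integral => //.
  - move=> x _; apply: adde_ge0; apply: mule_ge0; first by rewrite lee_fin.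
    + exact: e0.
    + by rewrite lee_fin.
    + by rewrite lee_fin indicE.
  - exact: emeasurable_funD.
  - apply: leb2_aeS bd => x H xT; have [uM DuM] := H (TO _ xT).
    case: (xT) => -[j /= jN xj] nA0; rewrite /disc /= in xj.
    have xr : r <= norm2 (x - iter j (rot N) x0).
      by rewrite leNgt; apply/negP => h; apply: nA0; exists j.
    have [vE DvE] := competitor_near a u Du r0 jN (near j x jN xj).
    have t01 := onem_cutoff_itv01 r (iter j (rot N) x0) x.
    have gG := HG r (iter j (rot N) x0) x r0.
    have aM : norm2 (u x - iter j (rot N) a) <= M + norm2 a.
      by apply: (le_trans (norm2_triangle _ _)); rewrite norm2N rot_iter_norm lerD2r.
    rewrite /f /e /density /v /Dv vE DvE -!EFinM -EFinD lee_fin.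
    have dens0 := @density_ge0 R W u Du x W0; rewrite /density in dens0.
    have [xP|xP] := pselect (P x); last first.
      rewrite indicE memNset // mulr0 addr0.
      exact: (density_good (Du x) erefl Wr Q cW_gt0 jN (good _ _ jN xj xr xP) t01 gG).
    rewrite indicE mem_set // mulr1.
    apply: ler_wpDl; first by rewrite mulr_ge0.
    have h1 := frob_interp (Du x) (u x - iter j (rot N) a) t01 gG.
    have f1 : frob (Du x) ^+ 2 <= M ^+ 2 by rewrite ler_sqr ?nnegrE ?frob_ge0.
    have f2 : norm2 (u x - iter j (rot N) a) ^+ 2 <= (M + norm2 a) ^+ 2.
      by rewrite ler_sqr ?nnegrE ?norm2_ge0 // addr_ge0 ?norm2_ge0.
    have f3 : G ^+ 2 * norm2 (u x - iter j (rot N) a) ^+ 2 <= G ^+ 2 * (M + norm2 a) ^+ 2.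
      by rewrite ler_wpM2l // sqr_ge0.
    have w1 : W (iter j (rot N) a + (1 - cutoff r (iter j (rot N) x0) x) *: (u x - iter j (rot N) a)) <= Wmax.
      apply: Wmaxb; case/andP: t01 => t0 t1.
      set z := cutoff r (iter j (rot N) x0) x in t0 t1 *.
      have -> : iter j (rot N) a + (1 - z) *: (u x - iter j (rot N) a) =
          (1 - z) *: u x + z *: iter j (rot N) a.
        rewrite scalerBr addrCA; congr (_ + _).
        by rewrite scalerBl scale1r opprB addrC subrK.
      apply: (le_trans (norm2_triangle _ _)); rewrite !norm2Z rot_iter_norm.
      rewrite ger0_norm // (ger0_norm (cutoff_ge0 _ _ _)); apply: lerD.
        by apply: le_trans uM; rewrite ler_piMl ?norm2_ge0.
      by rewrite ler_piMl ?norm2_ge0 // cutoff_le1.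
    move: h1 w1; rewrite /C_bad /=; set F := frob _ ^+ 2; set V := W (_ + _).
    move=> h1 w1; apply: lerD w1; rewrite ler_pdivrMr //; lra.
rewrite ge0_integralD //; first last.
- by move=> x _; apply: mule_ge0; [rewrite lee_fin|rewrite lee_fin indicE].
- by move=> x _; apply: mule_ge0; [rewrite lee_fin|exact: e0].
rewrite ge0_integralZl // ge0_integralZl //.
by rewrite integral_indic.
Qed.

(** * The area of thin shells far from the origin *)

(** A half-open interval of radii, the form in which intervals cover a set in the
    definition of the outer measure. *)
Definition shell (R : realType) (p : R * R) : set (R * R) :=
  [set x | p.1 < norm2 x <= p.2].

Lemma shell_measurable (R : realType) (p : R * R) : measurable (shell p : set (plane R)).
Proof.
have mn : measurable_fun setT (@norm2 R : plane R -> R).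
  by apply: continuous_measurable2; exact: norm2_continuous.
have -> : shell p = setT `&` (@norm2 R) @^-1` `]p.1, p.2].
  by rewrite setTI; apply/seteqP; split=> x; rewrite /shell /= in_itv.
by apply: mn => //; exact: measurable_itv.
Qed.

(** The slices are parallel to the dominant coordinate of the center of the disc.
    For two points (s, t) and (s, t') of the shell, with norms n and n', one has
    |t - t'| |t + t'| = (n - n') (n + n'). Since |c1| >= 3 L, the points t and
    t' are bounded away from 0 with the same sign, and n + n' <= 3 |t + t'|. *)
Lemma slice_diam (R : realType) (s c1 c2 L a b t t' : R) :
  `|s - c2| < L -> `|c2| <= `|c1| -> 3 * L <= `|c1| ->
  `|t - c1| < L -> `|t' - c1| < L ->
  a < norm2 (s, t) <= b -> a < norm2 (s, t') <= b -> `|t - t'| <= 3 * (b - a).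
Proof.
move=> hs hc hL ht ht'.
wlog : t t' ht ht' / norm2 (s, t') <= norm2 (s, t).
  move=> H h1 h2; have [le|/ltW le] := leP (norm2 (s, t')) (norm2 (s, t)); first exact: H.
  by rewrite distrC; apply: H.
set n := norm2 (s, t); set n' := norm2 (s, t') => le /andP[h1 h2] /andP[h3 h4].
have e1 : n ^+ 2 = s ^+ 2 + t ^+ 2 by rewrite norm2_sqr.
have e2 : n' ^+ 2 = s ^+ 2 + t' ^+ 2 by rewrite norm2_sqr.
have n0 : 0 <= n by exact: norm2_ge0.
have n0' : 0 <= n' by exact: norm2_ge0.
have L0 : 0 < L by apply: le_lt_trans hs.
have k1 : n <= `|s| + `|t| by exact: norm2_le_sum.
have k2 : n' <= `|s| + `|t'| by exact: norm2_le_sum.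
have bs : `|s| <= `|c2| + L.
  have := ler_normD (s - c2) c2; rewrite subrK; lra.
have tl x : `|x - c1| < L -> `|c1| - L <= `|x|.
  move=> hx; have := ler_normB x (x - c1); rewrite opprB addrC subrK; lra.
have lt := tl _ ht; have lt' := tl _ ht'.
have sum : `|t + t'| = `|t| + `|t'|.
  move: ht ht'; rewrite !ltr_norml => /andP[? ?] /andP[? ?].
  have [c0|c0] := leP 0 c1.
    have c1E : `|c1| = c1 by rewrite ger0_norm.
    by rewrite !gtr0_norm //; lra.
  have c1E : `|c1| = - c1 by rewrite ltr0_norm.
  by rewrite !ltr0_norm ?opprD //; lra.
(* Both sides are the difference of the squares, as s is common to the points. *)
have key : `|t - t'| * `|t + t'| = (n - n') * (n + n').
  rewrite -normrM.
  have -> : (t - t') * (t + t') = n ^+ 2 - n' ^+ 2 by rewrite e1 e2; ring.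
  by rewrite ger0_norm ?subr_ge0 ?ler_sqr ?nnegrE // subr_sqr.
have n3 : n + n' <= 3 * `|t + t'| by rewrite sum; lra.
have tp : 0 < `|t + t'| by rewrite sum; lra.
rewrite -(ler_pM2r tp) key.
apply: (@le_trans _ _ ((n - n') * (3 * `|t + t'|))); first by rewrite ler_wpM2l // subr_ge0.
rewrite mulrCA -!mulrA ler_pM2l //; rewrite ler_pM2r //; lra.
Qed.

(** A set is contained in an interval centered at any of its points; this bounds
    the slices without any study of their shape. *)
Lemma integral_indic_diam (R : realType) (S : set R) (d : R) :
  0 <= d -> measurable_fun setT (\1_S : R -> R) ->
  (forall t t', S t -> S t' -> `|t - t'| <= d) ->
  (\int[@lebesgue_measure R]_t (\1_S t)%:E <= (2 * d)%:E)%E.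
Proof.
move=> d0 mS H; have [[t0 St0]|nS] := pselect (exists t, S t); last first.
  rewrite integral0_eq ?lee_fin ?mulr_ge0 // => t _.
  by rewrite indicE memNset // => St; apply: nS; exists t.
apply: (@le_trans _ _ (\int[@lebesgue_measure R]_t (\1_(`[t0 - d, t0 + d]%classic : set R) t)%:E)%E).
  apply: ge0_le_integral => //.
  - exact/measurable_EFinP.
  - by apply/measurable_EFinP; apply: measurable_indic; exact: measurable_itv.
  - move=> t _; rewrite lee_fin !indicE; have [St|nSt] := pselect (S t); last first.
      by rewrite memNset.
    rewrite !mem_set // /= in_itv /=.
    by have := H t t0 St St0; rewrite ler_norml => /andP[? ?]; apply/andP; split; lra.
rewrite integral_indic // setIT.
by rewrite [X in (X <= _)%E]lebesgue_measure_centered.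
Qed.

(** The disc is sliced parallel to the axis along which its center is farther
    from the origin; every slice of the shell has diameter at most
    3 (p.2 - p.1) by [slice_diam]. *)
Lemma shell_area (R : realType) (p c : R * R) (L : R) : p.1 <= p.2 -> 0 < L ->
  6 * L <= norm2 c ->
  (leb2 R (shell p `&` disc c L) <= (12 * L * (p.2 - p.1))%:E)%E.
Proof.
move=> p12 L0 cL; set Q := shell p `&` disc c L.
have mQ : measurable (Q : set (plane R)).
  by apply: measurableI; [exact: shell_measurable|exact: disc_measurable].
pose F : plane R -> \bar R := fun x => (\1_Q x)%:E.
have mF : measurable_fun setT F.
  by apply/measurable_EFinP; exact: measurable_indic.
have F0 x : (0 <= F x)%E by rewrite lee_fin indicE.
have E0 : leb2 R Q = (\int[leb2 R]_x F x)%E by rewrite integral_indic // setIT.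
have d0 : 0 <= 3 * (p.2 - p.1) by lra.
have rhs0 (k x : R) : (0 <= (2 * (3 * (p.2 - p.1)))%:E * (\1_(`[k - L, k + L]%classic : set R) x)%:E)%E.
  by apply: mule_ge0; [rewrite lee_fin mulr_ge0|rewrite lee_fin indicE].
(* It is enough to bound every slice by 6 (p.2 - p.1): the slices are nonempty
   only over an interval of length 2 L. *)
have outer (k : R) (g : R -> \bar R) : measurable_fun setT g ->
    (forall x, 0 <= g x)%E ->
    (forall x, g x <= (2 * (3 * (p.2 - p.1)))%:E * (\1_(`[k - L, k + L]%classic : set R) x)%:E)%E ->
    (\int[@lebesgue_measure R]_x g x <= (12 * L * (p.2 - p.1))%:E)%E.
  move=> mg g0 gle.
  have mI : measurable_fun setT (fun x => (\1_(`[k - L, k + L]%classic : set R) x)%:E : \bar R).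
    by apply/measurable_EFinP; apply: measurable_indic; exact: measurable_itv.
  apply: (@le_trans _ _ (\int[@lebesgue_measure R]_x ((2 * (3 * (p.2 - p.1)))%:E * (\1_(`[k - L, k + L]%classic : set R) x)%:E))%E).
    by apply: ge0_le_integral => //; exact: measurable_funeM.
  rewrite ge0_integralZl //; last by rewrite lee_fin mulr_ge0.
  rewrite integral_indic // setIT.
  rewrite [X in (_ * X)%E]lebesgue_measure_centered; last exact: ltW.
  by rewrite -EFinM lee_fin; lra.
have [le|/ltW le] := leP `|c.1| `|c.2|.
- have c2L : 3 * L <= `|c.2| by have := norm2_le_sum c; lra.
  rewrite E0 (_ : (\int[leb2 R]_x F x = \int[@lebesgue_measure R]_x (fubini_F (@lebesgue_measure R) F x))%E); last first.
    exact: fubini_tonelli1.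
  apply: (outer c.1).
  + exact: measurable_fun_fubini_tonelli_F.
  + by move=> x; apply: integral_ge0.
  + move=> x; rewrite /fubini_F /F.
    have [xc|xc] := boolP (`|x - c.1| < L); last first.
      rewrite integral0_eq; first exact: rhs0.
      move=> y _; rewrite indicE memNset // => -[_]; rewrite /disc /= => h.
      by move/negP: xc; apply; apply: le_lt_trans h; exact: (normr1_le_norm2 ((x, y) - c)).
    rewrite indicE mem_set ?mule1; last first.
      by rewrite /= in_itv /=; move: xc; rewrite ltr_norml => /andP[? ?]; apply/andP; split; lra.
    apply: (@integral_indic_diam R [set y | Q (x, y)]) => //.
      by apply/measurable_EFinP; exact: (measurable_fun_pair2 x mF).
    move=> t t' [h1 h2] [h3 h4]; apply: (slice_diam xc le c2L) => //.
      by apply: le_lt_trans h2; exact: (normr2_le_norm2 ((x, t) - c)).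
    by apply: le_lt_trans h4; exact: (normr2_le_norm2 ((x, t') - c)).
- have c1L : 3 * L <= `|c.1| by have := norm2_le_sum c; lra.
  have swap (s t : R) : norm2 (s, t) = norm2 (t, s) by rewrite !norm2E /= addrC.
  rewrite E0 (_ : (\int[leb2 R]_x F x = \int[@lebesgue_measure R]_x (fubini_G (@lebesgue_measure R) F x))%E); last first.
    exact: fubini_tonelli2.
  apply: (outer c.2).
  + exact: measurable_fun_fubini_tonelli_G.
  + by move=> x; apply: integral_ge0.
  + move=> x; rewrite /fubini_G /F.
    have [xc|xc] := boolP (`|x - c.2| < L); last first.
      rewrite integral0_eq; first exact: rhs0.
      move=> y _; rewrite indicE memNset // => -[_]; rewrite /disc /= => h.
      by move/negP: xc; apply; apply: le_lt_trans h; exact: (normr2_le_norm2 ((y, x) - c)).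
    rewrite indicE mem_set ?mule1; last first.
      by rewrite /= in_itv /=; move: xc; rewrite ltr_norml => /andP[? ?]; apply/andP; split; lra.
    apply: (@integral_indic_diam R [set y | Q (y, x)]) => //.
      by apply/measurable_EFinP; exact: (measurable_fun_pair1 x mF).
    move=> t t' [h1 h2] [h3 h4]; apply: (slice_diam xc le c1L).
    * by apply: le_lt_trans h2; exact: (normr1_le_norm2 ((t, x) - c)).
    * by apply: le_lt_trans h4; exact: (normr1_le_norm2 ((t', x) - c)).
    * by rewrite swap.
    * by rewrite swap.
Qed.

(** By definition of the outer measure. This replaces Sigma by a Borel set of
    almost the same length, so that the bad set is a countable union of shells. *)
Lemma interval_cover (R : realType) (S : set R) (K : R) :
  (lebesgue_measure S <= K%:E)%E ->
  exists p : nat -> R * R, [/\ forall n, (p n).1 <= (p n).2,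
    forall s, S s -> exists n, (p n).1 < s <= (p n).2 &
    (\sum_(0 <= n <oo) ((p n).2 - (p n).1)%:E <= (K + 1)%:E)%E].
Proof.
move=> SK; have : (lebesgue_measure S < (K + 1)%:E)%E.
  by apply: (le_lt_trans SK); rewrite lte_fin ltrDl.
move=> /ereal_inf_lt[_ [F [mF SF] <-] Flt].
have [p Hp] : exists p : nat -> R * R, forall n, F n = `](p n).1, (p n).2]%classic.
  have : forall n, exists q : R * R, F n = `]q.1, q.2]%classic.
    by move=> n; have [q _ <-] := mF n; exists q.
  by move=> /choice[p Hp]; exists p.
exists (fun n => ((p n).1, Num.max (p n).1 (p n).2)); split.
- by move=> n; rewrite /= le_max lexx.
- move=> s /SF[n _]; rewrite Hp /= in_itv /= => /andP[h1 h2]; exists n.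
  by rewrite h1 le_max h2 orbT.
- apply: le_trans (ltW Flt); apply: lee_nneseries => n _ /=.
    by rewrite lee_fin subr_ge0 le_max lexx.
  rewrite Hp wlength_itv /= lte_fin; case: ltP => h.
    by rewrite -EFinB.
  by rewrite subrr.
Qed.

Definition bad_set (R : realType) (p : nat -> R * R) : set (R * R) :=
  \bigcup_n shell (p n).

Lemma bad_set_measurable (R : realType) (p : nat -> R * R) :
  measurable (bad_set p : set (plane R)).
Proof. by apply: bigcup_measurable => n _; exact: shell_measurable. Qed.

Lemma bad_set_area (R : realType) (p : nat -> R * R) (c : R * R) (L K : R) :
  (forall n, (p n).1 <= (p n).2) ->
  (\sum_(0 <= n <oo) ((p n).2 - (p n).1)%:E <= K%:E)%E ->
  0 < L -> 6 * L <= norm2 c ->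
  (leb2 R (bad_set p `&` disc c L) <= (12 * L * K)%:E)%E.
Proof.
move=> p12 pK L0 cL.
have mS n : measurable (shell (p n) `&` disc c L : set (plane R)).
  by apply: measurableI; [exact: shell_measurable|exact: disc_measurable].
rewrite /bad_set setI_bigcupl.
apply: (@le_trans _ _ (\sum_(0 <= n <oo) leb2 R (shell (p n) `&` disc c L))%E).
  apply: measure_sigma_subadditive => //.
  by apply: bigcup_measurable => n _; exact: mS.
apply: (@le_trans _ _ (\sum_(0 <= n <oo) ((12 * L)%:E * ((p n).2 - (p n).1)%:E))%E).
  apply: lee_nneseries => [n _ _|n _]; first exact: measure_ge0.
  by rewrite -EFinM; exact: shell_area.
rewrite nneseriesZl; last by move=> n _; rewrite lee_fin subr_ge0.
by rewrite [X in (_ <= X)%E]EFinM lee_wpmul2l // lee_fin mulr_ge0 // ltW.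
Qed.

Lemma bad_set_orbit_area (R : realType) (p : nat -> R * R) N (c : R * R) (L K : R) :
  (forall n, (p n).1 <= (p n).2) ->
  (\sum_(0 <= n <oo) ((p n).2 - (p n).1)%:E <= K%:E)%E ->
  0 < L -> 6 * L <= norm2 c ->
  (leb2 R (bad_set p `&` orbit_disc N c L) <= (N%:R * (12 * L * K))%:E)%E.
Proof.
move=> p12 pK L0 cL.
have mS j : measurable (bad_set p `&` disc (iter j (rot N) c) L : set (plane R)).
  by apply: measurableI; [exact: bad_set_measurable|exact: disc_measurable].
have -> : bad_set p `&` orbit_disc N c L =
   \big[setU/set0]_(j < N) (bad_set p `&` disc (iter j (rot N) c) L).
  by rewrite /orbit_disc setI_bigcupr -(bigcup_mkord N (fun j => bad_set p `&` disc (iter j (rot N) c) L)).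
apply: (@le_trans _ _ (\sum_(j < N) leb2 R (bad_set p `&` disc (iter j (rot N) c) L))%E).
  exact: (@Boole_inequality _ _ _ (leb2 R) (fun j => bad_set p `&` disc (iter j (rot N) c) L)).
apply: (@le_trans _ _ (\sum_(j < N) (12 * L * K)%:E)%E).
  by apply: lee_sum => j _; apply: bad_set_area => //; rewrite rot_iter_norm.
by rewrite sumEFin lee_fin sumr_const card_ord [N%:R * _]mulr_natl.
Qed.

Lemma orbit_disc_area (R : realType) N (c : R * R) (L : R) : 0 <= L ->
  (leb2 R (orbit_disc N c L) <= (N%:R * (2 * L) ^+ 2)%:E)%E.
Proof.
move=> L0.
have -> : orbit_disc N c L = \big[setU/set0]_(j < N) disc (iter j (rot N) c) L.
  by rewrite /orbit_disc -(bigcup_mkord N (fun j => disc (iter j (rot N) c) L)).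
apply: (@le_trans _ _ (\sum_(j < N) leb2 R (disc (iter j (rot N) c) L))%E).
  apply: (@Boole_inequality _ _ _ (leb2 R) (fun j => disc (iter j (rot N) c) L)).
  by move=> j _; exact: disc_measurable.
apply: (@le_trans _ _ (\sum_(j < N) ((2 * L) ^+ 2)%:E)%E).
  by apply: lee_sum => j _; exact: leb2_disc_le.
by rewrite sumEFin lee_fin sumr_const card_ord [N%:R * _]mulr_natl.
Qed.

(** * Boundedness of the energy *)

(** The differences on the right telescope. *)
Lemma sum_energy_le (R : realType) (C1 C2 : R) (e b : nat -> R) n :
  0 <= C1 -> 0 <= C2 -> 0 <= e 0%N -> 0 <= b 0%N ->
  (forall k, (k < n)%N -> e k <= C1 * (e k.+1 - e k) + C2 * (b k.+1 - b k)) ->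
  \sum_(k < n) e k <= C1 * e n + C2 * b n.
Proof.
move=> C10 C20 e0 b0; elim: n => [|n IH] H.
  by rewrite big_ord0 addr_ge0 ?mulr_ge0.
rewrite big_ord_recr /=; have := H n (ltnSn n).
have := IH (fun k kn => H k (ltnW kn)); lra.
Qed.

Lemma sum_tail_ge (R : realType) (e : nat -> R) i n :
  (forall k, 0 <= e k) -> (forall k, (k < i + n)%N -> e k <= e k.+1) ->
  n%:R * e i <= \sum_(k < i + n) e k.
Proof.
move=> e0; elim: n => [_|n IH emono]; first by rewrite mul0r sumr_ge0.
rewrite addnS big_ord_recr /= -natr1 mulrDl mul1r lerD //.
  by apply: IH => k kn; apply: emono; rewrite addnS ltnS ltnW.
elim: n emono {IH} => [|n IH] emono; first by rewrite addn0.
rewrite addnS; apply: (@le_trans _ _ (e (i + n)%N)).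
  by apply: IH => k kn; apply: emono; rewrite addnS ltnS ltnW.
by apply: emono; rewrite !addnS.
Qed.

(** As e is nondecreasing, (2 m) e_{2m} is at most the sum of the e_k up to 4 m,
    which telescopes to C1 e_{4m} + C2 b_{4m}. The quadratic growth of e and
    the linear growth of b make this of order m^2, so e_{2m} is of order m.
    The same step from 2 m to m makes e_m of order 1. *)
Lemma energy_bounded (R : realType) (C1 C2 C3 C4 : R) (e b : nat -> R) m :
  0 <= C1 -> 0 <= C2 -> (0 < m)%N ->
  (forall k, 0 <= e k) -> (forall k, (k < 4 * m)%N -> e k <= e k.+1) ->
  (forall k, 0 <= b k) ->
  (forall k, (k < 4 * m)%N -> e k <= C1 * (e k.+1 - e k) + C2 * (b k.+1 - b k)) ->
  e (4 * m)%N <= C3 * (4 * m)%:R ^+ 2 ->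
  (forall k, (0 < k)%N -> (k <= 4 * m)%N -> b k <= C4 * k%:R) ->
  e m <= 8 * C1 ^+ 2 * C3 + 2 * (C2 * C4) + 2 * (C1 * (C2 * C4)).
Proof.
move=> C10 C20 m0 e0 emono b0 H e4 bk.
have M0 : 0 < m%:R :> R by rewrite ltr0n.
have M1 : 1 <= m%:R :> R by rewrite ler1n.
have s1 := sum_energy_le C10 C20 (e0 0%N) (b0 0%N) H.
have E4 : (2 * m + 2 * m = 4 * m)%N by rewrite -mulnDl.
have t1 : (2 * m)%:R * e (2 * m)%N <= \sum_(k < 4 * m) e k.
  by rewrite -E4; apply: sum_tail_ge; rewrite ?E4.
have b4 : b (4 * m)%N <= C4 * (4 * m)%:R by apply: bk => //; rewrite muln_gt0.
have b2 : b (2 * m)%N <= C4 * (2 * m)%:R.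
  by apply: bk; rewrite ?muln_gt0 // leq_mul2r orbT.
have s2 : \sum_(k < 2 * m) e k <= C1 * e (2 * m)%N + C2 * b (2 * m)%N.
  apply: sum_energy_le => // k km; apply: H; apply: (leq_trans km).
  by rewrite leq_mul2r orbT.
have E2 : (m + m = 2 * m)%N by rewrite mul2n addnn.
have t2 : m%:R * e m <= \sum_(k < 2 * m) e k.
  rewrite -E2; apply: sum_tail_ge => // k km; apply: emono; apply: (leq_trans km).
  by rewrite E2 leq_mul2r orbT.
have h1 : C1 * e (4 * m)%N <= C1 * (C3 * (4 * m)%:R ^+ 2) by rewrite ler_wpM2l.
have h2 : C2 * b (4 * m)%N <= C2 * (C4 * (4 * m)%:R) by rewrite ler_wpM2l.
have h3 : C2 * b (2 * m)%N <= C2 * (C4 * (2 * m)%:R) by rewrite ler_wpM2l.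
rewrite !natrM in s1 t1 h1 h2 h3 t2.
set x := m%:R in M0 M1 t1 t2 h1 h2 h3.
have g1 : e (2 * m)%N <= 8 * C1 * C3 * x + 2 * (C2 * C4).
  have : (2 * x) * e (2 * m)%N <= (2 * x) * (8 * C1 * C3 * x + 2 * (C2 * C4)).
    apply: (le_trans t1); apply: (le_trans s1); apply: (le_trans (lerD h1 h2)).
    by rewrite le_eqVlt; apply/orP; left; apply/eqP; ring.
  by rewrite ler_pM2l //; lra.
have g2 : C1 * e (2 * m)%N <= C1 * (8 * C1 * C3 * x + 2 * (C2 * C4)) by rewrite ler_wpM2l.
rewrite -(ler_pM2l M0) -/x; apply: (le_trans t2); apply: (le_trans s2).
apply: (le_trans (lerD g2 h3)).
have cc : 0 <= C2 * C4.
  have : 0 <= b 1%N by [].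
  have := bk 1%N isT; rewrite muln_gt0 m0 mulr1 => /(_ isT) h h'.
  by rewrite mulr_ge0 // (le_trans h').
have z0 : 0 <= C1 * (C2 * C4) by rewrite mulr_ge0.
have z1 : C1 * (C2 * C4) <= C1 * (C2 * C4) * x by rewrite ler_peMr.
rewrite -subr_ge0.
have -> : x * (8 * C1 ^+ 2 * C3 + 2 * (C2 * C4) + 2 * (C1 * (C2 * C4))) -
  (C1 * (8 * C1 * C3 * x + 2 * (C2 * C4)) + C2 * (C4 * (2 * x))) =
  2 * (C1 * (C2 * C4) * x - C1 * (C2 * C4)) by ring.
lra.
Qed.

(** The increments over p disjoint blocks of length 3 sum up to at most K. *)
Lemma small_increment (R : realType) (e : nat -> R) q p (K : R) :
  (0 < p)%N -> 0 <= e q -> e (q + 3 * p)%N <= K ->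
  exists k, [/\ (q <= k)%N, (k + 3 <= q + 3 * p)%N & e (k + 3)%N - e k <= K / p%:R].
Proof.
move=> p0 e0 eK; apply: contrapT => H.
have P0 : 0 < p%:R :> R by rewrite ltr0n.
have lt i : (i < p)%N -> e (q + 3 * i)%N + K / p%:R < e (q + 3 * i.+1)%N.
  move=> ip; rewrite ltNge; apply/negP => h; apply: H; exists (q + 3 * i)%N; split.
  - exact: leq_addr.
  - by rewrite -addnA leq_add2l -mulnSr leq_mul2l.
  - by rewrite -addnA -mulnSr; lra.
have : forall i, (i <= p)%N -> (0 < i)%N -> e q + i%:R * (K / p%:R) < e (q + 3 * i)%N.
  elim=> // i IH ip _; have [->|i0] := posnP i.
    by have := lt 0%N; rewrite muln0 addn0 mul1r; exact.
  have := IH (ltnW ip) i0; have := lt i ip; rewrite -natr1 mulrDl mul1r; lra.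
move=> /(_ p (leqnn p) p0); rewrite mulrC divfK ?gt_eqF //; lra.
Qed.

(** * Regularity of minimizers and closeness to some well *)

Lemma leb2_setT_gt0 (R : realType) : (0 < leb2 R setT)%E.
Proof.
apply: (@lt_le_trans _ _ (leb2 R (disc (0 : R * R) 1))).
  apply: lt_le_trans (leb2_disc_ge _ _); last exact: ltr01.
  by rewrite lte_fin exprn_gt0.
by apply: le_measure; rewrite ?inE //; exact: disc_measurable.
Qed.

Lemma Linfty_ae (R : realType) (Om : set (R * R)) (f : R * R -> R) (M : R) :
  (forall x, 0 <= f x) -> (Linfty Om f <= M%:E)%E ->
  \forall x \ae leb2 R, Om x -> f x <= M.
Proof.
move=> f0; rewrite /Linfty unlock leb2_setT_gt0 => H.
have := ess_sup_inf.ess_sup_ge (leb2 R) (abse \o (EFin \o (f \_ Om))).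
apply: leb2_aeS => x /le_trans/(_ H) /=.
rewrite lee_fin patchE => h xO; move: h; rewrite mem_set //.
by rewrite ger0_norm.
Qed.

Lemma Linfty_ge0 (R : realType) (Om : set (R * R)) (f : R * R -> R) : (0 <= Linfty Om f)%E.
Proof. exact: Lnorm_ge0. Qed.

Lemma minimizer_ae_bounded (R : realType) N (W : R * R -> R) M rho u Du :
  minimizers_bounded N W M -> 0 < rho -> minimizer N W rho u Du ->
  ae_bounded rho M u Du.
Proof.
move=> hb rho0 mu; have H := hb rho u Du rho0 mu.
have h1 : (Linfty (disc 0%R rho) (fun x => norm2 (u x)) <= M%:E)%E.
  by apply: le_trans H; rewrite leeDl // Linfty_ge0.
have h2 : (Linfty (disc 0%R rho) (fun x => frob (Du x)) <= M%:E)%E.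
  by apply: le_trans H; rewrite leeDr // Linfty_ge0.
have a1 := Linfty_ae (fun x => norm2_ge0 (u x)) h1.
have a2 := Linfty_ae (fun x => frob_ge0 (Du x)) h2.
by apply: leb2_aeS (leb2_aeI a1 a2) => x [H1 H2] xO; split; [exact: H1|exact: H2].
Qed.

Lemma minimizer_lipschitz (R : realType) N (W : R * R -> R) M rho u Du x y :
  0 <= M -> minimizer N W rho u Du -> ae_bounded rho M u Du ->
  disc 0 rho x -> disc 0 rho y ->
  norm2 (u x - u y) <= 4 * M * norm2 (x - y).
Proof.
move=> M0 [cu [_ s1 s2] _] bd xO yO.
have cp (k : R * R -> R) : continuous k -> {in disc 0 rho, continuous (fun x => k (u x))}.
  move=> ck z zO; apply: (@continuous_comp _ _ _ u k); [exact: cu|exact: ck].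
have l1 : `|(u x).1 - (u y).1| <= 2 * M * norm2 (x - y).
  apply: (weak_grad_lipschitz M0 (cp _ (@fst_continuous R)) s1) => //.
  apply: leb2_aeS bd => z H zO; apply: le_trans (norm2_frob1 _) _.
  by have [] := H zO.
have l2 : `|(u x).2 - (u y).2| <= 2 * M * norm2 (x - y).
  apply: (weak_grad_lipschitz M0 (cp _ (@snd_continuous R)) s2) => //.
  apply: leb2_aeS bd => z H zO; apply: le_trans (norm2_frob2 _) _.
  by have [] := H zO.
apply: (le_trans (norm2_le_sum _)) => /=; lra.
Qed.

(** Otherwise, by the Lipschitz bound, u stays at distance delta from all the
    wells on the disc of radius s around x, where W(u) is then at least
    cW^2 delta^2 / 2; s^2 is a lower bound for the area of that disc. *)
Lemma near_some_well (R : realType) N (W : R * R -> R) (a : R * R) M dW cW rho u Du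
    (S : set (plane R)) (delta s : R) x :
  continuous W -> (forall z, 0 <= W z) ->
  (forall z d, 0 < d <= dW -> norm2 z <= M ->
     (forall j, (j < N)%N -> d <= norm2 (z - iter j (rot N) a)) ->
     cW ^+ 2 * d ^+ 2 / 2 <= W z) ->
  0 <= M -> minimizer N W rho u Du -> ae_bounded rho M u Du ->
  0 < delta <= dW -> 0 < s -> 4 * M * s <= delta ->
  measurable S -> S `<=` disc 0 rho -> disc x s `<=` S ->
  (\int[leb2 R]_(x in S) (density W u Du x)%:E < (cW ^+ 2 * delta ^+ 2 / 2 * s ^+ 2)%:E)%E ->
  exists2 j, (j < N)%N & norm2 (u x - iter j (rot N) a) < 2 * delta.
Proof.
move=> cWc W0 Q M0 mini bd ddW s0 Ms mS SO xS small; apply: contrapT => H.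
have [cu adm _] := mini.
have lip y z := @minimizer_lipschitz R N W M rho u Du y z M0 mini bd.
have far j : (j < N)%N -> 2 * delta <= norm2 (u x - iter j (rot N) a).
  by move=> jN; rewrite leNgt; apply/negP => h; apply: H; exists j.
have xx : disc x s x by rewrite /disc /= subrr norm2_0.
have md := measurable_density cWc adm.
have mdx := disc_measurable x s.
have md0 := @disc_measurable R 0 rho.
have meS (T : set (plane R)) : measurable T -> T `<=` disc 0 rho -> measurable_fun T (fun x => (density W u Du x)%:E).
  by move=> mT TO; apply/measurable_EFinP; exact: (measurable_funS md0 TO md).
have low : ((cW ^+ 2 * delta ^+ 2 / 2)%:E * leb2 R (disc x s) <=
    \int[leb2 R]_(y in disc x s) (density W u Du y)%:E)%E.
  rewrite -integral_cst //; apply: ae_ge0_le_integral => //.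
  - by move=> y _; rewrite lee_fin divr_ge0 // mulr_ge0 // sqr_ge0.
  - by move=> y _; rewrite lee_fin density_ge0.
  - by apply: meS => // y /xS/SO.
  - apply: leb2_aeS bd => y Hy xy; have yO := SO _ (xS _ xy).
    have [uM _] := Hy yO; rewrite lee_fin /density.
    apply: (@le_trans _ _ (W (u y))); last by rewrite lerDr divr_ge0 // sqr_ge0.
    apply: Q => // j jN; have := far j jN.
    have := norm2_tri3 (u x) (u y) (iter j (rot N) a).
    have := lip x y (SO _ (xS _ xx)) yO.
    have : 4 * M * norm2 (x - y) <= 4 * M * s.
      by rewrite ler_wpM2l ?mulr_ge0 // norm2C ltW.
    lra.
have : (\int[leb2 R]_(y in disc x s) (density W u Du y)%:E <=
    \int[leb2 R]_(y in S) (density W u Du y)%:E)%E.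
  apply: ge0_subset_integral => //; first exact: meS.
  by move=> y _; rewrite lee_fin density_ge0.
move=> /(le_trans low) h; have := le_lt_trans h small.
rewrite ltNge => /negP; apply; rewrite EFinM.
apply: lee_wpmul2l; first by rewrite lee_fin divr_ge0 // mulr_ge0 // sqr_ge0.
exact: leb2_disc_ge.
Qed.

(** Let f be |u - a| along the path. A value of f not exceeding max(kap, 2 delta)
    excludes every well but a, so that it is less than 2 delta. Hence f cannot
    take the value 2 delta, while it is below it at the end point. *)
Lemma path_same_well (R : realType) N (a : R * R) (u : R * R -> R * R) rho (y : R -> R * R)
    (delta kap d0 : R) :
  {in disc 0 rho, continuous u} -> continuous y ->
  (forall t, 0 <= t <= 1 -> disc 0 rho (y t)) ->
  (forall t, 0 <= t <= 1 -> exists2 j, (j < N)%N & norm2 (u (y t) - iter j (rot N) a) < 2 * delta) ->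
  (forall j, (0 < j < N)%N -> d0 <= norm2 (iter j (rot N) a - a)) ->
  2 * delta + kap < d0 -> 4 * delta < d0 ->
  norm2 (u (y 1) - a) <= kap ->
  norm2 (u (y 0) - a) < 2 * delta.
Proof.
move=> cu cy yO near sep k1 k2 h1.
have dich t k : 0 <= t <= 1 -> norm2 (u (y t) - a) <= k -> 2 * delta + k < d0 ->
    norm2 (u (y t) - a) < 2 * delta.
  move=> t01 tk kd; have [[|j] jN jd] := near t t01; first exact: jd.
  have := sep j.+1 jN; have := norm2_tri3 (iter j.+1 (rot N) a) (u (y t)) a.
  rewrite (norm2C (iter j.+1 (rot N) a) (u (y t))); lra.
have i0 : (0 : R) <= (0 : R) <= (1 : R) by rewrite lexx ler01.
have i1 : (0 : R) <= (1 : R) <= (1 : R) by rewrite lexx ler01.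
rewrite ltNge; apply/negP => h0.
have f1 := dich 1 kap i1 h1 k1.
pose f t := norm2 (u (y t) - a).
have cf : {within `[0, 1], continuous f}.
  apply: continuous_in_subspaceT => t; rewrite inE /= in_itv /= => t01.
  apply: (@continuous_comp _ _ _ (fun t => u (y t) - a) (@norm2 R)); last exact: norm2_continuous.
  apply: (@continuousB _ _ _ (fun t => u (y t)) (cst a)); last exact: cst_continuous.
  apply: (@continuous_comp _ _ _ y u); first exact: cy.
  by apply: cu; rewrite inE; exact: yO.
have [|c c01 fc] := IVT ler01 cf (v := 2 * delta).
  by rewrite ge_min le_max (ltW f1) h0 orbT.
have : norm2 (u (y c) - a) < 2 * delta.
  move: c01; rewrite in_itv /= => c01.
  by apply: (dich c (2 * delta) c01); [rewrite -/(f c) fc|lra].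
by rewrite -/(f c) fc ltxx.
Qed.

(** * Points avoiding a set of radii of small measure *)

Definition udir (R : realType) (t : R) : R * R := (cos t, sin t).

Lemma norm2_udir (R : realType) (t : R) : norm2 (udir t) = 1.
Proof. by rewrite norm2E /= cos2Dsin2 sqrtr1. Qed.

Lemma udir_continuous (R : realType) : continuous (@udir R).
Proof. by apply: pair_continuous; [exact: continuous_cos|exact: continuous_sin]. Qed.

Lemma continuous_scale_pair (R : realType) (k : R -> R) (h : R -> R * R) :
  continuous k -> continuous h -> continuous (fun t => k t *: h t).
Proof.
move=> ck ch.
have -> : (fun t => k t *: h t) = (fun t => (k t * (h t).1, k t * (h t).2)) by [].
apply: pair_continuous => t.
- apply: (@continuousM _ _ k (fst \o h)); first exact: ck.
  by apply: continuous_comp; [exact: ch|exact: fst_continuous].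
- apply: (@continuousM _ _ k (snd \o h)); first exact: ck.
  by apply: continuous_comp; [exact: ch|exact: snd_continuous].
Qed.

Lemma continuous_add_cst (R : realType) (x0 : R * R) (h : R -> R * R) :
  continuous h -> continuous (fun t => x0 + h t).
Proof.
move=> ch t; apply: (@continuousD _ _ _ (cst x0) h); first exact: cst_continuous.
exact: ch.
Qed.

Lemma polar (R : realType) (z : R * R) : exists t, z = norm2 z *: udir t.
Proof.
have [->|z0] := eqVneq z 0; first by exists 0; rewrite norm2_0 scale0r.
have n0 : 0 < norm2 z by rewrite lt_neqAle norm2_ge0 eq_sym norm2_eq0 z0.
set x := z.1 / norm2 z.
have x1 : -1 <= x <= 1.
  have := normr1_le_norm2 z; rewrite ler_norml => /andP[h1 h2].
  by rewrite /x ler_pdivlMr // ler_pdivrMr // mulN1r mul1r h1.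
have c : cos (acos x) = x by rewrite acosK // in_itv.
have s : sin (acos x) = `|z.2| / norm2 z.
  rewrite sin_acos // /x expr_div_n.
  have -> : 1 - z.1 ^+ 2 / norm2 z ^+ 2 = (z.2 / norm2 z) ^+ 2.
    rewrite expr_div_n.
    have n2 : norm2 z ^+ 2 != 0 by rewrite sqrf_eq0 gt_eqF.
    apply: (mulIf n2); rewrite mulrBl !divfK // mul1r norm2_sqr; ring.
  by rewrite sqrtr_sqr normrM normfV (ger0_norm (norm2_ge0 z)).
have sc (p q : R) : z.1 = norm2 z * p -> z.2 = norm2 z * q -> z = norm2 z *: (p, q).
  by move=> h1 h2; rewrite [LHS]surjective_pairing {1}h1 {1}h2.
have [z2|z2] := leP 0 z.2.
- exists (acos x); rewrite /udir c s; apply: sc; first by rewrite /x mulrC divfK ?gt_eqF.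
  by rewrite mulrC divfK ?gt_eqF // ger0_norm.
- exists (- acos x); rewrite /udir cosN sinN c s; apply: sc.
    by rewrite /x mulrC divfK ?gt_eqF.
  by rewrite mulrN mulrC divfK ?gt_eqF // ltr0_norm // opprK.
Qed.

(** Outer measure is monotone on arbitrary sets, so an interval inside S has
    length at most K. *)
Lemma exists_outside (R : realType) (S : set R) (K lo hi : R) :
  (lebesgue_measure S <= K%:E)%E -> lo < hi -> K < hi - lo ->
  exists2 r, lo <= r <= hi & ~ S r.
Proof.
move=> SK lh Klh; apply: contrapT => H.
have sub : `[lo, hi]%classic `<=` S.
  move=> r; rewrite /= in_itv /= => rI; apply: contrapT => nS.
  by apply: H; exists r.
have := le_trans (le_mu_ext (wlength idfun) sub) SK.
have -> : ((wlength idfun)^*%mu `[lo, hi]%classic = (hi - lo)%:E)%E.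
  transitivity (@lebesgue_measure R `[lo, hi]) => //.
  by rewrite lebesgue_measure_itv /= lte_fin lh EFinB.
by rewrite lee_fin leNgt Klh.
Qed.

Lemma norm2_ray (R : realType) (x0 : R * R) (th s : R) : x0 = norm2 x0 *: udir th ->
  0 <= norm2 x0 + s -> norm2 (x0 + s *: udir th) = norm2 x0 + s.
Proof.
by move=> E h; rewrite {1}E -scalerDl norm2Z norm2_udir mulr1 ger0_norm.
Qed.

(** On the circle |x| takes all the values between |x0| - s and |x0| + s, an
    interval of length 2 s. *)
Lemma good_angle (R : realType) (S : set R) (K s : R) (x0 : R * R) :
  (lebesgue_measure S <= K%:E)%E -> 0 < s -> K < 2 * s -> s <= norm2 x0 ->
  exists t, ~ S (norm2 (x0 + s *: udir t)).
Proof.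
move=> SK s0 Ks sx; have [th E] := polar x0.
have [||r /andP[r1 r2] nS] := exists_outside SK (lo := norm2 x0 - s) (hi := norm2 x0 + s).
- lra.
- lra.
pose f t := norm2 (x0 + s *: udir t).
have cf : continuous f.
  move=> t; apply: (@continuous_comp _ _ _ (fun t => x0 + s *: udir t) (@norm2 R)); last exact: norm2_continuous.
  apply: (continuous_add_cst (h := fun t => s *: udir t)).
  by apply: continuous_scale_pair; [exact: cst_continuous|exact: udir_continuous].
have f0 : f th = norm2 x0 + s by apply: norm2_ray => //; have := norm2_ge0 x0; lra.
have f1 : f (th + pi) = norm2 x0 - s.
  rewrite /f (_ : s *: udir (th + pi) = (- s) *: udir th); last first.
    by rewrite /udir cosDpi sinDpi scaleNr -scalerN.
  by rewrite norm2_ray //; lra.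
have lt : th <= th + pi by rewrite lerDl pi_ge0.
have [|c _ fc] := IVT lt (continuous_subspaceT cf) (v := r).
  by rewrite f0 f1 ge_min le_max r1 r2 orbT.
by exists c; rewrite -/(f c) fc.
Qed.

(** * The comparison inequality between real numbers *)

Lemma rot_iter_disc (R : realType) N j rho (x : R * R) :
  disc 0 rho x -> disc 0 rho (iter j (rot N) x).
Proof. by rewrite /disc /= !subr0 rot_iter_norm. Qed.

Lemma equivariant_iter (R : realType) N rho (u : R * R -> R * R) j x :
  (forall x, disc 0 rho x -> u (rot N x) = rot N (u x)) ->
  disc 0 rho x -> u (iter j (rot N) x) = iter j (rot N) (u x).
Proof.
move=> eq xO; elim: j => //= j IH; rewrite eq ?IH //.
exact: rot_iter_disc.
Qed.

(** A rotation carries the j-th disc to the one around x0, keeping |x| and hence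
    the membership in a set of shells. *)
Lemma equivariant_close (R : realType) N rho (u : R * R -> R * R) (a x0 x : R * R) s j (d : R) :
  (forall x, disc 0 rho x -> u (rot N x) = rot N (u x)) ->
  disc x0 s `<=` disc 0 rho -> (j < N)%N ->
  (forall y, norm2 (y - x0) = norm2 (x - iter j (rot N) x0) -> norm2 y = norm2 x ->
     norm2 (u y - a) <= d) ->
  norm2 (x - iter j (rot N) x0) < s ->
  norm2 (u x - iter j (rot N) a) <= d.
Proof.
move=> eq xO jN H xs; pose y := iter (N - j) (rot N) x.
have E : iter j (rot N) y = x.
  by rewrite -iterD subnKC ?rot_iterN // ?(ltnW jN) // (leq_ltn_trans _ jN).
have yx : norm2 (y - x0) = norm2 (x - iter j (rot N) x0) by rewrite -(rot_iter_dist N j) E.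
have yO : disc 0 rho y by apply: xO; rewrite /disc /= yx.
rewrite -{1}E (equivariant_iter j eq yO) rot_iter_dist; apply: H => //.
by rewrite /y rot_iter_norm.
Qed.

Definition orbit_energy (R : realType) N (W : R * R -> R) (x0 : R * R) u Du (s : R) : R :=
  fine (\int[leb2 R]_(x in orbit_disc N x0 s) (density W u Du x)%:E)%E.

Definition orbit_bad_area (R : realType) N (x0 : R * R) (P : set (plane R)) (s : R) : R :=
  fine (leb2 R (P `&` orbit_disc N x0 s)).

Lemma fine_setD (R : realType) (A B : set (plane R)) (f : R * R -> R) :
  measurable A -> measurable B -> A `<=` B ->
  measurable_fun B (f : plane R -> R) -> (forall x, 0 <= f x) ->
  (\int[leb2 R]_(x in B) (f x)%:E < +oo)%E ->
  (\int[leb2 R]_(x in B `\` A) (f x)%:E =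
    (fine (\int[leb2 R]_(x in B) (f x)%:E) - fine (\int[leb2 R]_(x in A) (f x)%:E))%:E)%E.
Proof.
move=> mA mB AB mf f0 fin.
have mfE : measurable_fun B (fun x => (f x)%:E) by exact/measurable_EFinP.
have sp : (\int[leb2 R]_(x in B) (f x)%:E = \int[leb2 R]_(x in A) (f x)%:E
    + \int[leb2 R]_(x in B `\` A) (f x)%:E)%E.
  rewrite -[in LHS](setDUK AB) ge0_integral_setU //.
  - exact: measurableD.
  - by rewrite setDUK.
  - by move=> x _; rewrite lee_fin.
  - by apply/disj_setPS => x [xA [_ nxA]]; case: nxA.
have g0 (S : set (plane R)) : (0 <= \int[leb2 R]_(x in S) (f x)%:E)%E.
  by apply: integral_ge0 => x _; rewrite lee_fin.
have finS (S : set (plane R)) : measurable S -> S `<=` B ->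
   (\int[leb2 R]_(x in S) (f x)%:E)%E \is a fin_num.
  move=> mS SB; rewrite ge0_fin_numE //; apply: le_lt_trans fin.
  by apply: ge0_subset_integral => // x _; rewrite lee_fin.
have f1 := finS A mA AB; have f2 := finS (B `\` A) (measurableD mB mA) (@subDsetl _ _ _).
rewrite sp fineD // addrAC subrr add0r fineK //.
Qed.

Lemma orbit_density_fin (R : realType) N rho M Wmax (W : R * R -> R) (x0 : R * R) u Du s :
  continuous W -> (forall z, 0 <= W z) -> (forall z, norm2 z <= M -> W z <= Wmax) ->
  0 <= Wmax -> admissible N rho u Du -> ae_bounded rho M u Du ->
  0 <= s -> disc x0 s `<=` disc 0 rho ->
  (\int[leb2 R]_(x in orbit_disc N x0 s) (density W u Du x)%:E <=
     ((M ^+ 2 / 2 + Wmax) * (N%:R * (2 * s) ^+ 2))%:E)%E.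
Proof.
move=> cW W0 Wm Wm0 adm bd s0 dO.
apply: (le_trans (density_integral_le cW W0 Wm Wm0 adm bd (orbit_disc_measurable _ _ _) (orbit_disc_sub dO))).
rewrite EFinM; apply: lee_wpmul2l; last exact: orbit_disc_area.
by rewrite lee_fin addr_ge0 // divr_ge0 // sqr_ge0.
Qed.

Lemma orbit_energyE (R : realType) N rho M Wmax (W : R * R -> R) (x0 : R * R) u Du s :
  continuous W -> (forall z, 0 <= W z) -> (forall z, norm2 z <= M -> W z <= Wmax) ->
  0 <= Wmax -> admissible N rho u Du -> ae_bounded rho M u Du ->
  0 <= s -> disc x0 s `<=` disc 0 rho ->
  (\int[leb2 R]_(x in orbit_disc N x0 s) (density W u Du x)%:E =
     (orbit_energy N W x0 u Du s)%:E)%E.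
Proof.
move=> cW W0 Wm Wm0 adm bd s0 dO; rewrite /orbit_energy fineK // ge0_fin_numE.
  by apply: (le_lt_trans (orbit_density_fin cW W0 Wm Wm0 adm bd s0 dO)); rewrite ltry.
by apply: integral_ge0 => x _; rewrite lee_fin density_ge0.
Qed.

Lemma orbit_energy_diff (R : realType) N rho M Wmax (W : R * R -> R) (x0 : R * R) u Du s t :
  continuous W -> (forall z, 0 <= W z) -> (forall z, norm2 z <= M -> W z <= Wmax) ->
  0 <= Wmax -> admissible N rho u Du -> ae_bounded rho M u Du ->
  0 <= s <= t -> disc x0 t `<=` disc 0 rho ->
  (\int[leb2 R]_(x in orbit_disc N x0 t `\` orbit_disc N x0 s) (density W u Du x)%:E =
     (orbit_energy N W x0 u Du t - orbit_energy N W x0 u Du s)%:E)%E.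
Proof.
move=> cW W0 Wm Wm0 adm bd /andP[s0 st] dO; apply: fine_setD.
- exact: orbit_disc_measurable.
- exact: orbit_disc_measurable.
- exact: orbit_discS.
- exact: (measurable_funS (@disc_measurable R 0 rho) (orbit_disc_sub dO) (measurable_density cW adm)).
- by move=> x; exact: density_ge0.
- have t0 : 0 <= t by exact: le_trans st.
  by apply: (le_lt_trans (orbit_density_fin cW W0 Wm Wm0 adm bd t0 dO)); rewrite ltry.
Qed.

Lemma orbit_energy_ge0 (R : realType) N (W : R * R -> R) (x0 : R * R) u Du s :
  (forall z, 0 <= W z) -> 0 <= orbit_energy N W x0 u Du s.
Proof.
by move=> W0; apply: fine_ge0; apply: integral_ge0 => x _; rewrite lee_fin density_ge0.
Qed.

Lemma orbit_bad_area_diff (R : realType) N (x0 : R * R) (P : set (plane R)) s t :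
  measurable P -> 0 <= s <= t ->
  leb2 R (P `&` (orbit_disc N x0 t `\` orbit_disc N x0 s)) =
  (orbit_bad_area N x0 P t - orbit_bad_area N x0 P s)%:E.
Proof.
move=> mP /andP[s0 st]; rewrite /orbit_bad_area.
set A1 := orbit_disc N x0 t; set A0 := orbit_disc N x0 s.
have A01 : A0 `<=` A1 by exact: orbit_discS.
have mA1 : measurable (A1 : set (plane R)) by exact: orbit_disc_measurable.
have mA0 : measurable (A0 : set (plane R)) by exact: orbit_disc_measurable.
have areafin : (leb2 R A1 < +oo)%E.
  by apply: le_lt_trans (ltry _); apply: orbit_disc_area; exact: le_trans st.
have PA : P `&` A0 `<=` P `&` A1 by move=> x [? /A01].
have mPA1 : measurable (P `&` A1 : set (plane R)) by exact: measurableI.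
have mPA0 : measurable (P `&` A0 : set (plane R)) by exact: measurableI.
have finPA : (leb2 R (P `&` A1) < +oo)%E.
  by apply: le_lt_trans areafin; apply: le_measure; rewrite ?inE //; exact: subIsetr.
have fPA0 : (leb2 R (P `&` A0) < +oo)%E.
  by apply: le_lt_trans finPA; apply: le_measure; rewrite ?inE.
have -> : P `&` (A1 `\` A0) = (P `&` A1) `\` (P `&` A0).
  rewrite setIDA; apply/seteqP.
  by split=> x [[Px x1] x0']; split => //; [case|move=> h; apply: x0'].
have -> : (leb2 R ((P `&` A1) `\` (P `&` A0)) = leb2 R (P `&` A1) - leb2 R (P `&` A0))%E.
  rewrite measureD; [|exact: mPA1|exact: mPA0|exact: finPA].
  by congr (_ - leb2 R _)%E; apply/setIidPr.
rewrite EFinB; congr (_ - _)%E; rewrite fineK // ge0_fin_numE //.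
Qed.

(** All quantities in [compare_energy] are finite; as real numbers they can be
    subtracted, which the telescoping argument needs. *)
Lemma compare_orbit_energy (R : realType) N rho M Wmax dW cW CW G r (W : R * R -> R)
    (a x0 : R * R) u Du (P : set (plane R)) :
  (0 < N)%N -> continuous W -> (forall z, 0 <= W z) -> W a = 0 ->
  (forall z, W (rot N z) = W z) ->
  (forall z d, norm2 (z - a) = d -> d <= dW ->
     cW ^+ 2 * d ^+ 2 / 2 <= W z <= CW ^+ 2 * d ^+ 2 / 2) ->
  0 < cW ->
  (forall z, norm2 z <= M + norm2 a -> W z <= Wmax) -> 0 <= M -> 0 <= Wmax ->
  (forall s y x, 0 <= s -> norm2 (grad (@cutoff R s y) x) <= G) ->
  minimizer N W rho u Du -> ae_bounded rho M u Du ->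
  0 <= r -> disc x0 (r + 1) `<=` disc 0 rho ->
  (forall j k, (j < N)%N -> (k < N)%N -> j <> k ->
     2 * (r + 1) <= norm2 (iter j (rot N) x0 - iter k (rot N) x0)) ->
  measurable P ->
  (forall j x, (j < N)%N -> norm2 (x - iter j (rot N) x0) < r + 1 ->
     r <= norm2 (x - iter j (rot N) x0) -> ~ P x ->
     norm2 (u x - iter j (rot N) a) <= dW) ->
  orbit_energy N W x0 u Du (r + 1) <=
    C_good G cW CW * (orbit_energy N W x0 u Du (r + 1) - orbit_energy N W x0 u Du r) +
    C_bad G M Wmax a * (orbit_bad_area N x0 P (r + 1) - orbit_bad_area N x0 P r).
Proof.
move=> N0 cW0 W0 Wa Wr Q cW_gt0 Wmaxb M0 Wmax0 HG mini bd r0 dO sep mP good.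
have := compare_energy N0 cW0 W0 Wa Wr Q cW_gt0 Wmaxb M0 Wmax0 HG mini bd r0 dO sep mP good.
have [cu adm _] := mini.
have Wm z : norm2 z <= M -> W z <= Wmax.
  by move=> zM; apply: Wmaxb; apply: (le_trans zM); rewrite lerDl norm2_ge0.
have r1 : 0 <= r <= r + 1 by apply/andP; split; lra.
have r10 : 0 <= r + 1 by lra.
rewrite (orbit_energyE cW0 W0 Wm Wmax0 adm bd r10 dO).
rewrite (orbit_energy_diff cW0 W0 Wm Wmax0 adm bd r1 dO).
by rewrite orbit_bad_area_diff // -!EFinM -EFinD lee_fin.
Qed.

(** * Closeness to the prescribed well on circles and rays *)

(** Along the circle through x one reaches a point where |x| avoids S and u is
    known to be near a; the well is the same all along. *)
Lemma circle_close (R : realType) N (a x0 : R * R) (u : R * R -> R * R) rho (S : set R)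
    (K delta kap d0 r1 r2 : R) :
  {in disc 0 rho, continuous u} -> disc x0 r2 `<=` disc 0 rho ->
  (forall x, r1 <= norm2 (x - x0) < r2 ->
     exists2 j, (j < N)%N & norm2 (u x - iter j (rot N) a) < 2 * delta) ->
  (forall j, (0 < j < N)%N -> d0 <= norm2 (iter j (rot N) a - a)) ->
  2 * delta + kap < d0 -> 4 * delta < d0 ->
  (lebesgue_measure S <= K%:E)%E -> 0 < r1 -> K < 2 * r1 -> r2 <= norm2 x0 ->
  (forall x, norm2 (x - x0) < r2 -> ~ S (norm2 x) -> norm2 (u x - a) <= kap) ->
  forall x, r1 <= norm2 (x - x0) < r2 -> norm2 (u x - a) < 2 * delta.
Proof.
move=> cu dO near sep k1 k2 SK r10 Kr x0r good x /andP[xr1 xr2].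
set r := norm2 (x - x0) in xr1 xr2.
have [th Eth] := polar (x - x0).
have g1 : 0 < r by lra.
have g2 : K < 2 * r by lra.
have g3 : r <= norm2 x0 by lra.
have [th1 nS] := good_angle SK g1 g2 g3.
have r0 : 0 <= r by exact: norm2_ge0.
pose y t := x0 + r *: udir (th + t * (th1 - th)).
have ny t : norm2 (y t - x0) = r.
  by rewrite /y addrAC subrr add0r norm2Z norm2_udir mulr1 ger0_norm.
have y0 : y 0 = x by rewrite /y mul0r addr0 -Eth addrC subrK.
rewrite -y0; apply: (path_same_well (y := y) (rho := rho) cu _ _ _ sep k1 k2).
- apply: continuous_add_cst; apply: continuous_scale_pair; first exact: cst_continuous.
  have ca : continuous (fun t : R => th + t * (th1 - th)).
    move=> t; apply: (@continuousD _ _ _ (cst th : R -> R) (fun t : R => t * (th1 - th))); first exact: cst_continuous.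
    by apply: (@continuousM _ _ (id : R -> R) (cst (th1 - th))); [exact: cvg_id|exact: cst_continuous].
  by move=> t; exact: (continuous_comp (ca t) (@udir_continuous R _)).
- by move=> t _; apply: dO; rewrite /disc /= ny.
- by move=> t _; apply: near; rewrite ny xr1.
- by apply: good; rewrite ?ny // /y mul1r [th + _]addrC subrK.
Qed.

(** Moving from x0 away from the origin, |x| increases at unit speed and leaves S
    before the length q > K is used up. *)
Lemma ray_close (R : realType) N (a x0 : R * R) (u : R * R -> R * R) rho (S : set R)
    (K delta kap d0 q r2 : R) :
  {in disc 0 rho, continuous u} -> disc x0 r2 `<=` disc 0 rho ->
  (forall x, norm2 (x - x0) <= q ->
     exists2 j, (j < N)%N & norm2 (u x - iter j (rot N) a) < 2 * delta) ->
  (forall j, (0 < j < N)%N -> d0 <= norm2 (iter j (rot N) a - a)) ->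
  2 * delta + kap < d0 -> 4 * delta < d0 ->
  (lebesgue_measure S <= K%:E)%E -> 0 < q -> K < q -> q < r2 ->
  (forall x, norm2 (x - x0) < r2 -> ~ S (norm2 x) -> norm2 (u x - a) <= kap) ->
  norm2 (u x0 - a) < 2 * delta.
Proof.
move=> cu dO near sep k1 k2 SK q0 Kq qr2 good.
have [th Eth] := polar x0.
have [||r /andP[r1 r2'] nS] := exists_outside SK (lo := norm2 x0) (hi := norm2 x0 + q).
- by rewrite ltrDl.
- by rewrite addrAC subrr add0r.
set s := r - norm2 x0; have s0 : 0 <= s by rewrite subr_ge0.
have sq : s <= q by rewrite lerBlDl.
pose y t := x0 + (t * s) *: udir th.
have ny t : 0 <= t <= 1 -> norm2 (y t - x0) <= q.
  move=> /andP[t0 t1]; rewrite /y addrAC subrr add0r norm2Z norm2_udir mulr1.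
  rewrite ger0_norm ?mulr_ge0 //; apply: le_trans sq; exact: ler_piMl.
have i1 : (0 : R) <= (1 : R) <= (1 : R) by rewrite lexx ler01.
have y0 : y 0 = x0 by rewrite /y mul0r scale0r addr0.
rewrite -{1}y0; apply: (path_same_well (y := y) (rho := rho) cu _ _ _ sep k1 k2).
- apply: continuous_add_cst; apply: continuous_scale_pair; last exact: cst_continuous.
  by move=> t; apply: (@continuousM _ _ id (cst s)); [exact: cvg_id|exact: cst_continuous].
- by move=> t t01; apply: dO; rewrite /disc /=; exact: le_lt_trans (ny t t01) qr2.
- by move=> t t01; apply: near; exact: ny.
- apply: good; first exact: le_lt_trans (ny 1 i1) qr2.
  rewrite /y mul1r norm2_ray //; first by rewrite /s addrC subrK.
  by rewrite addr_ge0 ?norm2_ge0.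
Qed.

Lemma exists_nat_gt (R : realType) (x : R) : exists2 n, (0 < n)%N & x < n%:R.
Proof.
exists (Num.bound x).+1 => //; apply: (le_lt_trans (ler_norm x)).
apply: (@lt_trans _ _ (Num.bound x)%:R); last by rewrite ltr_nat.
have := archi_boundP (normr_ge0 x).
by rewrite /Num.bound normr_id.
Qed.

(** The threshold for delta from which D is chosen. *)
Lemma small_delta_bounds (R : realType) (c alpha dW d0 delta : R) :
  0 < c -> 0 < alpha -> 0 < dW -> 0 < d0 ->
  0 <= delta <= Num.min ((Num.min dW (d0 / 4) / c) `^ (alpha^-1)) (Num.min (d0 / 16) (dW / 2)) ->
  [/\ c * delta `^ alpha <= dW, c * delta `^ alpha <= d0 / 4, delta <= d0 / 16 & 2 * delta <= dW].
Proof.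
move=> c0 al0 dW0 d00 /andP[de0]; rewrite !le_min => /andP[h1 /andP[h2 h3]].
have m0 : 0 < Num.min dW (d0 / 4) by rewrite lt_min dW0 divr_gt0.
have q0 : 0 <= Num.min dW (d0 / 4) / c by rewrite divr_ge0 // ltW.
have h : c * delta `^ alpha <= Num.min dW (d0 / 4).
  rewrite mulrC -ler_pdivlMr //.
  have := ge0_ler_powR (ltW al0) _ _ h1; rewrite !nnegrE powR_ge0 => /(_ de0 isT).
  by rewrite -powRrM mulVf ?gt_eqF // powRr1.
move: h; rewrite le_min => /andP[h4 h5]; split=> //; lra.
Qed.

(** * A quiet ring determines the map in the disc *)

Lemma exists_quiet_ring (R : realType) (C1 C2 C3 C4 K : R) (e b : nat -> R) q p :
  0 <= C1 -> 0 <= C2 -> (0 < p)%N ->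
  let m := (q + 3 * p)%N in
  (forall k, 0 <= e k) -> (forall k, (k < 4 * m)%N -> e k <= e k.+1) ->
  (forall k, 0 <= b k) ->
  (forall k, (k < 4 * m)%N -> e k.+1 <= C1 * (e k.+1 - e k) + C2 * (b k.+1 - b k)) ->
  e (4 * m)%N <= C3 * (4 * m)%:R ^+ 2 ->
  (forall k, (0 < k)%N -> (k <= 4 * m)%N -> b k <= C4 * k%:R) ->
  8 * C1 ^+ 2 * C3 + 2 * (C2 * C4) + 2 * (C1 * (C2 * C4)) <= K ->
  exists k, [/\ (q <= k)%N, (k + 3 <= m)%N & e (k + 3)%N - e k <= K / p%:R].
Proof.
move=> C10 C20 p0 m e0 emono b0 cmp e4 bk HK.
have m0 : (0 < m)%N by rewrite addn_gt0 muln_gt0 p0 orbT.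
have bnd := energy_bounded C10 C20 m0 e0 emono b0 (fun k km => le_trans (emono k km) (cmp k km)) e4 bk.
exact: (small_increment p0 (e0 q) (le_trans bnd HK)).
Qed.

(** The ring of width 3 leaves room on both sides of the ring of radii r + 1 and
    r + 2, on which u is shown to be 2 delta-close to a: the discs used in
    [near_some_well] must stay in the region of little energy. The second
    comparison uses this middle ring as the place where u is cut off. *)
Lemma close_of_quiet_ring (R : realType) (N : nat) (W : R * R -> R) (a x0 : R * R)
    (M dW cW CW G Wmax d0 delta c K r s eta rho : R) u Du (Sigma : set R) :
  (0 < N)%N -> continuous W -> (forall z, 0 <= W z) -> W a = 0 ->
  (forall z, W (rot N z) = W z) -> 0 <= M -> 0 < cW ->
  quadratic_bounds N W a M dW cW CW ->
  (forall z, norm2 z <= M + norm2 a -> W z <= Wmax) -> 0 <= Wmax ->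
  (forall s y x, 0 <= s -> norm2 (grad (@cutoff R s y) x) <= G) ->
  (forall j, (0 < j < N)%N -> d0 <= norm2 (iter j (rot N) a - a)) ->
  0 < delta <= dW -> 2 * delta + c < d0 -> 4 * delta < d0 -> 2 * delta <= dW ->
  0 < s <= 1 -> 4 * M * s <= delta ->
  minimizer N W rho u Du -> ae_bounded rho M u Du ->
  (lebesgue_measure Sigma <= K%:E)%E -> 0 < K < r ->
  disc x0 (r + 3) `<=` disc 0 rho ->
  (forall j k, (j < N)%N -> (k < N)%N -> j <> k ->
     2 * (r + 3) <= norm2 (iter j (rot N) x0 - iter k (rot N) x0)) ->
  r + 3 <= norm2 x0 ->
  (forall x, norm2 (x - x0) < r + 3 -> ~ Sigma (norm2 x) -> norm2 (u x - a) <= c) ->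
  orbit_energy N W x0 u Du (r + 3) - orbit_energy N W x0 u Du r <= eta ->
  C_good G cW CW * eta < cW ^+ 2 * delta ^+ 2 / 2 * s ^+ 2 ->
  norm2 (u x0 - a) < 2 * delta.
Proof.
move=> N0 cWc W0 Wa Wr M0 cW0 [Q1 Q2] Wmaxb Wmax0 HG sepa ddW kd1 kd2 dd2.
move=> /andP[s0 s1] Ms mini bd SK /andP[K0 Kr] dO sep x0r good Hen Hmu.
have [cu adm _] := mini; have [eqv _ _] := adm.
have r0 : 0 < r by exact: lt_trans Kr.
have rr1 : 0 <= r <= r + 1 by apply/andP; split; move: r0; clear; lra.
have r12 : 0 <= r + 1 <= r + 2 by apply/andP; split; move: r0; clear; lra.
have r23 : 0 <= r + 2 <= r + 3 by apply/andP; split; move: r0; clear; lra.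
have r13 : r + 1 <= r + 3 by clear; lra.
have rr3 : 0 <= r <= r + 3 by apply/andP; split; move: r0; clear; lra.
have lt23 : r + 2 < r + 3 by clear; lra.
have Wm z : norm2 z <= M -> W z <= Wmax.
  by move=> zM; apply: Wmaxb; apply: (le_trans zM); rewrite lerDl norm2_ge0.
have dOt (t : R) : t <= r + 3 -> disc x0 t `<=` disc 0 rho.
  move=> tr x; rewrite {1}/disc /= => xt; apply: dO; rewrite /disc /=.
  exact: lt_le_trans tr.
set e := orbit_energy N W x0 u Du in Hen.
have ediff (t t' : R) : 0 <= t <= t' -> t' <= r + 3 ->
    (\int[leb2 R]_(x in orbit_disc N x0 t' `\` orbit_disc N x0 t) (density W u Du x)%:E
    = (e t' - e t)%:E)%E.
  by move=> tt' t'r; apply: (orbit_energy_diff cWc W0 Wm Wmax0 adm bd tt'); exact: dOt.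
have emono (t t' : R) : 0 <= t <= t' -> t' <= r + 3 -> e t <= e t'.
  move=> tt' t'r; rewrite -subr_ge0 -lee_fin -ediff //.
  by apply: integral_ge0 => x _; rewrite lee_fin density_ge0.
have C12 := C_good_ge2 G cW CW.
have C10 : 0 <= C_good G cW CW by exact: le_trans C12.
have eta0 : 0 <= eta.
  by apply: le_trans Hen; rewrite subr_ge0 emono.
have etamu : eta < cW ^+ 2 * delta ^+ 2 / 2 * s ^+ 2.
  apply: le_lt_trans Hmu; rewrite ler_peMl //; apply: le_trans C12; exact: ler1n.
have far x j : norm2 (x - x0) < r + 3 -> (j < N)%N -> j <> 0%N ->
    r <= norm2 (x - iter j (rot N) x0).
  move=> xr jN j0; have h1 := sep j 0%N jN N0 j0.
  have h2 := norm2_tri3 (iter j (rot N) x0) x x0.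
  rewrite (norm2C (iter j (rot N) x0) x) in h2.
  move: h1 h2 xr r0; rewrite /=; clear; lra.
have ring1 x : r + 1 <= norm2 (x - x0) < r + 2 ->
    exists2 j, (j < N)%N & norm2 (u x - iter j (rot N) a) < 2 * delta.
  move=> /andP[x1 x2].
  apply: (@near_some_well R N W a M dW cW rho u Du
    (orbit_disc N x0 (r + 3) `\` orbit_disc N x0 r) delta s x) => //.
  - by apply: measurableD; exact: orbit_disc_measurable.
  - by move=> y [yA _]; apply: (orbit_disc_sub _ yA); exact: dOt.
  - move=> y; rewrite /disc /= => yx.
    have y1 : norm2 (y - x0) < r + 3.
      by have := norm2_tri3 y x x0; move: yx x2 s1; clear; lra.
    have y2 : r < norm2 (y - x0).
      have := norm2_tri3 x y x0; rewrite (norm2C x y).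
      by move: yx x1 s1; clear; lra.
    split; first by exists 0%N.
    move=> [j /= jN]; rewrite /disc /= => yj.
    have [j0|/eqP j0] := eqVneq j 0%N.
      by move: (lt_trans yj y2); rewrite j0 /= ltxx.
    by have := lt_le_trans yj (far y j y1 jN j0); rewrite ltxx.
  - by rewrite ediff // lte_fin (le_lt_trans Hen).
have ring_close : forall x, r + 1 <= norm2 (x - x0) < r + 2 -> norm2 (u x - a) < 2 * delta.
  have g1 : 0 < r + 1 by exact: addr_gt0.
  have g2 : K < 2 * (r + 1) by move: Kr r0; clear; lra.
  have g3 : r + 2 <= norm2 x0 by exact: le_trans (ltW lt23) x0r.
  apply: (circle_close cu _ ring1 sepa kd1 kd2 SK g1 g2 g3).
  - by apply: dOt; exact: ltW.
  - by move=> x xk2; apply: good; exact: lt_trans lt23.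
(* On the ring of radii r + 1 and r + 2 the map u is within 2 delta of a, so the
   comparison can be repeated with an empty bad set. *)
have E2 : r + 1 + 1 = r + 2 by clear; ring.
have cmp2 : e (r + 2) <= C_good G cW CW * (e (r + 2) - e (r + 1)).
  have k1R : 0 <= r + 1 by case/andP: r12.
  have k1n : r + 1 + 1 <= r + 3 by rewrite E2; exact: ltW.
  have sep1 j k : (j < N)%N -> (k < N)%N -> j <> k ->
     2 * (r + 1 + 1) <= norm2 (iter j (rot N) x0 - iter k (rot N) x0).
    by move=> jN kN jk; apply: le_trans (sep j k jN kN jk); rewrite ler_pM2l.
  have := @compare_orbit_energy R N rho M Wmax dW cW CW G (r + 1) W a x0 u Du set0
     N0 cWc W0 Wa Wr Q1 cW0 Wmaxb M0 Wmax0 HG mini bd k1R (dOt _ k1n) sep1 measurable0.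
  rewrite /orbit_bad_area !set0I measure0 subrr mulr0 addr0 E2; apply.
  move=> j x jN xj1 xj2 _; apply: le_trans dd2.
  apply: (equivariant_close (x0 := x0) (s := r + 2) eqv) => //; first exact: dOt (ltW lt23).
  by move=> y yx _; apply: ltW; apply: ring_close; rewrite yx xj2.
have e2mu : e (r + 2) < cW ^+ 2 * delta ^+ 2 / 2 * s ^+ 2.
  apply: (le_lt_trans cmp2); apply: le_lt_trans Hmu; rewrite ler_wpM2l //.
  apply: le_trans Hen; apply: lerB; first exact: emono.
  by apply: emono.
have disc1 x : norm2 (x - x0) <= r + 1 ->
    exists2 j, (j < N)%N & norm2 (u x - iter j (rot N) a) < 2 * delta.
  move=> x1.
  apply: (@near_some_well R N W a M dW cW rho u Du (orbit_disc N x0 (r + 2)) delta s x) => //.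
  - exact: orbit_disc_measurable.
  - by apply: orbit_disc_sub; apply: dOt; exact: ltW.
  - move=> y; rewrite /disc /= => yx; exists 0%N => //; rewrite /disc /=.
    by have := norm2_tri3 y x x0; move: yx x1 s1; clear; lra.
  - rewrite (orbit_energyE cWc W0 Wm Wmax0 adm bd _ (dOt _ (ltW lt23))) ?lte_fin //.
    by case/andP: r23.
have r3 : r < r + 3 by clear; lra.
apply: (ray_close cu dO _ sepa kd1 kd2 SK r0 Kr r3 good).
by move=> x xq; apply: disc1; apply: (le_trans xq); rewrite lerDl.
Qed.

(** The number of steps depends on delta and on the constants only: 4 m unit steps
    are needed, with m = q + 3 p, where q > K makes circles and rays long
    enough and p is the number of blocks that makes the increment small. The
    distance of x0 from the origin makes the discs disjoint and the shells
    thin. *)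
Lemma close_at_center (R : realType) (N : nat) (W : R * R -> R) (a : R * R)
    (M dW cW CW G Wmax kap d0 delta c K : R) :
  (0 < N)%N -> continuous W -> (forall z, 0 <= W z) -> W a = 0 ->
  (forall z, W (rot N z) = W z) -> 0 < M -> 0 < dW -> 0 < cW ->
  quadratic_bounds N W a M dW cW CW ->
  (forall z, norm2 z <= M + norm2 a -> W z <= Wmax) -> 0 <= Wmax ->
  (forall s y x, 0 <= s -> norm2 (grad (@cutoff R s y) x) <= G) ->
  0 < kap -> (forall (x : R * R) j k, (j < N)%N -> (k < N)%N -> j <> k ->
    kap * norm2 x <= norm2 (iter j (rot N) x - iter k (rot N) x)) ->
  (forall j, (0 < j < N)%N -> d0 <= norm2 (iter j (rot N) a - a)) ->
  0 < delta <= dW -> c <= dW -> c <= d0 / 4 -> delta <= d0 / 16 -> 2 * delta <= dW -> 0 < d0 ->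
  0 < K ->
  exists l_delta r_delta : R, [/\ 0 < l_delta, 0 < r_delta &
    forall rho u Du (l : R) (x0 : R * R) (Sigma : set R),
      minimizer N W rho u Du -> ae_bounded rho M u Du ->
      disc x0 l `<=` disc 0 rho ->
      (lebesgue_measure Sigma <= K%:E)%E ->
      (forall x, disc x0 l x -> ~ Sigma (norm2 x) -> norm2 (u x - a) <= c) ->
      l_delta <= l -> r_delta <= norm2 x0 -> norm2 (u x0 - a) < 2 * delta].
Proof.
move=> N0 cWc W0 Wa Wr M0 dW0 cW0 [Q1 Q2] Wmaxb Wmax0 HG kap0 Hkap sepa ddW cdW cd0 dd0 dd2 d00 K0.
have /andP[de0 _] := ddW.
set C1 := C_good G cW CW; set C2 := C_bad G M Wmax a.
have C12 : 2 <= C1 by exact: C_good_ge2.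
have C10 : 0 <= C1 by lra.
have C20 : 0 <= C2 by rewrite /C2 /C_bad !addr_ge0 ?sqr_ge0 // mulr_ge0 ?sqr_ge0.
set C3 := (M ^+ 2 / 2 + Wmax) * (N%:R * 4).
set C4 := N%:R * (12 * (K + 1)).
set K2 := 8 * C1 ^+ 2 * C3 + 2 * (C2 * C4) + 2 * (C1 * (C2 * C4)).
(* Radius on which u, which is 4 M-Lipschitz, varies by at most delta. *)
pose s := Num.min (delta / (4 * M)) 1.
have s0 : 0 < s by rewrite lt_min ltr01 divr_gt0 // mulr_gt0.
have s1 : s <= 1 by rewrite ge_min lexx orbT.
have Ms : 4 * M * s <= delta.
  have : s <= delta / (4 * M) by rewrite ge_min lexx.
  by rewrite ler_pdivlMr ?mulr_gt0 // mulrC.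
set mu := cW ^+ 2 * delta ^+ 2 / 2 * s ^+ 2.
have mu0 : 0 < mu by rewrite mulr_gt0 ?exprn_gt0 // divr_gt0 // mulr_gt0 // exprn_gt0.
have [q q0 Kq] := exists_nat_gt K.
have [p p0 Kp] := exists_nat_gt (C1 * K2 / mu).
pose m := (q + 3 * p)%N; pose n := (4 * m)%N.
have m0 : (0 < m)%N by rewrite addn_gt0 q0.
have n0 : (0 < n)%N by rewrite muln_gt0.
have nR : 0 < n%:R :> R by rewrite ltr0n.
(* The first summand is for [shell_area], the second makes the discs of radius
   n around the orbit of x0 disjoint. *)
exists n%:R, (6 * n%:R + 2 * n%:R / kap); split=> //.
  by rewrite addr_gt0 ?mulr_gt0 // invr_gt0.
move=> rho u Du l x0 Sigma mini bd dO SK good nl rx.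
have [cu adm _] := mini; have [eqv _ _] := adm.
have x6 : 6 * n%:R <= norm2 x0.
  by apply: le_trans rx; rewrite lerDl divr_ge0 ?mulr_ge0 // ltW.
have xk : 2 * n%:R <= kap * norm2 x0.
  have : 2 * n%:R / kap <= norm2 x0.
    by apply: le_trans rx; rewrite lerDr mulr_ge0.
  by rewrite ler_pdivrMr // [kap * _]mulrC.
have M0' := ltW M0.
have dOs (t : R) : t <= n%:R -> disc x0 t `<=` disc 0 rho.
  move=> tn x; rewrite {1}/disc /= => xt; apply: dO; rewrite /disc /=.
  exact: lt_le_trans xt (le_trans tn nl).
have sep (t : R) : t <= n%:R -> forall j k, (j < N)%N -> (k < N)%N -> j <> k ->
    2 * t <= norm2 (iter j (rot N) x0 - iter k (rot N) x0).
  move=> tn j k jN kN jk; apply: le_trans (Hkap x0 j k jN kN jk).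
  by apply: le_trans xk; rewrite ler_pM2l.
have Wm z : norm2 z <= M -> W z <= Wmax.
  by move=> zM; apply: Wmaxb; apply: (le_trans zM); rewrite lerDl norm2_ge0.
have [pp [pp12 ppS ppK]] := interval_cover SK.
set P := bad_set pp.
have mP : measurable (P : set (plane R)) by exact: bad_set_measurable.
have goodc x : norm2 (x - x0) < n%:R -> ~ Sigma (norm2 x) -> norm2 (u x - a) <= c.
  by move=> xn; apply: good; rewrite /disc /=; exact: lt_le_trans nl.
have goodP x : norm2 (x - x0) < n%:R -> ~ P x -> norm2 (u x - a) <= c.
  move=> xn nP; apply: goodc => // /ppS[i xi]; apply: nP; exists i => //.
pose e (k : nat) := orbit_energy N W x0 u Du k%:R.
pose b (k : nat) := orbit_bad_area N x0 P k%:R.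
have kn (k : nat) : (k < n)%N -> k%:R + 1 <= n%:R :> R by rewrite natr1 ler_nat.
have cmp k : (k < n)%N -> e k.+1 <= C1 * (e k.+1 - e k) + C2 * (b k.+1 - b k).
  move=> klt; rewrite /e /b -natr1.
  apply: (compare_orbit_energy N0 cWc W0 Wa Wr Q1 cW0 Wmaxb M0' Wmax0 HG mini bd) => //.
  - exact: dOs (kn k klt).
  - exact: sep (kn k klt).
  - move=> j x jN xj _ nP; apply: le_trans cdW.
    apply: (equivariant_close (x0 := x0) (s := k%:R + 1) eqv) => //; first exact: dOs (kn k klt).
    move=> y yx ny; apply: goodP; first by rewrite yx; exact: lt_le_trans xj (kn k klt).
    by move=> [i _ yi]; apply: nP; exists i => //; rewrite /shell /= -ny.
have e0 k : 0 <= e k by exact: orbit_energy_ge0.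
have ediff k k' : (k <= k' <= n)%N ->
  (\int[leb2 R]_(x in orbit_disc N x0 k'%:R `\` orbit_disc N x0 k%:R) (density W u Du x)%:E =
     (e k' - e k)%:E)%E.
  move=> /andP[kk' k'n]; apply: (orbit_energy_diff cWc W0 Wm Wmax0 adm bd).
    by rewrite ler0n ler_nat.
  by apply: dOs; rewrite ler_nat.
have emono k k' : (k <= k' <= n)%N -> e k <= e k'.
  move=> kk'; rewrite -subr_ge0 -lee_fin -ediff //.
  by apply: integral_ge0 => x _; rewrite lee_fin density_ge0.
have b0 k : 0 <= b k by exact: fine_ge0.
have e4 : e n <= C3 * n%:R ^+ 2.
  have := orbit_density_fin (s := n%:R) cWc W0 Wm Wmax0 adm bd (ltW nR) (dOs _ (lexx _)).
  rewrite (orbit_energyE cWc W0 Wm Wmax0 adm bd (ltW nR) (dOs _ (lexx _))) lee_fin.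
  move=> h; apply: (le_trans h); rewrite le_eqVlt; apply/orP; left; apply/eqP.
  by rewrite /C3; ring.
have bk k : (0 < k)%N -> (k <= n)%N -> b k <= C4 * k%:R.
  move=> k0 kln; have kR : 0 < k%:R :> R by rewrite ltr0n.
  have x6k : 6 * k%:R <= norm2 x0.
    by apply: le_trans x6; rewrite ler_pM2l // ler_nat.
  have := bad_set_orbit_area N pp12 ppK kR x6k => h.
  rewrite -lee_fin /b /orbit_bad_area fineK; last first.
    by rewrite ge0_fin_numE //; apply: (le_lt_trans h); rewrite ltry.
  apply: (le_trans h); rewrite lee_fin /C4 le_eqVlt; apply/orP; left; apply/eqP; ring.
have [k [qk km ek]] := exists_quiet_ring C10 C20 p0 e0
  (fun k kn => emono k k.+1 (introT andP (conj (leqnSn k) kn))) b0 cmp e4 bk (lexx K2).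
have kn3 : (k + 3 <= n)%N by apply: (leq_trans km); rewrite leq_pmull.
have K2p : C1 * (K2 / p%:R) < mu.
  have pR : 0 < p%:R :> R by rewrite ltr0n.
  by rewrite mulrA ltr_pdivrMr //; move: Kp; rewrite ltr_pdivrMr // [p%:R * _]mulrC.
have kn3' : k%:R + 3 <= n%:R :> R by rewrite -natrD ler_nat.
have Kk : 0 < K < k%:R by rewrite K0 (lt_le_trans Kq) // ler_nat.
have kd1 : 2 * delta + c < d0 by move: cd0 dd0 d00; clear; lra.
have kd2 : 4 * delta < d0 by move: dd0 d00; clear; lra.
have s01 : 0 < s <= 1 by rewrite s0.
have x3 : k%:R + 3 <= norm2 x0.
  by apply: (le_trans kn3'); apply: le_trans x6; rewrite ler_peMl ?(ltW nR) // ler1n.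
apply: (close_of_quiet_ring (eta := K2 / p%:R) N0 cWc W0 Wa Wr M0' cW0 (conj Q1 Q2) Wmaxb Wmax0 HG sepa
  ddW kd1 kd2 dd2 s01 Ms mini bd SK Kk (dOs _ kn3') (sep _ kn3') x3) => //.
- by move=> x xlt; apply: goodc; exact: lt_le_trans kn3'.
- by move: ek; rewrite /e natrD.
Qed.

Theorem theorem5p2 (R : realType) (N : nat) (W : R * R -> R) (a : R * R)
    (M deltaW cW CW deltastar delta0 : R)
    (hN : (3 <= N)%N)
    (hW : potential N W a)
    (hM : 0 < M)
    (hbound : minimizers_bounded N W M)
    (hdeltaW : 0 < deltaW) (hcW : 0 < cW) (hCW : 0 < CW)
    (hquad : quadratic_bounds N W a M deltaW cW CW)
    (hdeltastar : 0 < deltastar <= deltaW)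
    (hdelta0 : 0 < delta0 <= deltaW)
    (hmono : radial_monotone N W a M deltastar delta0)
    (c C alpha alpha' : R)
    (hc : 0 < c) (hC : 0 < C)
    (halpha : 0 < alpha < 1) (halpha' : 0 < alpha' < 1)
    (hsum : 2 * alpha + alpha' < 1) :
  exists D : R, 0 < D /\
    forall delta : R, 0 < delta <= delta0 ->
      delta <= D `^ (1 / (1 - (2 * alpha + alpha'))) ->
      exists l_delta r_delta : R, [/\ 0 < l_delta, 0 < r_delta &
        forall (rho : R) (u : R * R -> R * R)
          (Du : R * R -> (R * R) * (R * R))
          (l : R) (x0 : R * R) (Sigma : set R),
          0 < rho -> minimizer N W rho u Du ->
          0 < l -> disc x0 l `<=` disc 0 rho ->
          Sigma `<=` [set s | 0 < s < rho] ->
          lebesgue_measurable Sigma ->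
          (forall x, disc x0 l x ->
             ~ (disc 0 rho x /\ Sigma (norm2 x)) ->
             norm2 (u x - a) <= c * delta `^ alpha) ->
          (lebesgue_measure Sigma <= (C / delta `^ (1 + alpha'))%:E)%E ->
          l_delta <= l -> r_delta <= norm2 x0 ->
          norm2 (u x0 - a) <= 2 * delta].
Proof.
have N0 : (0 < N)%N by exact: leq_trans hN.
have [sW Wrot [W0 Wzero] [a0 _] _] := hW.
have cW_cont := smooth_cont sW.
have Wa : W a = 0.
  have : [set u | W u = 0] a by rewrite Wzero; exists 0%N.
  by [].
have [G _ HG] := grad_cutoff_bounded R.
have [Wmax Wmax0 HWmax] := continuous_bounded_disc (0 : R * R) (M + norm2 a + 1) cW_cont.
have Wmaxb z : norm2 z <= M + norm2 a -> W z <= Wmax.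
  move=> za; apply: (le_trans (ler_norm _)); apply: HWmax.
  by rewrite /disc /= subr0 (le_lt_trans za) // ltrDl.
have [kap kap0 Hkap] := rot_separation R N.
have na : 0 < norm2 a by rewrite lt_neqAle norm2_ge0 eq_sym norm2_eq0 a0.
(* Lower bound for the distance of a to the other wells. *)
pose d0 := kap * norm2 a; have d00 : 0 < d0 by rewrite mulr_gt0.
have sepa j : (0 < j < N)%N -> d0 <= norm2 (iter j (rot N) a - a).
  move=> /andP[j0 jN]; apply: (Hkap a j 0%N jN N0).
  by apply/eqP; rewrite -lt0n.
have /andP[al0 _] := halpha.
pose dmax := Num.min ((Num.min deltaW (d0 / 4) / c) `^ (alpha^-1)) (Num.min (d0 / 16) (deltaW / 2)).
have dmax0 : 0 < dmax.
  rewrite !lt_min powR_gt0 ?divr_gt0 //.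
  by rewrite lt_min hdeltaW divr_gt0.
have s0 : 1 - (2 * alpha + alpha') != 0 by rewrite gt_eqF // subr_gt0.
(* The exponents cancel, so that the condition on delta reads delta <= dmax. *)
exists (dmax `^ (1 - (2 * alpha + alpha'))); split; first exact: powR_gt0.
move=> delta /andP[de0 ded0].
rewrite -powRrM mul1r divff // powRr1 ?(ltW dmax0) // => dle.
have ddmax : 0 <= delta <= dmax by rewrite (ltW de0).
have [cdW cd0 dd0 dd2] := small_delta_bounds hc al0 hdeltaW d00 ddmax.
have ddW : 0 < delta <= deltaW.
  by rewrite de0 (le_trans ded0) //; case/andP: hdelta0.
have K0 : 0 < C / delta `^ (1 + alpha') by rewrite divr_gt0 // powR_gt0.
have [ld [rd [ld0 rd0 H]]] := close_at_center N0 cW_cont W0 Wa Wrot hM hdeltaW hcW hquad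
  Wmaxb Wmax0 HG kap0 Hkap sepa ddW cdW cd0 dd0 dd2 d00 K0.
exists ld, rd; split=> // rho u Du l x0 Sigma rho0 mini _ lO _ _ close SK ll rx.
apply: ltW; apply: (H rho u Du l x0 Sigma) => //.
  exact: minimizer_ae_bounded hbound rho0 mini.
by move=> x xl nS; apply: close => // -[].
Qed.
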